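(* Consider the impulsive system $$\dot x=f(x)+\varepsilon g(t,x,\varepsilon)\ \ (t\ne t_k),\qquad x(t_k+)-x(t_k-)=\varepsilon\, l_k(x(t_k-),\varepsilon)\ \ (k\in\mathbb Z),\qquad (S_\varepsilon)$$ with the standing assumptions and notation of the context (the planar Hamiltonian vector field $f$ with its family of periodic orbits $L_h$, $h\in V$, of period $T(h)$, the impulse data $t_k,l_k$, the period $T$). Suppose that for every $h\in V$ $$T(h)=T_0,\qquad \frac{T_0}{T}=\frac mK,$$ where $T_0$ is a constant and $m,K\ge1$ are coprime integers. Let $M,N$ be the functions defined in the context. Then: (1) For small $\varepsilon\ne0$, a necessary condition for $(S_\varepsilon)$ to have a subharmonic solution of order $m$ (near the family of periodic orbits) is that there exist $t_0^*\in[0,T_0]$ and $h_0\in V$ such that $$M(t_0^*,h_0)=0,\qquad N(t_0^*,h_0)=0.$$ That is: if for some $\hat h\in V$ the system $(S_\varepsilon)$ has, for all sufficiently small $\varepsilon\neq0$, an $mT$-periodic solution $x_\varepsilon$ with $\sup_{t\in\mathbb R}\operatorname{dist}(x_\varepsilon(t),L_{\hat h})\to0$ as $\varepsilon\to0$, then such $t_0^*$ and $h_0$ exist. (2) Suppose $t_0^*\in[0,T_0]$ and $h_0\in V$ satisfy $M(t_0^*,h_0)=N(t_0^*,h_0)=0$, and suppose that $$J=\det\begin{pmatrix}\dfrac{\partial M}{\partial\bar t_0}&\dfrac{\partial M}{\partial r}\\[2mm]\dfrac{\partial N}{\partial\bar t_0}&\dfrac{\partial N}{\partial r}\end{pmatrix}\Bigg|_{(\bar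 t_0,r)=(t_0^*,h_0)}\neq0 .$$ Then there is $\varepsilon_0>0$ such that for every $\varepsilon$ with $0<|\varepsilon|<\varepsilon_0$ the system $(S_\varepsilon)$ has a subharmonic (if $m>1$) or harmonic (if $m=1$) solution $x_\varepsilon(t)$ of order $m$, with the property $$\lim_{\varepsilon\to0}x_\varepsilon(t)=q(t-t_0^*,h_0).$$
   Context: Setting. $x=(x_1,x_2)^\top\in\mathbb R^2$, and $\varepsilon\in\mathbb R$ is a small parameter. The functions $f(x)$ and $g(t,x,\varepsilon)$ are of class $C^{r_0}$ with $r_0\ge3$, and $g$ is periodic in $t$ of period $T_1>0$. There is a function $H:\mathbb R^2\to\mathbb R$ of class $C^{r_1}$, $r_1\ge4$, with $f=(H_{x_2},-H_{x_1})^\top$; $DH=(H_{x_1},H_{x_2})$ denotes the row-vector gradient. There is an open interval $V$ such that for each $h\in V$ the level set $\{H=h\}$ contains a smooth closed curve $L_h$ which is a periodic orbit of $\dot x=f(x)$ with period $T(h)$. Put $\Omega(h)=2\pi/T(h)$. For each $h\in V$, $t\mapsto q(t,h)$ is a $T(h)$-periodic solution of $\dot x=f(x)$ parametrizing $L_h$ (by time), where the parametrization is chosen so that $G(\theta,h)=q(\theta/\Omega(h),h)$ ($2\pi$-periodic in $\theta$) is of class $C^{r_0}$ in $(\theta,h)$. Let $\alpha(\theta,h)$ be the unique $1\times2$ row vector ($2\pi$-periodic in $\theta$) with $$\alpha(\theta,h)\,D_hG(\theta,h)=0,\qquad \alpha(\theta,h)\,D_\theta G(\theta,h)=1,$$ where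 $D_hG,D_\theta G$ are the partial derivatives (column vectors) of $G$. Impulses. (i) $\cdots<t_{-1}<t_0<t_1<\cdots$ with $t_n\to\pm\infty$ as $n\to\pm\infty$. (ii) There are a constant $T_2>0$ and an integer $\nu\ge1$ with $t_{k+\nu}-t_k=T_2$ and $l_{k+\nu}=l_k$ for all $k\in\mathbb Z$. (iii) $T_2/T_1=p/s$ with $p,s\ge1$ coprime integers; put $T=pT_1=sT_2$, so that the system $(S_\varepsilon)$ is $T$-periodic in time. (iv) Each $l_k(x,\varepsilon)\in\mathbb R^2$ is $C^{r_0}$ in $x$ and continuous in $(x,\varepsilon)$. Solutions of $(S_\varepsilon)$ are piecewise continuous functions of $t$: they satisfy the differential equation on each interval $(t_{k-1},t_k)$, are continuous from the left at each $t_k$, and have discontinuities of the first kind at $t_k$ satisfying the jump condition. A solution $x(t)$ with $x((t+mT)\pm)=x(t\pm)$ for all $t\in\mathbb R$ (i.e. $mT$-periodic) is called harmonic if $m=1$ and subharmonic of order $m$ if $m>1$. Melnikov functions. For $r\in V$ and $\bar t_0\in(t_{j-1},t_j]$, $j\in\mathbb Z$, $$M(\bar t_0,r)=\int_{\bar t_0}^{\bar t_0+mT}DH(q(\tau-\bar t_0,r))\,g(\tau,q(\tau-\bar t_0,r),0)\,d\tau+\sum_{k=j}^{j+ms\nu-1}DH(q(t_k-\bar t_0,r))\,l_k(q(t_k-\bar t_0,r),0),$$ $$N(\bar t_0,r)=\int_{\bar t_0}^{\bar t_0+mT}\alpha\Big(\tfrac{2\pi}{T_0}(\tau-\bar t_0),r\Big)g(\tau,q(\tau-\bar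 t_0,r),0)\,d\tau+\sum_{k=j}^{j+ms\nu-1}\alpha\Big(\tfrac{2\pi}{T_0}(t_k-\bar t_0),r\Big)l_k(q(t_k-\bar t_0,r),0).$$ *)

(* Defs.v *)
From Stdlib Require Import Reals ZArith ClassicalEpsilon.
From Coquelicot Require Import Coquelicot.
Open Scope R_scope.

Definition is_open_interval (V : R -> Prop) : Prop :=
  exists a b : Rbar, forall h : R, V h <-> Rbar_lt a h /\ Rbar_lt h b.

(** Class [C^k] on an open set [D] of a finite-dimensional space: all iterated
    directional derivatives of order at most [k] exist and are continuous on
    [D].  (Quantifying over all directions [v] rather than over the vectors of
    a basis makes the definition independent of coordinates.) *)
Fixpoint Ck_on {U W : NormedModule R_AbsRing} (k : nat) (D : U -> Prop)
    (F : U -> W) : Prop :=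
  (forall u : U, D u -> continuous F u) /\
  match k with
  | O => True
  | S k' =>
      forall v : U, exists dF : U -> W,
        (forall u : U, D u ->
           is_derive (fun s : R => F (plus u (scal s v))) 0 (dF u)) /\
        Ck_on k' D dF
  end.

Definition Ck {U W : NormedModule R_AbsRing} (k : nat) (F : U -> W) : Prop :=
  Ck_on k (fun _ : U => True) F.

(** Product of a row vector and a column vector, both stored as pairs. *)
Definition rowcol (a b : R * R) : R := fst a * fst b + snd a * snd b.

Definition det2 (a b c d : R) : R := a * d - b * c.

Definition grad (H : R * R -> R) (x : R * R) : R * R :=
  (Derive (fun s => H (s, snd x)) (fst x),
   Derive (fun s => H (fst x, s)) (snd x)).

Definition hamiltonian_field (H : R * R -> R) (x : R * R) : R * R :=
  (snd (grad H x), - fst (grad H x)).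

Definition Dcurve (c : R -> R * R) (t : R) : R * R :=
  (Derive (fun s => fst (c s)) t, Derive (fun s => snd (c s)) t).

(** In what follows [Th] is the period function [h |-> T(h)] and [q t h] is the
    time parametrization of the orbit [L_h]. *)
Definition Omega (Th : R -> R) (h : R) : R := 2 * PI / Th h.

Definition Gmap (Th : R -> R) (q : R -> R -> R * R) (theta h : R) : R * R :=
  q (theta / Omega Th h) h.

Definition orbit (q : R -> R -> R * R) (h : R) : R * R -> Prop :=
  fun y => exists t : R, y = q t h.

(** Each [q(.,h)], [h] in [V], is a [T(h)]-periodic solution of [x' = f(x)] lying
    in [{H = h}], and [G] is [C^r] in [(theta,h)].  Equilibria are excluded:
    differentiating [H (G theta h) = h] in [h] shows [DH <> 0] on the orbits. *)
Definition periodic_family (r : nat) (H : R * R -> R) (f : R * R -> R * R)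
    (V : R -> Prop) (Th : R -> R) (q : R -> R -> R * R) : Prop :=
  (forall h, V h -> 0 < Th h) /\
  (forall h t, V h -> is_derive (fun s => q s h) t (f (q t h))) /\
  (forall h t, V h -> q (t + Th h) h = q t h) /\
  (forall h t, V h -> H (q t h) = h) /\
  Ck_on r (fun u : R * R => V (snd u))
    (fun u : R * R => Gmap Th q (fst u) (snd u)).

Definition is_alpha (V : R -> Prop) (G : R -> R -> R * R)
    (alpha : R -> R -> R * R) : Prop :=
  forall theta h, V h ->
    rowcol (alpha theta h) (Dcurve (fun h' => G theta h') h) = 0 /\
    rowcol (alpha theta h) (Dcurve (fun theta' => G theta' h) theta) = 1 /\
    alpha (theta + 2 * PI) h = alpha theta h.

Definition impulse_times (tk : Z -> R) : Prop :=
  (forall k, tk k < tk (k + 1)%Z) /\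
  (forall B, exists n0, forall n, (n0 <= n)%Z -> B < tk n) /\
  (forall B, exists n0, forall n, (n <= n0)%Z -> tk n < B).

(** Solutions of the impulsive system; continuity from the left makes
    [x (tk k)] the left limit at [tk k]. *)
Definition is_solution (f : R * R -> R * R) (g : R -> R * R -> R -> R * R)
    (tk : Z -> R) (l : Z -> R * R -> R -> R * R) (eps : R)
    (x : R -> R * R) : Prop :=
  (forall k t, tk (k - 1)%Z < t < tk k ->
     is_derive x t (plus (f (x t)) (scal eps (g t (x t) eps)))) /\
  (forall k, filterlim x (at_left (tk k)) (locally (x (tk k)))) /\
  (forall k, exists xplus : R * R,
     filterlim x (at_right (tk k)) (locally xplus) /\
     minus xplus (x (tk k)) = scal eps (l k (x (tk k)) eps)).

(** Harmonic solutions ([m = 1]) and subharmonic solutions of order [m]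
    ([m > 1]) of the [T]-periodic system. *)
Definition is_subharmonic (f : R * R -> R * R) (g : R -> R * R -> R -> R * R)
    (tk : Z -> R) (l : Z -> R * R -> R -> R * R) (T : R) (m : nat) (eps : R)
    (x : R -> R * R) : Prop :=
  is_solution f g tk l eps x /\ forall t, x (t + INR m * T) = x t.

(** The [j] such that [t0] lies in [(tk (j-1), tk j]]; it exists and is unique
    under [impulse_times tk]. *)
Definition impulse_index (tk : Z -> R) (t0 : R) : Z :=
  epsilon (inhabits 0%Z) (fun j => tk (j - 1)%Z < t0 <= tk j).

(** Common shape of the two Melnikov functions: integral over an interval of
    length [len] and sum over [n] consecutive impulses (so [n >= 1]; [sum_n]
    includes its last index), with row-vector weight [w]. *)
Definition melnikov (w q : R -> R -> R * R) (g : R -> R * R -> R -> R * R)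
    (tk : Z -> R) (l : Z -> R * R -> R -> R * R) (len : R) (n : nat)
    (t0 r : R) : R :=
  RInt (fun tau => rowcol (w (tau - t0) r) (g tau (q (tau - t0) r) 0))
    t0 (t0 + len)
  + sum_n (fun i =>
      let k := (impulse_index tk t0 + Z.of_nat i)%Z in
      rowcol (w (tk k - t0) r) (l k (q (tk k - t0) r) 0)) (n - 1).

Definition melnikovM (H : R * R -> R) (q : R -> R -> R * R)
    (g : R -> R * R -> R -> R * R) (tk : Z -> R)
    (l : Z -> R * R -> R -> R * R) (len : R) (n : nat) : R -> R -> R :=
  melnikov (fun t r => grad H (q t r)) q g tk l len n.

Definition melnikovN (alpha : R -> R -> R * R) (T0 : R)
    (q : R -> R -> R * R) (g : R -> R * R -> R -> R * R) (tk : Z -> R)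
    (l : Z -> R * R -> R -> R * R) (len : R) (n : nat) : R -> R -> R :=
  melnikov (fun t r => alpha (2 * PI / T0 * t) r) q g tk l len n.

(** Distance to a nonempty set. *)
Definition dist_to (L : R * R -> Prop) (x : R * R) : R :=
  real (Glb_Rbar (fun d => exists y, L y /\ d = norm (minus x y))).

Definition sup_dist (x : R -> R * R) (L : R * R -> Prop) : Rbar :=
  Lub_Rbar (fun d => exists t : R, d = dist_to L (x t)).

(* Main.v *)
(** Idea. Compare a solution [x] of the perturbed system with the unperturbed
    orbit [q(t - t0, r)] through the same initial point.  The row vectors
    [DH(q)] and [alpha] solve the adjoint variational equation along the orbit,
    so for either of them the derivative of [w . (x - q)] is [eps w . g] up to
    [o(eps)], and over [m T], which is a period of every orbit, [w . (x - q)]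
    grows by [eps] times the corresponding Melnikov function, up to [o(eps)],
    uniformly in [(t0, r)].  As the two rows are linearly independent, [x] is
    [m T]-periodic iff both increments vanish.  This gives (1) in the limit.
    For (2), the impulses are merely continuous in [(x, eps)], so the rescaled
    increments converge to [(M, N)] uniformly but not in [C^1]; the zero near a
    simple zero of [(M, N)] is therefore obtained from the Poincaré–Miranda
    theorem and not from the implicit function theorem. *)
Require Import Defs.
From Stdlib Require Import Reals ZArith.
From Coquelicot Require Import Coquelicot.
From Stdlib Require Import Lra Lia Classical ClassicalEpsilon.
Open Scope R_scope.

Local Notation R2 := (prod_NormedModule R_AbsRing R_NormedModule R_NormedModule).
Local Notation R3 := (prod_NormedModule R_AbsRing R_NormedModule R2).

(** The windows in [M] and [N] move with [t0], and the first impulse index jumps when [t0] crosses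
    an impulse time. Periodicity moves both to the window from [tk 0] to [tk n], [n = m s nu], whose
    impulses are fixed, so that differentiability in [(t0, r)] becomes visible. Initial values at
    [tk 0] are written as [q (tk 0 - t0) r]. Differentiating [H (q t h) = h] in [h] gives
    [f1 p2 - f2 p1 = 1] for [(p1, p2) = D_h q]; this identity makes [(t0, r)] local coordinates, the
    two weights independent, and [alpha] a multiple of [(p2, - p1)].

    Solutions need not exist on the whole window, so the field and the impulses are composed with a
    retraction onto a box one unit larger than one holding the reference orbits; for small [eps] the
    retraction is inert. In (1) the common zero is found at [h0 = hhat]. In (2) Poincaré-Miranda
    gives neither uniqueness nor a continuous choice of zeros, so for each [eps] a zero almost as
    close to [(t0, h0)] as possible is taken, which forces convergence. *)

Lemma ball_R (x d y : R) : ball x d y <-> Rabs (y - x) < d.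
Proof. reflexivity. Qed.

(** Compactness as a local-to-uniform principle: a property with a radius
    parameter that holds locally with some radius holds with a common one. *)
Definition cpt {U : UniformSpace} (A : U -> Prop) : Prop :=
  forall Q : U -> R -> Prop,
    (forall x d d', Q x d -> 0 < d' <= d -> Q x d') ->
    (forall x, A x -> exists d, 0 < d /\ forall y, A y -> ball x d y -> Q y d) ->
    exists d, 0 < d /\ forall y, A y -> Q y d.

(** Choice turns the local radii into a gauge, to which the Lebesgue-number statement
    [compactness_value_1d] applies. *)
Lemma cpt_interval (a b : R) : cpt (fun t : R => a <= t <= b).
Proof.
  intros Q Hmono Hloc.
  assert (Hch : forall t, exists d : posreal, a <= t <= b ->
      forall y, a <= y <= b -> ball t d y -> Q y d).
  { intros t. destruct (classic (a <= t <= b)) as [Ht|Ht].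
    - destruct (Hloc t Ht) as (d & Hd & H). exists (mkposreal d Hd). auto.
    (* Default radius at points outside the interval, which the compactness lemma never selects. *)
    - exists (mkposreal 1 Rlt_0_1). tauto. }
  pose (delta t := proj1_sig (constructive_indefinite_description _ (Hch t))).
  destruct (compactness_value_1d a b delta) as [d Hd].
  exists d. split. apply cond_pos.
  intros y Hy. apply NNPP. intro Hn. apply (Hd y Hy). intros (t & Ht & Hyt & Hdt).
  apply Hn. apply Hmono with (delta t).
  - unfold delta in *.
    destruct (constructive_indefinite_description _ (Hch t)) as [dt Hdt']; simpl in *.
    apply Hdt'; trivial.
  - split; [apply cond_pos | trivial].
Qed.

(** The tube lemma: compactness of the second factor gives a radius valid on a whole strip around
    [x1], and compactness of the first factor makes it independent of the strip. *)
Lemma cpt_prod {U1 U2 : UniformSpace} (A1 : U1 -> Prop) (A2 : U2 -> Prop) :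
  cpt A1 -> cpt A2 -> cpt (fun x : U1 * U2 => A1 (fst x) /\ A2 (snd x)).
Proof.
  intros H1 H2 Q Hmono Hloc.
  destruct (H1 (fun y1 d => forall y2, A2 y2 -> Q (y1, y2) d)) as (d & Hd & H).
  - intros x d d' HQ Hd y2 Hy2. apply Hmono with d; auto.
  - intros x1 Hx1.
    destruct (H2 (fun y2 d => forall y1, A1 y1 -> ball x1 d y1 -> Q (y1, y2) d))
      as (d & Hd & H).
    + intros x d d' HQ Hd y1 Hy1 Hb. apply Hmono with d; auto. apply HQ; auto.
      apply ball_le with d'; [apply Hd | trivial].
    + intros x2 Hx2. destruct (Hloc (x1, x2)) as (d & Hd & H). now split.
      exists d. split; [trivial|]. intros y2 Hy2 Hb y1 Hy1 Hb1. apply H; now split.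
    + exists d. split; [trivial|]. intros y1 Hy1 Hb y2 Hy2. now apply H.
  - exists d. split; [trivial|]. intros [y1 y2] [Hy1 Hy2]. now apply H.
Qed.

(** The second point [z] may leave [A], because continuity is that of [F] on the whole space. This
    matters later, where only the reference orbit lies in the compact set. *)
Lemma cpt_unif_cont {U W : UniformSpace} (A : U -> Prop) (F : U -> W) (eta : R) :
  cpt A -> (forall x, A x -> continuous F x) -> 0 < eta ->
  exists d, 0 < d /\ forall y, A y -> forall z, ball y d z -> ball (F y) eta (F z).
Proof.
  intros HA HF He.
  apply (HA (fun y d => forall z, ball y d z -> ball (F y) eta (F z))).
  - intros x d d' HQ Hd z Hz. apply HQ. apply ball_le with d'; [apply Hd | trivial].
  - intros x Hx. assert (He2 : 0 < eta / 2) by lra.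
    destruct (proj1 (filterlim_locally _ _) (HF x Hx) (mkposreal _ He2)) as [d Hd].
    simpl in Hd. pose proof (cond_pos d) as Hdp. exists (d / 2). split; [lra|].
    intros y Hy Hb z Hz. replace eta with (eta / 2 + eta / 2) by lra.
    apply ball_triangle with (F x).
    + apply ball_sym, Hd. apply ball_le with (d / 2); [lra | trivial].
    + apply Hd. replace (pos d) with (d / 2 + d / 2) by lra.
      now apply ball_triangle with y.
Qed.

Lemma cpt_bounded {U : UniformSpace} (A : U -> Prop) (F : U -> R) :
  cpt A -> (forall x, A x -> continuous F x) ->
  exists B, 0 < B /\ forall y, A y -> Rabs (F y) <= B.
Proof.
  intros HA HF.
  (* Writing the bound as the inverse of the radius makes it weaker as [d] shrinks, as [cpt]
     demands. *)
  destruct (HA (fun y d => Rabs (F y) <= / d)) as (d & Hd & H).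
  - intros x d d' HQ Hd. apply Rle_trans with (1 := HQ). apply Rinv_le_contravar; lra.
  - intros x Hx.
    destruct (proj1 (filterlim_locally _ _) (HF x Hx) (mkposreal _ Rlt_0_1)) as [d Hd].
    simpl in Hd. pose proof (cond_pos d) as Hdp. pose proof (Rabs_pos (F x)) as Hp.
    set (c := / (Rabs (F x) + 1)). assert (Hc : 0 < c) by (apply Rinv_0_lt_compat; lra).
    exists (Rmin d c). split. apply Rmin_pos; lra.
    intros y Hy Hb.
    assert (Hy1 : Rabs (F y - F x) < 1).
    { apply (Hd y). apply ball_le with (Rmin d c); [apply Rmin_l | trivial]. }
    apply Rle_trans with (Rabs (F x) + 1).
    + replace (F y) with ((F y - F x) + F x) by ring.
      apply Rle_trans with (1 := Rabs_triang _ _). lra.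
    + replace (Rabs (F x) + 1) with (/ c) by (unfold c; rewrite Rinv_inv; lra).
      apply Rinv_le_contravar. apply Rmin_pos; lra. apply Rmin_r.
  - exists (/ d). split. now apply Rinv_0_lt_compat. exact H.
Qed.

(** * The Poincaré–Miranda theorem in the plane *)

Fixpoint zsum (F : nat -> Z) (n : nat) : Z :=
  match n with O => 0%Z | S k => (zsum F k + F k)%Z end.

Lemma zsum_ext (F F' : nat -> Z) n :
  (forall i, (i < n)%nat -> F i = F' i) -> zsum F n = zsum F' n.
Proof.
  induction n as [|n IH]; intros H; simpl; [trivial|].
  rewrite IH, H; auto with arith.
Qed.

Lemma zsum_minus (F F' : nat -> Z) n :
  zsum (fun i => F i - F' i)%Z n = (zsum F n - zsum F' n)%Z.
Proof. induction n; simpl; lia. Qed.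

Lemma zsum_tele (F : nat -> Z) n :
  zsum (fun i => F (S i) - F i)%Z n = (F n - F O)%Z.
Proof. induction n; simpl; lia. Qed.

(** The 1-cochain of the degree proof of Sperner's lemma: a signed count of 01-edges whose sum
    around a triangle can be nonzero only if all three labels occur. *)
Definition edge (a b : Z) : Z :=
  if (Z.eqb a 0 && Z.eqb b 1)%bool then 1%Z
  else if (Z.eqb a 1 && Z.eqb b 0)%bool then (-1)%Z else 0%Z.

Definition label (a : Z) : Prop := (a = 0 \/ a = 1 \/ a = 2)%Z.

Definition rainbow (a b c : Z) : Prop :=
  (a <> b /\ b <> c /\ a <> c)%Z.

Lemma edge_triangle a b c : label a -> label b -> label c ->
  ~ rainbow a b c -> (edge a b + edge b c + edge c a = 0)%Z.
Proof.
  unfold label, rainbow.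
  intros [->|[->| ->]] [->|[->| ->]] [->|[->| ->]] Hn;
    try reflexivity; exfalso; apply Hn; repeat split; discriminate.
Qed.

Lemma edge_antisym a b : label a -> label b -> edge b a = (- edge a b)%Z.
Proof. unfold label. intros [->|[->| ->]] [->|[->| ->]]; reflexivity. Qed.

(** Discrete Stokes: the signed count of 01-edges along the boundary, here 1, is
    the sum of the counts around the triangles. *)
Lemma sperner_grid (c : nat -> nat -> Z) (n : nat) :
  (forall i j, label (c i j)) ->
  (forall i, (i <= n)%nat -> c i O <> 2%Z) -> c O O = 0%Z -> c n O = 1%Z ->
  (forall i, (i <= n)%nat -> c i n = 2%Z) ->
  (forall j, (j <= n)%nat -> c O j <> 1%Z) ->
  (forall j, (j <= n)%nat -> c n j <> 0%Z) ->
  exists i j, (i < n)%nat /\ (j < n)%nat /\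
    (rainbow (c i j) (c (S i) j) (c i (S j)) \/
     rainbow (c (S i) (S j)) (c i (S j)) (c (S i) j)).
Proof.
  intros Hl Hbot H0 H1 Htop Hleft Hright.
  apply NNPP. intro Hn.
  set (h i j := edge (c i j) (c (S i) j)).
  set (v i j := edge (c i j) (c i (S j))).
  assert (Hcell : forall i j, (i < n)%nat -> (j < n)%nat ->
            (v (S i) j - v i j = h i (S j) - h i j)%Z).
  { intros i j Hi Hj.
    assert (E1 : (edge (c i j) (c (S i) j) + edge (c (S i) j) (c i (S j))
                 + edge (c i (S j)) (c i j) = 0)%Z).
    { apply edge_triangle; auto. intro Hr. apply Hn. exists i, j. auto. }
    assert (E2 : (edge (c (S i) (S j)) (c i (S j)) + edge (c i (S j)) (c (S i) j)
                 + edge (c (S i) j) (c (S i) (S j)) = 0)%Z).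
    { apply edge_triangle; auto. intro Hr. apply Hn. exists i, j. auto. }
    pose proof (edge_antisym (c i j) (c i (S j)) (Hl _ _) (Hl _ _)).
    pose proof (edge_antisym (c i (S j)) (c (S i) (S j)) (Hl _ _) (Hl _ _)).
    pose proof (edge_antisym (c i (S j)) (c (S i) j) (Hl _ _) (Hl _ _)).
    unfold h, v. lia. }
  (* The signed count along row [j]. No label 1 occurs on the left side and no label 0 on the right,
     so the vertical edges there contribute nothing and, without rainbow triangles, all rows have
     the same count. *)
  set (W j := zsum (fun i => h i j) n).
  assert (HW : forall j, (j < n)%nat -> W (S j) = W j).
  { intros j Hj. unfold W.
    assert (E : (zsum (fun i => h i (S j)) n - zsum (fun i => h i j) n
                 = v n j - v O j)%Z).
    { rewrite <- zsum_minus, <- (zsum_tele (fun i => v i j)). apply zsum_ext.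
      intros i Hi. symmetry. now apply Hcell. }
    assert (v n j = 0%Z).
    { unfold v. pose proof (Hright j ltac:(lia)). pose proof (Hright (S j) ltac:(lia)).
      destruct (Hl n j) as [E'|[-> | ->]], (Hl n (S j)) as [E''|[-> | ->]];
        try contradiction; reflexivity. }
    assert (v O j = 0%Z).
    { unfold v. pose proof (Hleft j ltac:(lia)). pose proof (Hleft (S j) ltac:(lia)).
      destruct (Hl O j) as [-> |[E'| ->]], (Hl O (S j)) as [-> |[E''| ->]];
        try contradiction; reflexivity. }
    lia. }
  assert (HWn : forall j, (j <= n)%nat -> W j = W O).
  { induction j; intros; [trivial|]. rewrite HW by lia. apply IHj. lia. }
  assert (HW0 : W O = 1%Z).
  (* Without the label 2 on the bottom row, [edge a b] is just [b - a], and the sum telescopes to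
     1. *)
  { unfold W. rewrite (zsum_ext _ (fun i => c (S i) O - c i O)%Z).
    - rewrite (zsum_tele (fun i => c i O)), H0, H1. reflexivity.
    - intros i Hi. unfold h. pose proof (Hbot i ltac:(lia)). pose proof (Hbot (S i) ltac:(lia)).
      destruct (Hl i O) as [-> |[-> | E]], (Hl (S i) O) as [-> |[-> | E']];
        try contradiction; reflexivity. }
  assert (HWt : W n = 0%Z).
  { unfold W. rewrite (zsum_ext _ (fun i => 0 - 0)%Z).
    - rewrite zsum_minus. lia.
    - intros i Hi. unfold h. rewrite !Htop by lia. reflexivity. }
  rewrite (HWn n) in HWt by lia. lia.
Qed.

(** If there were no common zero, some [eta] would satisfy [eta < |E1|] or [eta < |E2|] everywhere
    on the square. Sperner's lemma on a grid finer than the modulus of continuity for [eta] yields a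
    small triangle on which both functions change sign, so both are smaller than [eta] at one
    vertex. *)
Lemma miranda_unit (E1 E2 : R * R -> R) :
  (forall x, 0 <= fst x <= 1 /\ 0 <= snd x <= 1 -> continuous E1 x) ->
  (forall x, 0 <= fst x <= 1 /\ 0 <= snd x <= 1 -> continuous E2 x) ->
  (forall t, 0 <= t <= 1 -> E1 (0, t) < 0 < E1 (1, t)) ->
  (forall t, 0 <= t <= 1 -> E2 (t, 0) < 0 < E2 (t, 1)) ->
  exists x, (0 <= fst x <= 1 /\ 0 <= snd x <= 1) /\ E1 x = 0 /\ E2 x = 0.
Proof.
  intros HE1 HE2 Hs1 Hs2. apply NNPP. intro Hn.
  set (A := fun x : R * R => 0 <= fst x <= 1 /\ 0 <= snd x <= 1).
  assert (HA : cpt A) by exact (cpt_prod _ _ (cpt_interval 0 1) (cpt_interval 0 1)).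
  assert (Habs : exists d, 0 < d /\ forall y, A y -> d < Rabs (E1 y) \/ d < Rabs (E2 y)).
  { apply HA.
    - intros x d d' [H|H] Hd; [left|right]; lra.
    - intros x Hx.
      assert (Hpos : forall E : R * R -> R, continuous E x -> E x <> 0 ->
         exists d, 0 < d /\ forall y, A y -> ball x d y -> d < Rabs (E y)).
      { intros E HE H0. apply Rabs_pos_lt in H0.
        assert (H2 : 0 < Rabs (E x) / 2) by lra.
        destruct (proj1 (filterlim_locally _ _) HE (mkposreal _ H2)) as [d Hd].
        simpl in Hd. pose proof (cond_pos d).
        exists (Rmin d (Rabs (E x) / 2)). split. apply Rmin_pos; lra.
        intros y Hy Hb. apply Rle_lt_trans with (1 := Rmin_r _ _).
        assert (Hb' : Rabs (E y - E x) < Rabs (E x) / 2).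
        { apply (Hd y). apply ball_le with (2 := Hb). apply Rmin_l. }
        pose proof (Rabs_triang_inv (E x) (E x - E y)) as Ht.
        rewrite (Rabs_minus_sym (E x)) in Ht.
        replace (E x - (E x - E y)) with (E y) in Ht by ring. lra. }
      destruct (classic (E1 x = 0)) as [H1|H1].
      + destruct (classic (E2 x = 0)) as [H2|H2].
        * exfalso. apply Hn. exists x. auto.
        * destruct (Hpos E2) as (d & Hd & H); auto. exists d. split; auto.
      + destruct (Hpos E1) as (d & Hd & H); auto. exists d. split; auto. }
  destruct Habs as (eta & Heta & Habs).
  destruct (cpt_unif_cont A E1 eta HA HE1 Heta) as (d1 & Hd1 & HU1).
  destruct (cpt_unif_cont A E2 eta HA HE2 Heta) as (d2 & Hd2 & HU2).
  set (d := Rmin d1 d2). assert (Hd : 0 < d) by (apply Rmin_pos; lra).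
  destruct (nfloor_ex (/ (d / 2))) as [n' Hn'].
  { left. apply Rinv_0_lt_compat. lra. }
  set (n := S n').
  assert (Hnp : 0 < INR n) by (apply lt_0_INR; unfold n; lia).
  assert (Hnd : / INR n < d).
  { assert (/ (d/2) < INR n) by (unfold n; rewrite S_INR; lra).
    apply Rlt_le_trans with (d / 2); [|lra].
    rewrite <- (Rinv_inv (d / 2)). apply Rinv_lt_contravar; trivial.
    apply Rmult_lt_0_compat; trivial. apply Rinv_0_lt_compat. lra. }
  set (P i j := (INR i / INR n, INR j / INR n) : R * R).
  assert (Hgrid : forall i, (i <= n)%nat -> 0 <= INR i / INR n <= 1).
  { intros i Hi. split.
    - apply Rmult_le_pos. apply pos_INR. left. now apply Rinv_0_lt_compat.
    - apply (Rmult_le_reg_r (INR n)); trivial. unfold Rdiv.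
      rewrite Rmult_assoc, Rinv_l, Rmult_1_r, Rmult_1_l by lra. now apply le_INR. }
  assert (HPA : forall i j, (i <= n)%nat -> (j <= n)%nat -> A (P i j)).
  { intros. split; simpl; auto. }
  (* Label 0 means both values are negative, label 1 that [E1 >= 0 > E2], label 2 that [E2 >= 0].
     The face conditions of Miranda become the boundary conditions of Sperner. *)
  set (c i j := if Rle_dec 0 (E2 (P i j)) then 2%Z
                else if Rle_dec 0 (E1 (P i j)) then 1%Z else 0%Z).
  assert (P0 : INR 0 / INR n = 0) by (change (INR 0) with 0; field; lra).
  assert (Pn : INR n / INR n = 1) by (field; lra).
  destruct (sperner_grid c n) as (i & j & Hi & Hj & Hr).
  - intros i j. unfold c, label. repeat destruct (Rle_dec _ _); auto.
  - intros i Hi. unfold c. pose proof (Hs2 _ (Hgrid i Hi)) as Hs.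
    unfold P. rewrite P0. destruct (Rle_dec _ _); [lra|].
    destruct (Rle_dec _ _); discriminate.
  - unfold c, P. rewrite P0. pose proof (Hs1 0). pose proof (Hs2 0).
    destruct (Rle_dec _ _); [lra|]. destruct (Rle_dec _ _); [lra|]. reflexivity.
  - unfold c, P. rewrite P0, Pn. pose proof (Hs1 0). pose proof (Hs2 1).
    destruct (Rle_dec _ _); [lra|]. destruct (Rle_dec _ _); [|lra]. reflexivity.
  - intros i Hi. unfold c, P. rewrite Pn. pose proof (Hs2 _ (Hgrid i Hi)).
    destruct (Rle_dec _ _); [|lra]. reflexivity.
  - intros j Hj. unfold c, P. rewrite P0. pose proof (Hs1 _ (Hgrid j Hj)).
    destruct (Rle_dec _ _); [discriminate|]. destruct (Rle_dec _ _); [lra|discriminate].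
  - intros j Hj. unfold c, P. rewrite Pn. pose proof (Hs1 _ (Hgrid j Hj)).
    destruct (Rle_dec _ _); [discriminate|]. destruct (Rle_dec _ _); [discriminate|lra].
  - assert (Hclose : forall i' j' i'' j'', (i' <= S i'')%nat -> (i'' <= S i')%nat ->
        (j' <= S j'')%nat -> (j'' <= S j')%nat -> ball (P i' j') d (P i'' j'')).
    { assert (Hone : forall a b, (a <= S b)%nat -> (b <= S a)%nat ->
         Rabs (INR b / INR n - INR a / INR n) < d).
      { intros a b Hab Hba. replace (INR b / INR n - INR a / INR n)
          with ((INR b - INR a) * / INR n) by (field; lra).
        rewrite Rabs_mult, (Rabs_pos_eq (/ INR n)) by (left; now apply Rinv_0_lt_compat).
        apply Rle_lt_trans with (2 := Hnd).
        rewrite <- (Rmult_1_l (/ INR n)) at 2. apply Rmult_le_compat_r.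
        left; now apply Rinv_0_lt_compat.
        apply le_INR in Hab. apply le_INR in Hba. rewrite S_INR in *.
        apply Rabs_le. lra. }
      intros. split; simpl; apply Hone; trivial. }
    (* At the vertex labelled 0 both functions are negative, but within [eta] of the nonnegative
       values [E1] at the vertex labelled 1 and [E2] at the vertex labelled 2. *)
    assert (Hsmall : forall i0 j0 i1 j1 i2 j2,
        A (P i0 j0) -> A (P i1 j1) -> A (P i2 j2) ->
        ball (P i0 j0) d (P i1 j1) -> ball (P i0 j0) d (P i2 j2) ->
        ball (P i1 j1) d (P i0 j0) -> ball (P i1 j1) d (P i2 j2) ->
        ball (P i2 j2) d (P i0 j0) -> ball (P i2 j2) d (P i1 j1) ->
        ~ (c i0 j0 = 0%Z /\ c i1 j1 = 1%Z /\ c i2 j2 = 2%Z)).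
    { intros i0 j0 i1 j1 i2 j2 A0 A1 A2 B01 B02 _ _ _ _ (C0 & C1 & C2).
      assert (HB : forall y, ball (P i0 j0) d y ->
         Rabs (E1 y - E1 (P i0 j0)) < eta /\ Rabs (E2 y - E2 (P i0 j0)) < eta).
      { intros y Hy. split.
        - apply HU1; trivial. apply ball_le with (2 := Hy). apply Rmin_l.
        - apply HU2; trivial. apply ball_le with (2 := Hy). apply Rmin_r. }
      destruct (HB _ B01) as [K1 _]. destruct (HB _ B02) as [_ K2].
      unfold c in C0, C1, C2.
      destruct (Rle_dec 0 (E2 (P i0 j0))); [discriminate|].
      destruct (Rle_dec 0 (E1 (P i0 j0))); [discriminate|].
      destruct (Rle_dec 0 (E2 (P i1 j1))); [discriminate|].
      destruct (Rle_dec 0 (E1 (P i1 j1))); [|discriminate].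
      destruct (Rle_dec 0 (E2 (P i2 j2))); [|destruct (Rle_dec 0 (E1 (P i2 j2))); discriminate].
      apply Rabs_def2 in K1. apply Rabs_def2 in K2.
      destruct (Habs _ A0) as [H|H]; rewrite Rabs_left in H; lra. }
    assert (Hlab : forall i j, label (c i j)).
    { intros i' j'. unfold c, label. repeat destruct (Rle_dec _ _); auto. }
    assert (Hperm : forall i0 j0 i1 j1 i2 j2,
        A (P i0 j0) -> A (P i1 j1) -> A (P i2 j2) ->
        ball (P i0 j0) d (P i1 j1) -> ball (P i0 j0) d (P i2 j2) ->
        ball (P i1 j1) d (P i0 j0) -> ball (P i1 j1) d (P i2 j2) ->
        ball (P i2 j2) d (P i0 j0) -> ball (P i2 j2) d (P i1 j1) ->
        ~ rainbow (c i0 j0) (c i1 j1) (c i2 j2)).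
    { intros i0 j0 i1 j1 i2 j2 A0 A1 A2 B1 B2 B3 B4 B5 B6 (N1 & N2 & N3).
      destruct (Hlab i0 j0) as [C0|[C0|C0]], (Hlab i1 j1) as [C1|[C1|C1]],
        (Hlab i2 j2) as [C2|[C2|C2]]; try congruence.
      - now apply (Hsmall i0 j0 i1 j1 i2 j2).
      - now apply (Hsmall i0 j0 i2 j2 i1 j1).
      - now apply (Hsmall i1 j1 i0 j0 i2 j2).
      - now apply (Hsmall i2 j2 i0 j0 i1 j1).
      - now apply (Hsmall i1 j1 i2 j2 i0 j0).
      - now apply (Hsmall i2 j2 i1 j1 i0 j0). }
    destruct Hr as [Hr|Hr]; revert Hr; apply Hperm;
      try (apply HPA; lia); apply Hclose; lia.
Qed.

(** Multiplication by the inverse matrix brings the map within [rho / 2] of the identity (centred at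
    the base point) on the square of half-side [rho], hence its components have opposite signs on
    opposite faces. The tolerance [kappa] depends on the matrix only, so errors that are [o(rho)]
    become admissible at small radii. *)
Lemma perturbed_linear_zero (a b c d : R) :
  a * d - b * c <> 0 ->
  exists kappa, 0 < kappa /\
  forall (F1 F2 : R * R -> R) (x0 y0 rho : R), 0 < rho ->
    (forall x, Rabs (fst x - x0) <= rho -> Rabs (snd x - y0) <= rho ->
       continuous F1 x /\ continuous F2 x /\
       Rabs (F1 x - (a * (fst x - x0) + b * (snd x - y0))) <= kappa * rho /\
       Rabs (F2 x - (c * (fst x - x0) + d * (snd x - y0))) <= kappa * rho) ->
    exists x, Rabs (fst x - x0) <= rho /\ Rabs (snd x - y0) <= rho /\
      F1 x = 0 /\ F2 x = 0.
Proof.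
  intros Hdet. set (D := a * d - b * c) in *.
  (* This exceeds the absolute row sums of the inverse matrix, so errors of size [rho / (2 S0)]
     become at most [rho / 2]; the final 1 makes it positive. *)
  set (S0 := Rabs (d / D) + Rabs (b / D) + Rabs (c / D) + Rabs (a / D) + 1).
  pose proof (Rabs_pos (d / D)). pose proof (Rabs_pos (b / D)).
  pose proof (Rabs_pos (c / D)). pose proof (Rabs_pos (a / D)).
  assert (HS : 0 < S0) by (unfold S0; lra).
  exists (/ (2 * S0)). split. apply Rinv_0_lt_compat; lra.
  set (ka := / (2 * S0)). intros F1 F2 x0 y0 rho Hrho HF.
  set (e := fun x : R * R => (x0 - rho + 2 * rho * fst x, y0 - rho + 2 * rho * snd x)).
  set (G1 := fun x => d / D * F1 x + - (b / D) * F2 x).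
  set (G2 := fun x => - (c / D) * F1 x + a / D * F2 x).
  assert (Hin : forall x, 0 <= fst x <= 1 /\ 0 <= snd x <= 1 ->
      Rabs (fst (e x) - x0) <= rho /\ Rabs (snd (e x) - y0) <= rho).
  { intros x [Hx Hy]. simpl. split; apply Rabs_le; nra. }
  assert (Hka : ka * rho * S0 = rho / 2) by (unfold ka; field; lra).
  assert (Hk0 : 0 < ka * rho).
  { apply Rmult_lt_0_compat; trivial. apply Rinv_0_lt_compat; lra. }
  assert (Hest : forall x, 0 <= fst x <= 1 /\ 0 <= snd x <= 1 ->
      Rabs (G1 (e x) - (fst (e x) - x0)) <= rho / 2 /\
      Rabs (G2 (e x) - (snd (e x) - y0)) <= rho / 2).
  { intros x Hx. destruct (Hin x Hx) as [I1 I2].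
    destruct (HF _ I1 I2) as (_ & _ & K1 & K2).
    set (u := fst (e x) - x0) in *. set (v := snd (e x) - y0) in *.
    set (r1 := F1 (e x) - (a * u + b * v)) in *.
    set (r2 := F2 (e x) - (c * u + d * v)) in *.
    assert (HC : forall s t, Rabs s + Rabs t <= S0 -> Rabs (s * r1 + t * r2) <= rho / 2).
    { intros s t Hst. rewrite <- Hka. apply Rle_trans with (1 := Rabs_triang _ _).
      rewrite !Rabs_mult. pose proof (Rabs_pos s). pose proof (Rabs_pos t). nra. }
    split.
    - replace (G1 (e x) - u) with (d / D * r1 + - (b / D) * r2).
      apply HC. rewrite Rabs_Ropp. unfold S0. lra.
      unfold G1, r1, r2, D. field. exact Hdet.
    - replace (G2 (e x) - v) with (- (c / D) * r1 + a / D * r2).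
      apply HC. rewrite Rabs_Ropp. unfold S0. lra.
      unfold G2, r1, r2, D. field. exact Hdet. }
  assert (He : forall x, continuous e x).
  { intros x. apply (continuous_comp_2 (fun x : R * R => x0 - rho + 2 * rho * fst x)
      (fun x : R * R => y0 - rho + 2 * rho * snd x) pair).
    - apply (continuous_plus (V := R_NormedModule)). apply continuous_const.
      apply (continuous_scal_r (V := R_NormedModule) (2 * rho)), continuous_fst.
    - apply (continuous_plus (V := R_NormedModule)). apply continuous_const.
      apply (continuous_scal_r (V := R_NormedModule) (2 * rho)), continuous_snd.
    - apply continuous_ext with (fun x => x). now intros []. apply continuous_id. }
  assert (HG : forall s t x, 0 <= fst x <= 1 /\ 0 <= snd x <= 1 ->
     continuous (fun x => s * F1 (e x) + t * F2 (e x)) x).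
  { intros s t x Hx. destruct (Hin x Hx) as [I1 I2].
    destruct (HF _ I1 I2) as (C1 & C2 & _ & _).
    apply (continuous_plus (V := R_NormedModule)).
    - apply (continuous_scal_r (V := R_NormedModule) s). now apply (continuous_comp e F1).
    - apply (continuous_scal_r (V := R_NormedModule) t). now apply (continuous_comp e F2). }
  destruct (miranda_unit (fun x => G1 (e x)) (fun x => G2 (e x))) as (x & Hx & E1 & E2).
  - intros x Hx. now apply HG.
  - intros x Hx. now apply HG.
  - intros t Ht. split.
    + destruct (Hest (0, t)) as [K _]. simpl; lra. simpl fst in K.
      apply Rabs_le_between in K. lra.
    + destruct (Hest (1, t)) as [K _]. simpl; lra. simpl fst in K.
      apply Rabs_le_between in K. lra.
  - intros t Ht. split.
    + destruct (Hest (t, 0)) as [_ K]. simpl; lra. simpl snd in K.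
      apply Rabs_le_between in K. lra.
    + destruct (Hest (t, 1)) as [_ K]. simpl; lra. simpl snd in K.
      apply Rabs_le_between in K. lra.
  - destruct (Hin x Hx) as [I1 I2]. exists (e x). repeat split; trivial.
    + transitivity (a * G1 (e x) + b * G2 (e x)).
      unfold G1, G2, D. field. exact Hdet. rewrite E1, E2. ring.
    + transitivity (c * G1 (e x) + d * G2 (e x)).
      unfold G1, G2, D. field. exact Hdet. rewrite E1, E2. ring.
Qed.

Lemma common_radius (a b c d e : R) : 0 < a -> 0 < b -> 0 < c -> 0 < d -> 0 < e ->
  exists r, 0 < r /\ r <= a /\ r <= b /\ r <= c /\ r <= d /\ r <= e.
Proof.
  intros. exists (Rmin (Rmin a b) (Rmin c (Rmin d e))).
  pose proof (Rmin_l (Rmin a b) (Rmin c (Rmin d e))).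
  pose proof (Rmin_r (Rmin a b) (Rmin c (Rmin d e))).
  pose proof (Rmin_l c (Rmin d e)). pose proof (Rmin_r c (Rmin d e)).
  pose proof (Rmin_l a b). pose proof (Rmin_r a b).
  pose proof (Rmin_l d e). pose proof (Rmin_r d e).
  split; [repeat apply Rmin_pos; trivial | lra].
Qed.

(** * Differential inequalities and Picard iteration *)

Lemma derive_compare (u v u' v' : R -> R) (a b : R) : a <= b ->
  (forall t, a <= t <= b -> continuous u t /\ continuous v t) ->
  (forall t, a < t < b -> is_derive u t (u' t) /\ is_derive v t (v' t) /\ u' t <= v' t) ->
  u b - u a <= v b - v a.
Proof.
  intros Hab Hc Hd.
  (* The intermediate point may be an endpoint, where no derivative is given; the default 0 keeps
     [0 <= d c] true there. *)
  set (d t := if Rlt_dec a t then if Rlt_dec t b then v' t - u' t else 0 else 0).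
  destruct (MVT_gen (fun t => v t - u t) a b d) as (c & _ & Hc2).
  - rewrite Rmin_left, Rmax_right by trivial. intros t Ht.
    destruct (Hd t Ht) as (D1 & D2 & _). unfold d.
    destruct (Rlt_dec a t); [|lra]. destruct (Rlt_dec t b); [|lra].
    now apply (is_derive_minus v u).
  - rewrite Rmin_left, Rmax_right by trivial. intros t Ht.
    destruct (Hc t Ht) as (D1 & D2).
    apply continuity_pt_filterlim. now apply (continuous_minus v u).
  - assert (0 <= d c).
    { unfold d. destruct (Rlt_dec a c); [|lra]. destruct (Rlt_dec c b); [|lra].
      destruct (Hd c) as (_ & _ & Hle); lra. }
    nra.
Qed.

Lemma derive_compare_abs (u v u' v' : R -> R) (a b : R) : a <= b ->
  (forall t, a <= t <= b -> continuous u t /\ continuous v t) ->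
  (forall t, a < t < b ->
     is_derive u t (u' t) /\ is_derive v t (v' t) /\ Rabs (u' t) <= v' t) ->
  Rabs (u b - u a) <= v b - v a.
Proof.
  intros Hab Hc Hd. apply Rabs_le. split.
  - assert (H : - u b - - u a <= v b - v a); [|lra].
    apply (derive_compare (fun t => - u t) v (fun t => - u' t) v'); trivial.
    + intros t Ht. destruct (Hc t Ht). split; trivial. now apply (continuous_opp u).
    + intros t Ht. destruct (Hd t Ht) as (D1 & D2 & D3). split; [|split]; trivial.
      now apply (is_derive_opp u). apply Rabs_le_between in D3. lra.
  - apply (derive_compare u v u' v'); trivial.
    intros t Ht. destruct (Hd t Ht) as (D1 & D2 & D3). split; [|split]; trivial.
    apply Rabs_le_between in D3. lra.
Qed.

Lemma is_derive_Rplus (u v : R -> R) (t du dv : R) :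
  is_derive u t du -> is_derive v t dv -> is_derive (fun s => u s + v s) t (du + dv).
Proof. apply (is_derive_plus (V := R_NormedModule)). Qed.

Lemma is_derive_Rminus (u v : R -> R) (t du dv : R) :
  is_derive u t du -> is_derive v t dv -> is_derive (fun s => u s - v s) t (du - dv).
Proof. apply (is_derive_minus (V := R_NormedModule)). Qed.

Lemma is_derive_Rmult (u v : R -> R) (t du dv : R) :
  is_derive u t du -> is_derive v t dv ->
  is_derive (fun s => u s * v s) t (du * v t + u t * dv).
Proof.
  intros Hu Hv. apply (is_derive_mult (K := R_AbsRing) u v t du dv); trivial.
  intros; apply Rmult_comm.
Qed.

(** The derivative of [u] times [exp (- A (t - a))] is at most [B]. Bounding that exponential by 1
    gives a cruder but division-free constant. *)
Lemma gronwall (u u' : R -> R) (a b A B : R) : a <= b -> 0 <= A -> 0 <= B ->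
  (forall t, a <= t <= b -> continuous u t) ->
  (forall t, a < t < b -> is_derive u t (u' t) /\ u' t <= A * u t + B) ->
  u b <= exp (A * (b - a)) * (u a + B * (b - a)).
Proof.
  intros Hab HA HB Hc Hd.
  assert (H : u b * exp (- A * (b - a)) - u a * exp (- A * (a - a))
              <= B * (b - a) - B * (a - a)).
  { apply (derive_compare (fun t => u t * exp (- A * (t - a))) (fun t => B * (t - a))
      (fun t => u' t * exp (- A * (t - a)) + u t * (- A * exp (- A * (t - a))))
      (fun t => B)); trivial.
    - intros t Ht. split.
      + apply (continuous_mult u). now apply Hc.
        apply (ex_derive_continuous (fun t => exp (- A * (t - a)))). auto_derive; trivial.
      + apply (ex_derive_continuous (fun t => B * (t - a))). auto_derive; trivial.
    - intros t Ht. destruct (Hd t Ht) as (D1 & D2). split; [|split].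
      + apply (is_derive_mult u (fun t => exp (- A * (t - a)))); trivial.
        * (auto_derive; [trivial|unfold Rminus; ring]).
        * intros; apply Rmult_comm.
      + (auto_derive; [trivial|unfold Rminus; ring]).
      + assert (exp (- A * (t - a)) <= 1).
        { rewrite <- exp_0. destruct (Rle_lt_or_eq_dec (- A * (t - a)) 0) as [Hl| ->].
          nra. left. now apply exp_increasing. right; trivial. }
        pose proof (exp_pos (- A * (t - a))). nra. }
  replace (- A * (a - a)) with 0 in H by ring. rewrite exp_0 in H.
  assert (E : exp (A * (b - a)) * exp (- A * (b - a)) = 1).
  { rewrite <- exp_plus. replace (A * (b - a) + - A * (b - a)) with 0 by ring. apply exp_0. }
  pose proof (exp_pos (A * (b - a))).
  replace (u b) with (exp (A * (b - a)) * (u b * exp (- A * (b - a)))).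
  apply Rmult_le_compat_l; lra.
  rewrite (Rmult_comm (u b)), <- Rmult_assoc, E. ring.
Qed.

(** The 1-Lipschitz retraction of the line onto [[a, b]]. It turns local data into global data
    without changing them on the interval, for time here and for space in [boxclamp]. *)
Definition clamp (a b t : R) : R := Rmax a (Rmin b t).

Lemma clamp_in a b t : a <= b -> a <= clamp a b t <= b.
Proof.
  intros H. unfold clamp. split. apply Rmax_l.
  apply Rmax_lub; [trivial | apply Rmin_l].
Qed.

Lemma clamp_id a b t : a <= t <= b -> clamp a b t = t.
Proof. intros H. unfold clamp. rewrite Rmin_right, Rmax_right; lra. Qed.

Lemma clamp_lip a b s t : Rabs (clamp a b s - clamp a b t) <= Rabs (s - t).
Proof.
  assert (Hle : forall x y, x <= y -> 0 <= clamp a b y - clamp a b x <= y - x).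
  { intros x y Hxy. unfold clamp, Rmin.
    destruct (Rle_dec b x), (Rle_dec b y); unfold Rmax;
      repeat destruct (Rle_dec _ _); lra. }
  destruct (Rle_dec s t) as [H|H].
  - specialize (Hle s t H). rewrite !Rabs_left1; lra.
  - specialize (Hle t s ltac:(lra)). rewrite !Rabs_pos_eq; lra.
Qed.

Lemma continuous_clamp a b t : continuous (clamp a b) t.
Proof.
  apply filterlim_locally. intros e. exists e. intros s Hs.
  apply ball_R. apply Rle_lt_trans with (1 := clamp_lip _ _ _ _). exact Hs.
Qed.

Lemma continuous_pair {U V W : UniformSpace} (F : U -> V) (G : U -> W) (x : U) :
  continuous F x -> continuous G x -> continuous (fun y => (F y, G y)) x.
Proof.
  intros HF HG. apply (continuous_comp_2 F G pair); trivial.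
  apply continuous_ext with (fun x => x). now intros []. apply continuous_id.
Qed.

Lemma continuous_fst_comp {U V W : UniformSpace} (F : U -> V * W) (x : U) :
  continuous F x -> continuous (fun y => fst (F y)) x.
Proof. intros HF. apply (continuous_comp F fst); trivial. apply continuous_fst. Qed.

Lemma continuous_snd_comp {U V W : UniformSpace} (F : U -> V * W) (x : U) :
  continuous F x -> continuous (fun y => snd (F y)) x.
Proof. intros HF. apply (continuous_comp F snd); trivial. apply continuous_snd. Qed.

Section RealContinuity.
Context {U : UniformSpace}.
Implicit Types (F G : U -> R) (x : U).

Lemma continuous_Rplus F G x :
  continuous F x -> continuous G x -> continuous (fun y => F y + G y) x.
Proof. apply (continuous_plus (V := R_NormedModule)). Qed.

Lemma continuous_Rminus F G x :
  continuous F x -> continuous G x -> continuous (fun y => F y - G y) x.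
Proof. apply (continuous_minus (V := R_NormedModule)). Qed.

Lemma continuous_Rmult F G x :
  continuous F x -> continuous G x -> continuous (fun y => F y * G y) x.
Proof. apply (continuous_mult (K := R_AbsRing)). Qed.

Lemma continuous_Rabs_comp F x : continuous F x -> continuous (fun y => Rabs (F y)) x.
Proof. intros H. apply (continuous_comp F Rabs); trivial. apply continuous_Rabs. Qed.
End RealContinuity.

(** The sum metric, chosen because it splits into coordinates and is handled by linear
    arithmetic. *)
Definition dist1 (x y : R * R) : R := Rabs (fst x - fst y) + Rabs (snd x - snd y).

(** The explicit rate, with 2 the sum of the geometric series, is what makes the convergence of
    Picard iterates uniform in time. *)
Lemma geometric_cauchy (u : nat -> R) (C : R) :
  (forall n, Rabs (u (S n) - u n) <= C * (1 / 2) ^ n) ->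
  exists l, forall n, Rabs (u n - l) <= 2 * C * (1 / 2) ^ n.
Proof.
  intros Hu.
  assert (HC : 0 <= C).
  { specialize (Hu O). simpl in Hu. pose proof (Rabs_pos (u 1%nat - u O)). lra. }
  assert (Hp : forall n, 0 < (1 / 2) ^ n) by (intros; apply pow_lt; lra).
  assert (Hd : forall n k, Rabs (u (n + k)%nat - u n)
                 <= 2 * C * (1 / 2) ^ n - 2 * C * (1 / 2) ^ (n + k)).
  { intros n. induction k.
    - rewrite Nat.add_0_r, !Rminus_diag, Rabs_R0. lra.
    - rewrite Nat.add_succ_r. specialize (Hu (n + k)%nat).
      replace (u (S (n + k)) - u n)
        with ((u (S (n + k)) - u (n + k)%nat) + (u (n + k)%nat - u n)) by ring.
      apply Rle_trans with (1 := Rabs_triang _ _). simpl. lra. }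
  assert (Hlim : ex_finite_lim_seq u).
  { apply ex_lim_seq_cauchy_corr. intros e.
    assert (Hg : is_lim_seq (fun n => 2 * C * (1 / 2) ^ n) 0).
    { replace (Finite 0) with (Rbar_mult (2 * C) 0) by (simpl; f_equal; ring).
      apply is_lim_seq_scal_l. apply is_lim_seq_geom. rewrite Rabs_pos_eq; lra. }
    apply is_lim_seq_spec in Hg. assert (He2 : 0 < e / 2) by (destruct e; simpl; lra).
    destruct (Hg (mkposreal _ He2)) as [N HN]. exists N. intros n k Hn Hk.
    assert (HB : forall j, (N <= j)%nat -> Rabs (u j - u N) < e / 2).
    { intros j Hj. replace j with (N + (j - N))%nat by lia.
      apply Rle_lt_trans with (1 := Hd _ _). specialize (HN N (le_n _)). simpl in HN.
      rewrite Rminus_0_r in HN. apply Rabs_def2 in HN. specialize (Hp (N + (j - N))%nat).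
      nra. }
    replace (u n - u k) with ((u n - u N) - (u k - u N)) by ring.
    apply Rle_lt_trans with (1 := Rabs_triang _ _). rewrite Rabs_Ropp.
    pose proof (HB n Hn). pose proof (HB k Hk). lra. }
  destruct Hlim as [l Hl]. exists l. intros n.
  apply (is_lim_seq_le (fun k => Rabs (u n - u (n + k)%nat)) (fun _ => 2 * C * (1/2)^n)
          (Rabs (u n - l)) (2 * C * (1/2)^n)).
  - intros k. rewrite Rabs_minus_sym. apply Rle_trans with (1 := Hd _ _).
    specialize (Hp (n + k)%nat). nra.
  - apply (is_lim_seq_abs _ (u n - l)). apply is_lim_seq_minus'.
    apply is_lim_seq_const. apply is_lim_seq_ext with (fun k => u (k + n)%nat).
    intros; f_equal; lia. now apply is_lim_seq_incr_n.
  - apply is_lim_seq_const.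
Qed.

Section Picard.
Variables (F1 F2 : R -> R * R -> R) (L a b : R).
Hypothesis (Hab : a < b) (HL : 0 < L).
Hypothesis HF1 : forall z : R * (R * R), continuous (fun z => F1 (fst z) (snd z)) z.
Hypothesis HF2 : forall z : R * (R * R), continuous (fun z => F2 (fst z) (snd z)) z.
Hypothesis HL1 : forall t x y, Rabs (F1 t x - F1 t y) <= L * dist1 x y.
Hypothesis HL2 : forall t x y, Rabs (F2 t x - F2 t y) <= L * dist1 x y.

Lemma continuous_along (F : R -> R * R -> R) (X : R -> R * R) :
  (forall z : R * (R * R), continuous (fun z => F (fst z) (snd z)) z) ->
  (forall t, continuous X t) -> forall t, continuous (fun s => F s (X s)) t.
Proof.
  intros HF HX t.
  apply (continuous_comp (fun s => (s, X s)) (fun z => F (fst z) (snd z))); auto.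
  apply continuous_pair; auto. apply continuous_id.
Qed.

(** Integrating up to [clamp a b t] keeps every iterate continuous on the whole line and constant
    outside [[a, b]], while inside it is the usual Picard operator. *)
Definition picard1 (F : R -> R * R -> R) (c : R) (X : R -> R * R) (t : R) : R :=
  c + RInt (fun s => F s (X s)) a (clamp a b t).

Lemma picard1_derive (F : R -> R * R -> R) (c : R) (X : R -> R * R) (t : R) :
  (forall z : R * (R * R), continuous (fun z => F (fst z) (snd z)) z) ->
  (forall t, continuous X t) -> a < t < b ->
  is_derive (picard1 F c X) t (F t (X t)).
Proof.
  intros HF HX Ht.
  apply is_derive_ext_loc with (fun t => c + RInt (fun s => F s (X s)) a t).
  - apply (locally_interval _ t a b); simpl; try lra. intros y Hy1 Hy2.
    unfold picard1. rewrite clamp_id; trivial. simpl in *. lra.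
  - replace (F t (X t)) with (0 + F t (X t)) by ring.
    apply (is_derive_plus (V := R_NormedModule) (fun _ => c) (fun t => RInt (fun s => F s (X s)) a t) t 0).
    apply (is_derive_const (V := R_NormedModule) c).
    apply (is_derive_RInt (fun s => F s (X s)) _ a).
    + apply filter_forall. intros y. apply (RInt_correct (V := R_CompleteNormedModule)).
      apply (ex_RInt_continuous (V := R_CompleteNormedModule)). intros; now apply continuous_along.
    + now apply continuous_along.
Qed.

Lemma picard1_continuous (F : R -> R * R -> R) (c : R) (X : R -> R * R) (t : R) :
  (forall z : R * (R * R), continuous (fun z => F (fst z) (snd z)) z) ->
  (forall t, continuous X t) -> continuous (picard1 F c X) t.
Proof.
  intros HF HX. apply (continuous_plus (V := R_NormedModule) (fun _ => c)). apply continuous_const.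
  apply (continuous_comp (clamp a b) (fun t => RInt (fun s => F s (X s)) a t)).
  apply continuous_clamp.
  apply (continuous_RInt_1 (V := R_CompleteNormedModule) (fun s => F s (X s)) a).
  apply filter_forall. intros y. apply (RInt_correct (V := R_CompleteNormedModule)).
  apply (ex_RInt_continuous (V := R_CompleteNormedModule)). intros; now apply continuous_along.
Qed.

Lemma picard1_a F c X : picard1 F c X a = c.
Proof.
  unfold picard1. rewrite clamp_id by lra. rewrite RInt_point. apply Rplus_0_r.
Qed.

Definition picard (y : R * R) (X : R -> R * R) (t : R) : R * R :=
  (picard1 F1 (fst y) X t, picard1 F2 (snd y) X t).

Lemma picard_clamp y X t : picard y X (clamp a b t) = picard y X t.
Proof. unfold picard, picard1. rewrite (clamp_id a b (clamp a b t)); trivial. apply clamp_in; lra. Qed.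

Lemma picard_continuous y X : (forall t, continuous X t) -> forall t, continuous (picard y X) t.
Proof. intros HX t. apply continuous_pair; now apply picard1_continuous. Qed.

(** The weight [exp (4 L (t - a))] makes the operator a half-contraction. *)
Lemma picard_contract y X Y C :
  (forall t, continuous X t) -> (forall t, continuous Y t) -> 0 <= C ->
  (forall t, a <= t <= b -> dist1 (X t) (Y t) <= C * exp (4 * L * (t - a))) ->
  forall t, a <= t <= b ->
    dist1 (picard y X t) (picard y Y t) <= C / 2 * exp (4 * L * (t - a)).
Proof.
  intros HX HY HC HXY t Ht.
  assert (Hone : forall F c, (forall z : R * (R * R), continuous (fun z => F (fst z) (snd z)) z) ->
      (forall t x y, Rabs (F t x - F t y) <= L * dist1 x y) ->
      Rabs (picard1 F c X t - picard1 F c Y t) <= C / 4 * exp (4 * L * (t - a))).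
  { intros F c HF HLF.
    (* The derivative of [C / 4 * exp (4 L (t - a))] is exactly the Lipschitz bound for the
       integrands; the two coordinates add up to [C / 2]. *)
    assert (H : Rabs ((picard1 F c X t - picard1 F c Y t) - (picard1 F c X a - picard1 F c Y a))
             <= C / 4 * exp (4 * L * (t - a)) - C / 4 * exp (4 * L * (a - a))).
    { apply (derive_compare_abs (fun t => picard1 F c X t - picard1 F c Y t)
        (fun t => C / 4 * exp (4 * L * (t - a)))
        (fun t => F t (X t) - F t (Y t)) (fun t => C * L * exp (4 * L * (t - a)))); [lra| |].
      - intros s Hs. split.
        + apply (continuous_minus (V := R_NormedModule)); now apply picard1_continuous.
        + apply (ex_derive_continuous (fun t => C / 4 * exp (4 * L * (t - a)))).
          auto_derive; trivial.
      - intros s Hs. split; [|split].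
        + apply (is_derive_minus (V := R_NormedModule)); apply picard1_derive; trivial; lra.
        + auto_derive; [trivial|]. unfold Rminus. field.
        + apply Rle_trans with (1 := HLF _ _ _).
          specialize (HXY s ltac:(lra)). nra. }
    rewrite !picard1_a, Rminus_diag, Rminus_0_r in H.
    apply Rle_trans with (1 := H). pose proof (exp_pos (4 * L * (a - a))). nra. }
  pose proof (Hone F1 (fst y) HF1 HL1). pose proof (Hone F2 (snd y) HF2 HL2).
  unfold dist1, picard; simpl. lra.
Qed.

Fixpoint picard_iter (y : R * R) (n : nat) : R -> R * R :=
  match n with O => fun _ => y | S k => picard y (picard_iter y k) end.

Lemma picard_iter_continuous y n t : continuous (picard_iter y n) t.
Proof.
  revert t. induction n; intros t; simpl. apply continuous_const.
  now apply picard_continuous.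
Qed.

Lemma picard_iter_step y : exists C, 0 <= C /\ forall n t, a <= t <= b ->
  dist1 (picard_iter y (S n) t) (picard_iter y n t)
    <= C * (1 / 2) ^ n * exp (4 * L * (t - a)).
Proof.
  destruct (cpt_bounded (fun t => a <= t <= b)
     (fun t => dist1 (picard_iter y 1 t) (picard_iter y 0 t))) as (C & HC & HB).
  - apply cpt_interval.
  - intros t _. unfold dist1.
    assert (Hc : continuous (picard_iter y 1) t) by apply picard_iter_continuous.
    apply continuous_Rplus; apply continuous_Rabs_comp; apply continuous_Rminus;
      try apply continuous_const.
    now apply continuous_fst_comp. now apply continuous_snd_comp.
  - exists C. split; [lra|]. induction n; intros t Ht.
    + specialize (HB t Ht). rewrite Rabs_pos_eq in HB.
      * apply Rle_trans with (1 := HB). simpl pow. rewrite Rmult_1_r.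
        rewrite <- (Rmult_1_r C) at 1. apply Rmult_le_compat_l; [lra|].
        rewrite <- exp_0. destruct (Rle_lt_or_eq_dec 0 (4 * L * (t - a))) as [Hl| <-].
        nra. left. now apply exp_increasing. right; trivial.
      * apply Rplus_le_le_0_compat; apply Rabs_pos.
    + replace (C * (1 / 2) ^ S n) with ((C * (1 / 2) ^ n) / 2) by (simpl; field).
      apply (picard_contract y (picard_iter y (S n)) (picard_iter y n)); trivial.
      apply picard_iter_continuous. apply picard_iter_continuous.
      apply Rmult_le_pos. lra. apply pow_le; lra.
Qed.

(** The iterates converge at a rate uniform in [t], so the limit is continuous. It is a fixed point
    because the contraction estimate also compares it with late iterates; no limit is taken under
    the integral. *)
Lemma picard_solution (y : R * R) : exists X : R -> R * R,
  (forall t, continuous X t) /\ X a = y /\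
  forall t, a < t < b ->
    is_derive (fun s => fst (X s)) t (F1 t (X t)) /\
    is_derive (fun s => snd (X s)) t (F2 t (X t)).
Proof.
  destruct (picard_iter_step y) as (C & HC & Hstep).
  set (E := exp (4 * L * (b - a))).
  assert (HE : 0 < E) by apply exp_pos.
  assert (Hp : forall n, 0 < (1 / 2) ^ n) by (intros; apply pow_lt; lra).
  assert (Hiter : forall n t, picard_iter y n (clamp a b t) = picard_iter y n t).
  { intros [|n] t; simpl; trivial. apply picard_clamp. }
  assert (Hs : forall n t, dist1 (picard_iter y (S n) t) (picard_iter y n t)
                 <= C * E * (1 / 2) ^ n).
  { intros n t. rewrite <- (Hiter (S n)), <- (Hiter n).
    pose proof (clamp_in a b t ltac:(lra)) as Hc.
    apply Rle_trans with (1 := Hstep n _ Hc).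
    assert (exp (4 * L * (clamp a b t - a)) <= E).
    { unfold E. destruct (Rle_lt_or_eq_dec (clamp a b t) b) as [Hl| ->]; try lra.
      left. apply exp_increasing. nra. }
    specialize (Hp n). replace (C * E * (1 / 2) ^ n) with (C * (1 / 2) ^ n * E) by ring.
    apply Rmult_le_compat_l; [nra | trivial]. }
  assert (Hex : forall t, exists l : R * R, forall n,
            dist1 (picard_iter y n t) l <= 4 * (C * E) * (1 / 2) ^ n).
  { intros t.
    destruct (geometric_cauchy (fun n => fst (picard_iter y n t)) (C * E)) as [l1 H1].
    { intros n. apply Rle_trans with (2 := Hs n t). unfold dist1.
      pose proof (Rabs_pos (snd (picard_iter y (S n) t) - snd (picard_iter y n t))). lra. }
    destruct (geometric_cauchy (fun n => snd (picard_iter y n t)) (C * E)) as [l2 H2].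
    { intros n. apply Rle_trans with (2 := Hs n t). unfold dist1.
      pose proof (Rabs_pos (fst (picard_iter y (S n) t) - fst (picard_iter y n t))). lra. }
    exists (l1, l2). intros n. unfold dist1. simpl. specialize (H1 n). specialize (H2 n). lra. }
  destruct (choice _ Hex) as [X HX].
  assert (Hg : forall K e, 0 <= K -> 0 < e -> exists n, K * (1 / 2) ^ n < e).
  { intros K e HK He.
    destruct (pow_lt_1_zero (1 / 2) ltac:(rewrite Rabs_pos_eq; lra) (e / (K + 1)))
      as [N HN]. apply Rdiv_lt_0_compat; lra.
    exists N. specialize (HN N (le_n _)). rewrite Rabs_pos_eq in HN by (left; apply Hp).
    specialize (Hp N).
    apply (Rmult_lt_compat_r (K + 1)) in HN; [|lra].
    unfold Rdiv in HN. rewrite Rmult_assoc, Rinv_l in HN by lra. nra. }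
  assert (HCE : 0 <= C * E) by nra.
  assert (HXc : forall t, continuous X t).
  { intros t. apply filterlim_locally. intros e.
    assert (He4 : 0 < e / 4) by (destruct e; simpl; lra).
    destruct (Hg (4 * (C * E)) (e / 4)) as [n Hn]; [lra | trivial |].
    destruct (proj1 (filterlim_locally _ _) (picard_iter_continuous y n t)
       (mkposreal _ He4)) as [d Hd]. simpl in Hd.
    exists d. intros s Hsd. specialize (Hd s Hsd).
    pose proof (HX s n) as K1. pose proof (HX t n) as K2. unfold dist1 in K1, K2.

    assert (B1 : Rabs (fst (picard_iter y n s) - fst (picard_iter y n t)) < e / 4)
      by exact (proj1 Hd).
    assert (B2 : Rabs (snd (picard_iter y n s) - snd (picard_iter y n t)) < e / 4)
      by exact (proj2 Hd).
    assert (Htri : forall p q r o : R, Rabs (p - q) < e / 4 -> Rabs (r - o) < e / 4 ->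
              Rabs (p - r) < e / 4 -> Rabs (o - q) < e).
    { intros p q r o P1 P2 P3.
      apply Rabs_def2 in P1. apply Rabs_def2 in P2. apply Rabs_def2 in P3.
      apply Rabs_def1; lra. }
    pose proof (Rabs_pos (fst (picard_iter y n s) - fst (X s))).
    pose proof (Rabs_pos (snd (picard_iter y n s) - snd (X s))).
    pose proof (Rabs_pos (fst (picard_iter y n t) - fst (X t))).
    pose proof (Rabs_pos (snd (picard_iter y n t) - snd (X t))).
    assert (G1 : Rabs (fst (X s) - fst (X t)) < e).
    { apply (Htri (fst (picard_iter y n t)) _ (fst (picard_iter y n s)));
        [| |rewrite Rabs_minus_sym]; lra. }
    assert (G2 : Rabs (snd (X s) - snd (X t)) < e).
    { apply (Htri (snd (picard_iter y n t)) _ (snd (picard_iter y n s)));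
        [| |rewrite Rabs_minus_sym]; lra. }
    now split. }
  assert (Hfix : forall t, X t = picard y X t).
  { intros t.
    assert (Hz : forall e, 0 < e -> dist1 (X t) (picard y X t) <= e).
    { intros e He.
      destruct (Hg (8 * (C * E) * E) e) as [n Hn]; [nra | trivial |].
      assert (K : dist1 (picard y (picard_iter y n) (clamp a b t)) (picard y X (clamp a b t))
         <= (4 * (C * E) * (1 / 2) ^ n) / 2 * exp (4 * L * (clamp a b t - a))).
      { apply picard_contract; trivial.
        - intros; apply picard_iter_continuous.
        - specialize (Hp n). nra.
        - intros s Hs1. apply Rle_trans with (1 := HX s n).
          assert (1 <= exp (4 * L * (s - a))).
          { rewrite <- exp_0. destruct (Rle_lt_or_eq_dec 0 (4 * L * (s - a))) as [Hl| <-].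
            nra. left. now apply exp_increasing. right; trivial. }
          specialize (Hp n). assert (0 <= 4 * (C * E) * (1 / 2) ^ n) by nra. nra.
        - apply clamp_in; lra. }
      rewrite !picard_clamp in K.
      assert (exp (4 * L * (clamp a b t - a)) <= E).
      { unfold E. pose proof (clamp_in a b t ltac:(lra)).
        destruct (Rle_lt_or_eq_dec (clamp a b t) b) as [Hl| ->]; try lra.
        left. apply exp_increasing. nra. }
      assert (1 <= E).
      { rewrite <- exp_0. left. apply exp_increasing. nra. }
      pose proof (HX t (S n)) as K2. simpl picard_iter in K2. simpl pow in K2.
      specialize (Hp n).
      assert (dist1 (X t) (picard y X t) <= dist1 (picard y (picard_iter y n) t) (X t)
          + dist1 (picard y (picard_iter y n) t) (picard y X t)).
      { unfold dist1.
        pose proof (Rabs_triang (fst (X t) - fst (picard y (picard_iter y n) t))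
          (fst (picard y (picard_iter y n) t) - fst (picard y X t))) as T1.
        pose proof (Rabs_triang (snd (X t) - snd (picard y (picard_iter y n) t))
          (snd (picard y (picard_iter y n) t) - snd (picard y X t))) as T2.
        rewrite (Rabs_minus_sym (fst (X t))) in T1. rewrite (Rabs_minus_sym (snd (X t))) in T2.
        unfold Rminus in *. rewrite !Rplus_assoc in *.
        rewrite <- !(Rplus_assoc (- _) _ _), !Rplus_opp_l, !Rplus_0_l in *. lra. }
      apply Rle_trans with (1 := H1).
      set (p := (1 / 2) ^ n) in *. set (ce := C * E) in *.
      assert (4 * ce * p / 2 * exp (4 * L * (clamp a b t - a)) <= 2 * ce * p * E).
      { assert (0 <= ce * p) by nra. nra. }
      assert (0 <= ce * p) by nra.
      assert (4 * ce * (1 / 2 * p) <= 2 * (ce * p) * E) by nra.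
      assert (8 * ce * E * p < e) by trivial. nra. }
    assert (H0 : dist1 (X t) (picard y X t) <= 0).
    { apply Rnot_lt_le. intro Hn. specialize (Hz (dist1 (X t) (picard y X t) / 2) ltac:(lra)). lra. }
    unfold dist1 in H0.
    pose proof (Rabs_pos (fst (X t) - fst (picard y X t))).
    pose proof (Rabs_pos (snd (X t) - snd (picard y X t))).
    apply injective_projections; apply Rminus_diag_uniq; apply Rabs_eq_0; lra. }
  exists X. split; [|split]; trivial.
  - rewrite Hfix. unfold picard. rewrite !picard1_a. now destruct y.
  - intros t Ht. split.
    + apply is_derive_ext with (picard1 F1 (fst y) X).
      intros s. now rewrite (Hfix s). now apply picard1_derive.
    + apply is_derive_ext with (picard1 F2 (snd y) X).
      intros s. now rewrite (Hfix s). now apply picard1_derive.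
Qed.

End Picard.

(** * Continuously differentiable maps *)

(** Fréchet differentiability with a derivative jointly continuous in point and direction. In this
    form the class is closed under composition by a direct argument, whereas [Ck] only speaks of one
    direction at a time. *)
Definition C1 {U W : NormedModule R_AbsRing} (D : U -> Prop) (F : U -> W) : Prop :=
  exists dF : U -> U -> W,
    (forall u, D u -> filterdiff F (locally u) (dF u)) /\
    (forall u v, D u -> continuous (fun p : U * U => dF (fst p) (snd p)) (u, v)).

Section C1.
Context {U W : NormedModule R_AbsRing}.

Lemma C1_continuous (D : U -> Prop) (F : U -> W) u : C1 D F -> D u -> continuous F u.
Proof.
  intros (dF & H & _) Hu. apply filterdiff_continuous. exists (dF u). auto.
Qed.

Lemma C1_ext_open (D : U -> Prop) (F G : U -> W) :
  open D -> (forall u, D u -> F u = G u) -> C1 D F -> C1 D G.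
Proof.
  intros HD HFG (dF & H1 & H2). exists dF. split; trivial.
  intros u Hu. apply filterdiff_ext_locally with F; auto.
  apply filter_imp with D; auto.
Qed.

Lemma C1_linear (D : U -> Prop) (F : U -> W) : is_linear F -> C1 D F.
Proof.
  intros HF. exists (fun _ v => F v). split.
  - intros u _. now apply filterdiff_linear.
  - intros u v _. apply (continuous_comp (V := U) (fun p : U * U => snd p) F).
    apply continuous_snd. apply filterdiff_continuous. exists F. now apply filterdiff_linear.
Qed.

Lemma C1_const (D : U -> Prop) (c : W) : C1 D (fun _ => c).
Proof.
  exists (fun _ _ => zero). split.
  - intros. apply filterdiff_const.
  - intros. apply continuous_const.
Qed.

End C1.

Lemma C1_comp {U V W : NormedModule R_AbsRing} (D : U -> Prop) (D' : V -> Prop) (G : U -> V) (F : V -> W) :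
  C1 D G -> C1 D' F -> (forall u, D u -> D' (G u)) -> C1 D (fun u => F (G u)).
Proof.
  intros HG HF Hsub. pose proof HG as (dG & G1 & G2). destruct HF as (dF & F1 & F2).
  exists (fun u v => dF (G u) (dG u v)). split.
  - intros u Hu. apply filterdiff_comp'; auto.
  - intros u v Hu.
    apply (continuous_comp (fun p : U * U => (G (fst p), dG (fst p) (snd p)))
             (fun p : V * V => dF (fst p) (snd p))).
    + apply continuous_pair; auto.
      apply (continuous_comp (V := U) (fun p : U * U => fst p) G).
      apply continuous_fst. now apply (C1_continuous D).
    + simpl. apply F2. auto.
Qed.

Lemma C1_pair {U V W : NormedModule R_AbsRing} (D : U -> Prop) (F : U -> V) (G : U -> W) :
  C1 D F -> C1 D G -> C1 D (fun u => (F u, G u)).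
Proof.
  intros (dF & F1 & F2) (dG & G1 & G2).
  exists (fun u v => (dF u v, dG u v)). split.
  - intros u Hu. apply (filterdiff_comp'_2 F G pair u (dF u) (dG u) pair); auto.
    apply (filterdiff_ext (fun t => t)). now intros [].
    apply (filterdiff_ext_lin _ (fun t => t)). apply filterdiff_id. now intros [].
  - intros u v Hu. apply continuous_pair; auto.
Qed.

Section C1Real.
Context {U : NormedModule R_AbsRing}.

Lemma C1_Rplus (D : U -> Prop) (F G : U -> R) :
  C1 D F -> C1 D G -> C1 D (fun u => F u + G u).
Proof.
  intros HF HG. apply (C1_comp D (fun _ => True) (fun u => (F u, G u)) (fun t : R * R => fst t + snd t)).
  - now apply C1_pair.
  - apply C1_linear. apply (is_linear_plus (V := R_NormedModule)).
  - trivial.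
Qed.

Lemma C1_Ropp (D : U -> Prop) (F : U -> R) : C1 D F -> C1 D (fun u => - F u).
Proof.
  intros HF. apply (C1_comp D (fun _ => True) F Ropp); trivial.
  apply C1_linear. apply (is_linear_opp (V := R_NormedModule)).
Qed.

Lemma C1_Rmult (D : U -> Prop) (F G : U -> R) :
  C1 D F -> C1 D G -> C1 D (fun u => F u * G u).
Proof.
  intros HF HG. apply (C1_comp D (fun _ => True) (fun u => (F u, G u)) (fun t : R * R => fst t * snd t)).
  - now apply C1_pair.
  - exists (fun u v => fst v * snd u + fst u * snd v). split.
    + intros u _. apply (filterdiff_mult (K := R_AbsRing)). now intros P.
      apply Rmult_comm.
    + intros u v _.
      apply continuous_Rplus; apply continuous_Rmult.
      * apply continuous_fst_comp, continuous_snd.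
      * apply continuous_snd_comp, continuous_fst.
      * apply continuous_fst_comp, continuous_fst.
      * apply continuous_snd_comp, continuous_snd.
  - trivial.
Qed.

Lemma is_derive_along (F : U -> R) (dF : U -> R) (c : R -> U) (t : R) (c' : U) :
  filterdiff F (locally (c t)) dF -> is_derive c t c' ->
  is_derive (fun s => F (c s)) t (dF c').
Proof.
  intros HF Hc. unfold is_derive.
  apply filterdiff_ext_lin with (fun y => dF (scal y c')).
  - apply (filterdiff_comp' (U := R_NormedModule) c F t (fun y => scal y c') dF); trivial.
  - intros y. apply linear_scal. apply HF.
Qed.

End C1Real.

Lemma is_derive_pair {U W : NormedModule R_AbsRing} (F : R -> U) (G : R -> W) t dF dG :
  is_derive F t dF -> is_derive G t dG -> is_derive (fun s => (F s, G s)) t (dF, dG).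
Proof.
  intros HF HG. unfold is_derive.
  apply (filterdiff_comp'_2 F G pair t (fun y => scal y dF) (fun y => scal y dG) pair); auto.
  apply (filterdiff_ext (fun t => t)). now intros [].
  apply (filterdiff_ext_lin _ (fun t => t)). apply filterdiff_id. now intros [].
Qed.

Lemma is_derive_fst {U W : NormedModule R_AbsRing} (F : R -> U * W) t l :
  is_derive F t l -> is_derive (fun s => fst (F s)) t (fst l).
Proof.
  intros HF. unfold is_derive.
  apply (filterdiff_comp' F fst t (fun y => scal y l) fst); trivial.
  apply filterdiff_linear, is_linear_fst.
Qed.

Lemma is_derive_snd {U W : NormedModule R_AbsRing} (F : R -> U * W) t l :
  is_derive F t l -> is_derive (fun s => snd (F s)) t (snd l).
Proof.
  intros HF. unfold is_derive.
  apply (filterdiff_comp' F snd t (fun y => scal y l) snd); trivial.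
  apply filterdiff_linear, is_linear_snd.
Qed.

(** * From continuous directional derivatives to Fréchet differentiability *)

Section Directional.
Context {U : NormedModule R_AbsRing}.

Lemma Ck_on_continuous {W : NormedModule R_AbsRing} k (D : U -> Prop) (F : U -> W) u :
  Ck_on k D F -> D u -> continuous F u.
Proof. destruct k; intros [H _]; apply H. Qed.

Lemma Ck_on_dir {W : NormedModule R_AbsRing} k (D : U -> Prop) (F : U -> W) (v : U) :
  Ck_on (S k) D F -> exists dF : U -> W,
    (forall u, D u -> is_derive (fun s : R => F (plus u (scal s v))) 0 (dF u)) /\
    Ck_on k D dF.
Proof. intros [_ H]. apply H. Qed.

Lemma Ck_on_fst {V W : NormedModule R_AbsRing} k (D : U -> Prop) (F : U -> V * W) :
  Ck_on k D F -> Ck_on k D (fun u => fst (F u)).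
Proof.
  revert F. induction k; intros F [Hc Hd]; split; trivial.
  - intros u Hu. now apply continuous_fst_comp, Hc.
  - intros u Hu. now apply continuous_fst_comp, Hc.
  - intros v. destruct (Hd v) as (dF & H1 & H2). exists (fun u => fst (dF u)). split; auto.
    intros u Hu. now apply (is_derive_fst (fun s => F (plus u (scal s v)))), H1.
Qed.

Lemma Ck_on_snd {V W : NormedModule R_AbsRing} k (D : U -> Prop) (F : U -> V * W) :
  Ck_on k D F -> Ck_on k D (fun u => snd (F u)).
Proof.
  revert F. induction k; intros F [Hc Hd]; split; trivial.
  - intros u Hu. now apply continuous_snd_comp, Hc.
  - intros u Hu. now apply continuous_snd_comp, Hc.
  - intros v. destruct (Hd v) as (dF & H1 & H2). exists (fun u => snd (dF u)). split; auto.
    intros u Hu. now apply (is_derive_snd (fun s => F (plus u (scal s v)))), H1.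
Qed.

Definition dir_derivative (D : U -> Prop) (F : U -> R) (e : U) (d : U -> R) : Prop :=
  (forall u, D u -> is_derive (fun s : R => F (plus u (scal s e))) 0 (d u)) /\
  (forall u, D u -> continuous d u).

Lemma Ck_on_dir_derivative k (D : U -> Prop) (F : U -> R) (e : U) :
  Ck_on (S k) D F -> exists d, dir_derivative D F e d /\ Ck_on k D d.
Proof.
  intros HF. destruct (Ck_on_dir _ _ _ e HF) as (d & H1 & H2). exists d.
  split; [split|]; trivial. intros u Hu. now apply (Ck_on_continuous (W := R_NormedModule) k D).
Qed.

Lemma dir_derivative_at D F e d u s : dir_derivative D F e d ->
  D (plus u (scal s e)) ->
  is_derive (fun s : R => F (plus u (scal s e))) s (d (plus u (scal s e))).
Proof.
  intros [H _] Hu. specialize (H _ Hu).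
  apply is_derive_ext with (fun t => F (plus (plus u (scal s e)) (scal (t - s) e))).
  { intros t. f_equal. rewrite <- plus_assoc, <- scal_distr_r. f_equal. f_equal.
    change (s + (t - s) = t). ring. }
  replace (d (plus u (scal s e))) with (scal 1 (d (plus u (scal s e))))
    by (change (1 * d (plus u (scal s e)) = d (plus u (scal s e))); ring).
  apply (is_derive_comp (fun t => F (plus (plus u (scal s e)) (scal t e))) (fun t => t - s)).
  - now replace (s - s) with 0 by ring.
  - auto_derive; trivial; ring.
Qed.

Lemma plus_scal_0 (u e : U) : plus u (scal 0 e) = u.
Proof.
  transitivity (plus u zero). f_equal. exact (scal_zero_l (K := R_AbsRing) e). apply plus_zero_r.
Qed.

(** The mean value theorem along [e], uniform over base points [u'] near [u]. That uniformity lets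
    increments in several directions be chained. *)
Lemma dir_derivative_mean D F e d u : dir_derivative D F e d -> open D -> D u ->
  forall eta, 0 < eta -> exists del, 0 < del /\ forall u' c,
    ball u del u' -> Rabs c < del ->
    Rabs (F (plus u' (scal c e)) - F u' - c * d u) <= eta * Rabs c.
Proof.
  intros HF HD Hu eta Heta.
  set (pth := fun z : U * R => plus (fst z) (scal (snd z) e)).
  assert (Hp : continuous pth (u, 0)).
  { unfold pth. apply (continuous_plus (fun z : U * R => fst z) (fun z => scal (snd z) e)).
    apply continuous_fst. apply (continuous_scal_l (fun z : U * R => snd z)), continuous_snd. }
  assert (E0 : pth (u, 0) = u).
  { unfold pth; simpl. apply plus_scal_0. }
  unfold continuous in Hp. rewrite E0 in Hp.
  assert (HN : locally u (fun y => D y /\ ball (d u) eta (d y))).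
  { apply filter_and. now apply HD.
    apply (proj1 (filterlim_locally d (d u)) (proj2 HF u Hu) (mkposreal _ Heta)). }
  destruct (Hp _ HN) as [del Hdel].
  exists del. split. apply cond_pos. intros u' c Hu' Hc.
  assert (Hs : forall s, Rmin 0 c <= s <= Rmax 0 c ->
     D (plus u' (scal s e)) /\ Rabs (d (plus u' (scal s e)) - d u) < eta).
  { intros s Hs. apply (Hdel (u', s)). split; trivial. simpl. apply ball_R.
    rewrite Rminus_0_r. apply Rle_lt_trans with (2 := Hc).
    unfold Rmin, Rmax in Hs. destruct (Rle_dec 0 c).
    rewrite !Rabs_pos_eq; lra. rewrite !Rabs_left1; lra. }
  destruct (MVT_gen (fun s => F (plus u' (scal s e))) 0 c (fun s => d (plus u' (scal s e))))
    as (x & Hx & E).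
  - intros s Hs'. apply dir_derivative_at with D; trivial. apply Hs. lra.
  - intros s Hs'. apply continuity_pt_filterlim.
    apply (ex_derive_continuous (fun s => F (plus u' (scal s e)))).
    exists (d (plus u' (scal s e))). apply dir_derivative_at with D; trivial. apply Hs. lra.
  - rewrite plus_scal_0 in E. rewrite E.
    replace (d (plus u' (scal x e)) * (c - 0) - c * d u)
      with ((d (plus u' (scal x e)) - d u) * c) by ring.
    rewrite Rabs_mult. apply Rmult_le_compat_r. apply Rabs_pos. left. now apply Hs.
Qed.

End Directional.

Lemma filterdiff_intro {U : NormedModule R_AbsRing} (F l : U -> R) (u : U) :
  is_linear l ->
  (forall eta, 0 < eta -> exists del, 0 < del /\ forall v, ball u del (plus u v) ->
     Rabs (F (plus u v) - F u - l v) <= eta * norm v) ->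
  filterdiff F (locally u) l.
Proof.
  intros Hl H. split; trivial. intros x Hx.
  apply (is_filter_lim_locally_unique (V := U)) in Hx. subst x.
  intros eps. destruct (H eps (cond_pos eps)) as (del & Hdel & K).
  exists (mkposreal del Hdel). intros y Hy.
  assert (E : plus u (minus y u) = y).
  { transitivity (plus y (plus (opp u) u)).
    - rewrite plus_assoc, plus_comm. reflexivity.
    - transitivity (plus y zero). f_equal. exact (plus_opp_l (G := U) u). apply plus_zero_r. }
  specialize (K (minus y u)). rewrite E in K. apply K. exact Hy.
Qed.

Lemma is_linear_R2 (a b : R) : is_linear (fun v : R * R => fst v * a + snd v * b).
Proof.
  apply (is_linear_comp (fun v : R * R => (fst v * a, snd v * b)) (fun v : R * R => plus (fst v) (snd v))).
  2: apply (is_linear_plus (V := R_NormedModule)).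
  apply is_linear_prod.
  - apply (is_linear_comp fst (fun x : R => x * a)). apply is_linear_fst.
    apply (is_linear_scal_l (K := R_AbsRing) a).
  - apply (is_linear_comp snd (fun x : R => x * b)). apply is_linear_snd.
    apply (is_linear_scal_l (K := R_AbsRing) b).
Qed.

Lemma ball_self (x d : R) : 0 < d -> ball x d x.
Proof. intros H. apply ball_R. rewrite Rminus_diag, Rabs_R0. exact H. Qed.

Lemma ball_plus (x d v : R) : ball x d (x + v) <-> Rabs v < d.
Proof. rewrite ball_R. now replace (x + v - x) with v by ring. Qed.

(** The increment is split into one step per coordinate. The first is taken from a displaced base
    point, where continuity of the partial derivative is used. *)
Lemma filterdiff_R2 (D : R * R -> Prop) (F d1 d2 : R * R -> R) : open D ->
  dir_derivative D F (1, 0) d1 -> dir_derivative D F (0, 1) d2 ->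
  forall u, D u -> filterdiff F (locally u) (fun v => fst v * d1 u + snd v * d2 u).
Proof.
  intros HD H1 H2 u Hu. apply (filterdiff_intro (U := R2)). apply is_linear_R2.
  intros eta Heta. assert (He2 : 0 < eta / 2) by lra.
  destruct (dir_derivative_mean D F _ d1 u H1 HD Hu _ He2) as (r1 & Hr1 & K1).
  destruct (dir_derivative_mean D F _ d2 u H2 HD Hu _ He2) as (r2 & Hr2 & K2).
  exists (Rmin r1 r2). split. now apply Rmin_pos.
  pose proof (Rmin_l r1 r2). pose proof (Rmin_r r1 r2).
  intros v [B1 B2]. destruct u as [u1 u2], v as [v1 v2].
  apply (ball_plus u1 _ v1) in B1. apply (ball_plus u2 _ v2) in B2.
  pose proof (norm_le_prod_norm_1 (K := R_AbsRing) (v1, v2)) as N1.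
  pose proof (norm_le_prod_norm_2 (K := R_AbsRing) (v1, v2)) as N2.
  change (Rabs v1 <= norm (v1, v2)) in N1. change (Rabs v2 <= norm (v1, v2)) in N2.
  set (nv := norm (v1, v2)) in *.
  assert (M1 : Rabs (F (u1 + v1, u2 + v2) - F (u1, u2 + v2) - v1 * d1 (u1, u2))
               <= eta / 2 * Rabs v1).
  { replace (u1 + v1, u2 + v2) with (plus (u1, u2 + v2) (scal v1 (1, 0))).
    apply K1; [split; [apply ball_self | apply ball_plus] | ]; simpl in *; lra.
    change ((u1 + v1 * 1, u2 + v2 + v1 * 0) = (u1 + v1, u2 + v2)). f_equal; ring. }
  assert (M2 : Rabs (F (u1, u2 + v2) - F (u1, u2) - v2 * d2 (u1, u2))
               <= eta / 2 * Rabs v2).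
  { replace (u1, u2 + v2) with (plus (u1, u2) (scal v2 (0, 1))).
    apply K2; [split; apply ball_self | ]; simpl in *; lra.
    change ((u1 + v2 * 0, u2 + v2 * 1) = (u1, u2 + v2)). f_equal; ring. }
  change (plus (u1, u2) (v1, v2)) with (u1 + v1, u2 + v2). simpl fst. simpl snd.
  replace (F (u1 + v1, u2 + v2) - F (u1, u2) - (v1 * d1 (u1, u2) + v2 * d2 (u1, u2)))
    with ((F (u1 + v1, u2 + v2) - F (u1, u2 + v2) - v1 * d1 (u1, u2))
          + (F (u1, u2 + v2) - F (u1, u2) - v2 * d2 (u1, u2))) by ring.
  apply Rle_trans with (1 := Rabs_triang _ _). nra.
Qed.

Lemma filterdiff_R3 (D : R * (R * R) -> Prop) (F d0 d1 d2 : R * (R * R) -> R) : open D ->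
  dir_derivative D F (1, (0, 0)) d0 -> dir_derivative D F (0, (1, 0)) d1 ->
  dir_derivative D F (0, (0, 1)) d2 ->
  forall u, D u -> filterdiff F (locally u)
    (fun v => fst v * d0 u + (fst (snd v) * d1 u + snd (snd v) * d2 u)).
Proof.
  intros HD H0 H1 H2 u Hu. apply (filterdiff_intro (U := R3)).
  { apply (is_linear_comp (fun v : R * (R * R) =>
        (fst v * d0 u, fst (snd v) * d1 u + snd (snd v) * d2 u)) (fun v : R * R => plus (fst v) (snd v))).
    2: apply (is_linear_plus (V := R_NormedModule)).
    apply is_linear_prod.
    - apply (is_linear_comp fst (fun x : R => x * d0 u)). apply is_linear_fst.
      apply (is_linear_scal_l (K := R_AbsRing) (d0 u)).
    - apply (is_linear_comp snd (fun v : R * R => fst v * d1 u + snd v * d2 u)).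
      apply is_linear_snd. apply is_linear_R2. }
  intros eta Heta. assert (He3 : 0 < eta / 3) by lra.
  destruct (dir_derivative_mean D F _ d0 u H0 HD Hu _ He3) as (r0 & Hr0 & K0).
  destruct (dir_derivative_mean D F _ d1 u H1 HD Hu _ He3) as (r1 & Hr1 & K1).
  destruct (dir_derivative_mean D F _ d2 u H2 HD Hu _ He3) as (r2 & Hr2 & K2).
  exists (Rmin r0 (Rmin r1 r2)). split. repeat apply Rmin_pos; trivial.
  pose proof (Rmin_l r1 r2). pose proof (Rmin_r r1 r2).
  pose proof (Rmin_l r0 (Rmin r1 r2)). pose proof (Rmin_r r0 (Rmin r1 r2)).
  intros v [B0 [B1 B2]]. destruct u as [u0 [u1 u2]], v as [v0 [v1 v2]].
  apply (ball_plus u0 _ v0) in B0. apply (ball_plus u1 _ v1) in B1. apply (ball_plus u2 _ v2) in B2.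
  pose proof (norm_le_prod_norm_1 (K := R_AbsRing) (v0, (v1, v2))) as N0.
  pose proof (norm_le_prod_norm_2 (K := R_AbsRing) (v0, (v1, v2))) as N.
  pose proof (norm_le_prod_norm_1 (K := R_AbsRing) (v1, v2)) as N1.
  pose proof (norm_le_prod_norm_2 (K := R_AbsRing) (v1, v2)) as N2.
  change (Rabs v0 <= norm (v0, (v1, v2))) in N0.
  change (norm (v1, v2) <= norm (v0, (v1, v2))) in N.
  change (Rabs v1 <= norm (v1, v2)) in N1. change (Rabs v2 <= norm (v1, v2)) in N2.
  set (nv := norm (v0, (v1, v2))) in *.
  assert (M0 : Rabs (F (u0 + v0, (u1 + v1, u2 + v2)) - F (u0, (u1 + v1, u2 + v2))
                     - v0 * d0 (u0, (u1, u2))) <= eta / 3 * Rabs v0).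
  { replace (u0 + v0, (u1 + v1, u2 + v2))
      with (plus (u0, (u1 + v1, u2 + v2)) (scal v0 (1, (0, 0)))).
    apply K0; [split; [apply ball_self | split; apply ball_plus] | ]; simpl in *; lra.
    change ((u0 + v0 * 1, (u1 + v1 + v0 * 0, u2 + v2 + v0 * 0)) = (u0 + v0, (u1 + v1, u2 + v2))).
    apply f_equal2; [ring | apply f_equal2; ring]. }
  assert (M1 : Rabs (F (u0, (u1 + v1, u2 + v2)) - F (u0, (u1, u2 + v2))
                     - v1 * d1 (u0, (u1, u2))) <= eta / 3 * Rabs v1).
  { replace (u0, (u1 + v1, u2 + v2)) with (plus (u0, (u1, u2 + v2)) (scal v1 (0, (1, 0)))).
    apply K1; [split; [apply ball_self | split; [apply ball_self | apply ball_plus]] | ];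
      simpl in *; lra.
    change ((u0 + v1 * 0, (u1 + v1 * 1, u2 + v2 + v1 * 0)) = (u0, (u1 + v1, u2 + v2))).
    apply f_equal2; [ring | apply f_equal2; ring]. }
  assert (M2 : Rabs (F (u0, (u1, u2 + v2)) - F (u0, (u1, u2))
                     - v2 * d2 (u0, (u1, u2))) <= eta / 3 * Rabs v2).
  { replace (u0, (u1, u2 + v2)) with (plus (u0, (u1, u2)) (scal v2 (0, (0, 1)))).
    apply K2; [split; [apply ball_self | split; apply ball_self] | ]; simpl in *; lra.
    change ((u0 + v2 * 0, (u1 + v2 * 0, u2 + v2 * 1)) = (u0, (u1, u2 + v2))).
    apply f_equal2; [ring | apply f_equal2; ring]. }
  change (plus (u0, (u1, u2)) (v0, (v1, v2))) with (u0 + v0, (u1 + v1, u2 + v2)).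
  simpl fst. simpl snd.
  replace (F (u0 + v0, (u1 + v1, u2 + v2)) - F (u0, (u1, u2)) -
     (v0 * d0 (u0, (u1, u2)) + (v1 * d1 (u0, (u1, u2)) + v2 * d2 (u0, (u1, u2)))))
    with ((F (u0 + v0, (u1 + v1, u2 + v2)) - F (u0, (u1 + v1, u2 + v2)) - v0 * d0 (u0, (u1, u2)))
          + ((F (u0, (u1 + v1, u2 + v2)) - F (u0, (u1, u2 + v2)) - v1 * d1 (u0, (u1, u2)))
          + (F (u0, (u1, u2 + v2)) - F (u0, (u1, u2)) - v2 * d2 (u0, (u1, u2))))) by ring.
  assert (P0 : eta / 3 * Rabs v0 <= eta / 3 * nv) by (apply Rmult_le_compat_l; lra).
  assert (P1 : eta / 3 * Rabs v1 <= eta / 3 * nv) by (apply Rmult_le_compat_l; lra).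
  assert (P2 : eta / 3 * Rabs v2 <= eta / 3 * nv) by (apply Rmult_le_compat_l; lra).
  eapply Rle_trans; [apply Rabs_triang|].
  eapply Rle_trans; [apply Rplus_le_compat; [exact M0|];
    eapply Rle_trans; [apply Rabs_triang | apply Rplus_le_compat; [exact M1 | exact M2]]|].
  match goal with |- ?a <= _ => change (a <= eta * nv) end.
  apply Rle_trans with (eta / 3 * nv + (eta / 3 * nv + eta / 3 * nv)); [|right; field].
  now repeat apply Rplus_le_compat.
Qed.

Lemma continuous_on_fst {U V W : UniformSpace} (d : U -> W) (u : U) (v : V) :
  continuous d u -> continuous (fun p : U * V => d (fst p)) (u, v).
Proof.
  intros Hd. apply (continuous_comp (fun p : U * V => fst p) d); trivial.
  apply continuous_fst.
Qed.

Local Notation C1_real U := (C1 (U := U) (W := R_NormedModule)).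

Lemma C1_R2 (D : R * R -> Prop) (F d1 d2 : R * R -> R) : open D ->
  dir_derivative D F (1, 0) d1 -> dir_derivative D F (0, 1) d2 -> C1 D F.
Proof.
  intros HD H1 H2. exists (fun u v => fst v * d1 u + snd v * d2 u). split.
  - now apply filterdiff_R2.
  - intros u v Hu.
    apply continuous_Rplus; apply continuous_Rmult;
      try (apply continuous_on_fst; now apply H1 || now apply H2).
    apply continuous_fst_comp, continuous_snd. apply continuous_snd_comp, continuous_snd.
Qed.

Lemma C1_R3 (D : R * (R * R) -> Prop) (F d0 d1 d2 : R * (R * R) -> R) : open D ->
  dir_derivative D F (1, (0, 0)) d0 -> dir_derivative D F (0, (1, 0)) d1 ->
  dir_derivative D F (0, (0, 1)) d2 -> C1 D F.
Proof.
  intros HD H0 H1 H2.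
  exists (fun u v => fst v * d0 u + (fst (snd v) * d1 u + snd (snd v) * d2 u)). split.
  - now apply filterdiff_R3.
  - intros u v Hu.
    repeat apply continuous_Rplus; apply continuous_Rmult;
      try (apply continuous_on_fst; now apply H0 || now apply H1 || now apply H2).
    apply continuous_fst_comp, continuous_snd.
    apply continuous_fst_comp, continuous_snd_comp, continuous_snd.
    apply continuous_snd_comp, continuous_snd_comp, continuous_snd.
Qed.

Lemma Ck_C1_R2 k (D : R * R -> Prop) (F : R * R -> R) :
  open D -> Ck_on (S k) D F -> C1 D F.
Proof.
  intros HD HF.
  destruct (Ck_on_dir_derivative k D F (1, 0) HF) as (d1 & H1 & _).
  destruct (Ck_on_dir_derivative k D F (0, 1) HF) as (d2 & H2 & _).
  now apply C1_R2 with d1 d2.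
Qed.

(** * Perturbation of a reference orbit across finitely many impulses *)

Lemma dist1_pos x y : 0 <= dist1 x y.
Proof. apply Rplus_le_le_0_compat; apply Rabs_pos. Qed.

Lemma dist1_refl x : dist1 x x = 0.
Proof. unfold dist1. rewrite !Rminus_diag, Rabs_R0. ring. Qed.

Lemma Rabs_triang3 a b c : Rabs (a - c) <= Rabs (a - b) + Rabs (b - c).
Proof. replace (a - c) with ((a - b) + (b - c)) by ring. apply Rabs_triang. Qed.

Lemma dist1_triang x y z : dist1 x z <= dist1 x y + dist1 y z.
Proof.
  unfold dist1. pose proof (Rabs_triang3 (fst x) (fst y) (fst z)).
  pose proof (Rabs_triang3 (snd x) (snd y) (snd z)). lra.
Qed.

Definition box (B : R) (x : R * R) : Prop := - B <= fst x <= B /\ - B <= snd x <= B.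

Definition boxclamp (B : R) (x : R * R) : R * R :=
  (clamp (- B) B (fst x), clamp (- B) B (snd x)).

Lemma boxclamp_in B x : 0 < B -> box B (boxclamp B x).
Proof. intros HB. split; apply clamp_in; lra. Qed.

Lemma boxclamp_id B x : box B x -> boxclamp B x = x.
Proof. intros [H1 H2]. unfold boxclamp. rewrite !clamp_id by trivial. now destruct x. Qed.

Lemma boxclamp_lip B x y : dist1 (boxclamp B x) (boxclamp B y) <= dist1 x y.
Proof. apply Rplus_le_compat; apply clamp_lip. Qed.

Lemma continuous_boxclamp B x : continuous (boxclamp B) x.
Proof.
  apply continuous_pair; apply (continuous_comp _ (clamp (- B) B)).
  apply continuous_fst. apply continuous_clamp. apply continuous_snd. apply continuous_clamp.
Qed.

Lemma box_near B0 x y : box B0 x -> dist1 y x <= 1 -> box (B0 + 1) y.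
Proof.
  intros [H1 H2] H. unfold dist1 in H.
  pose proof (Rabs_pos (fst y - fst x)). pose proof (Rabs_pos (snd y - snd x)).
  assert (K1 : Rabs (fst y - fst x) <= 1) by lra. assert (K2 : Rabs (snd y - snd x) <= 1) by lra.
  apply Rabs_le_between in K1. apply Rabs_le_between in K2. split; lra.
Qed.

Lemma cpt_box B : cpt (box B).
Proof. exact (cpt_prod _ _ (cpt_interval (- B) B) (cpt_interval (- B) B)). Qed.

Section Perturbation.
Variables (f : R * R -> R * R) (g : R -> R * R -> R -> R * R)
  (tn : nat -> R) (ln : nat -> R * R -> R -> R * R) (a11 a12 a21 a22 : R * R -> R)
  (N : nat) (B0 L Bg : R).
(** Reference orbits stay in [box B0]; a solution within distance 1 of them stays in [box B], where
    the cut-off is the identity. *)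
Let B := B0 + 1.
Hypothesis (HB0 : 0 < B0) (HL : 0 < L) (HBg : 0 < Bg).
Hypothesis Htn : forall i, tn i < tn (S i).

Hypothesis Hflip : forall x y, box B x -> box B y ->
  Rabs (fst (f x) - fst (f y)) <= L * dist1 x y /\
  Rabs (snd (f x) - snd (f y)) <= L * dist1 x y.
Hypothesis Hftay : forall eta, 0 < eta -> exists del, 0 < del /\
  forall x y, box B0 x -> dist1 y x < del ->
  Rabs (fst (f y) - fst (f x) - ((fst y - fst x) * a11 x + (snd y - snd x) * a12 x))
    <= eta * dist1 y x /\
  Rabs (snd (f y) - snd (f x) - ((fst y - fst x) * a21 x + (snd y - snd x) * a22 x))
    <= eta * dist1 y x.
Hypothesis HgB : forall t x eps, tn O <= t <= tn N -> box B x -> Rabs eps <= 1 ->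
  Rabs (fst (g t x eps)) <= Bg /\ Rabs (snd (g t x eps)) <= Bg.
Hypothesis Hgc : forall eta, 0 < eta -> exists del, 0 < del /\
  forall t x y eps, tn O <= t <= tn N -> box B0 x -> dist1 y x < del -> Rabs eps < del ->
  Rabs (fst (g t y eps) - fst (g t x 0)) <= eta /\
  Rabs (snd (g t y eps) - snd (g t x 0)) <= eta.
Hypothesis HlB : forall i x eps, (i < N)%nat -> box B x -> Rabs eps <= 1 ->
  Rabs (fst (ln i x eps)) <= Bg /\ Rabs (snd (ln i x eps)) <= Bg.
Hypothesis Hlc : forall i eta, (i < N)%nat -> 0 < eta -> exists del, 0 < del /\
  forall x y eps, box B0 x -> dist1 y x < del -> Rabs eps < del ->
  Rabs (fst (ln i y eps) - fst (ln i x 0)) <= eta /\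
  Rabs (snd (ln i y eps) - snd (ln i x 0)) <= eta.

(** Continuity at the endpoints is two-sided, so a piece of solution has to be extended beyond its
    interval; the equation is imposed only inside. *)
Definition solves_on (F : R -> R * R -> R * R) (a b : R) (X : R -> R * R) : Prop :=
  (forall t, a <= t <= b -> continuous X t) /\
  forall t, a < t < b -> is_derive (fun s => fst (X s)) t (fst (F t (X t))) /\
                         is_derive (fun s => snd (X s)) t (snd (F t (X t))).

(** Evaluating at the retracted point makes the field globally Lipschitz in [x], so that solutions
    exist on each whole interval for every initial value. *)
Definition cutfield (eps t : R) (x : R * R) : R * R :=
  (fst (f (boxclamp B x)) + eps * fst (g t (boxclamp B x) eps),
   snd (f (boxclamp B x)) + eps * snd (g t (boxclamp B x) eps)).

Definition jump (eps : R) (i : nat) (y : R * R) : R * R :=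
  (fst y + eps * fst (ln i (boxclamp B y) eps), snd y + eps * snd (ln i (boxclamp B y) eps)).

(** [y i] is the left limit at [tn i] and [X i] the solution on
    [[tn i, tn (i+1)]]. *)
Definition trajectory (eps : R) (y : nat -> R * R) (X : nat -> R -> R * R) : Prop :=
  forall i, (i < N)%nat ->
    X i (tn i) = jump eps i (y i) /\ solves_on (cutfield eps) (tn i) (tn (S i)) (X i) /\
    X i (tn (S i)) = y (S i).

Lemma tn_mono i j : (i <= j)%nat -> tn i <= tn j.
Proof. induction 1. lra. pose proof (Htn m). lra. Qed.

(** Grönwall is applied to the squared Euclidean distance [u], which is differentiable. The rate
    [4 c + 2] comes from [(p + r)^2 <= 2 (p^2 + r^2)] and [2 (p + r) e <= (p + r)^2 + e^2], the
    factor 2 from the return to [dist1]. *)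
Lemma gronwall_dist (e c : R) (F1 F2 : R -> R * R -> R * R) (X Y : R -> R * R) (a b : R) :
  a <= b -> 0 <= c -> 0 <= e ->
  solves_on F1 a b X -> solves_on F2 a b Y ->
  (forall t, a < t < b ->
     Rabs (fst (F1 t (X t)) - fst (F2 t (Y t))) <= c * dist1 (X t) (Y t) + e /\
     Rabs (snd (F1 t (X t)) - snd (F2 t (Y t))) <= c * dist1 (X t) (Y t) + e) ->
  forall t, a <= t <= b ->
    (dist1 (X t) (Y t)) ^ 2
      <= 2 * exp ((4 * c + 2) * (b - a)) * ((dist1 (X a) (Y a)) ^ 2 + e ^ 2 * (b - a)).
Proof.
  intros Hab Hc0 He [HXc HXd] [HYc HYd] HF t Ht.
  set (D1 s := fst (X s) - fst (Y s)). set (D2 s := snd (X s) - snd (Y s)).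
  set (u s := D1 s * D1 s + D2 s * D2 s).
  set (u' s := 2 * (D1 s * (fst (F1 s (X s)) - fst (F2 s (Y s)))
                  + D2 s * (snd (F1 s (X s)) - snd (F2 s (Y s))))).
  assert (Hd : forall s, dist1 (X s) (Y s) = Rabs (D1 s) + Rabs (D2 s)) by reflexivity.
  assert (H : u t <= exp ((4 * c + 2) * (t - a)) * (u a + e ^ 2 * (t - a))).
  { apply (gronwall u u' a t (4 * c + 2) (e ^ 2)); [lra | lra | apply pow2_ge_0 | |].
    - intros s Hs. specialize (HXc s ltac:(lra)). specialize (HYc s ltac:(lra)).
      assert (continuous D1 s).
      { apply continuous_Rminus; now apply continuous_fst_comp. }
      assert (continuous D2 s).
      { apply continuous_Rminus; now apply continuous_snd_comp. }
      apply continuous_Rplus; now apply continuous_Rmult.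
    - intros s Hs. destruct (HXd s ltac:(lra)) as [X1 X2]. destruct (HYd s ltac:(lra)) as [Y1 Y2].
      assert (DD1 : is_derive D1 s (fst (F1 s (X s)) - fst (F2 s (Y s))))
        by now apply is_derive_Rminus.
      assert (DD2 : is_derive D2 s (snd (F1 s (X s)) - snd (F2 s (Y s))))
        by now apply is_derive_Rminus.
      destruct (HF s ltac:(lra)) as [K1 K2]. rewrite Hd in K1, K2.
      unfold u', u.
      set (d1 := fst (F1 s (X s)) - fst (F2 s (Y s))) in *.
      set (d2 := snd (F1 s (X s)) - snd (F2 s (Y s))) in *.
      split.
      + replace (2 * (D1 s * d1 + D2 s * d2))
          with ((d1 * D1 s + D1 s * d1) + (d2 * D2 s + D2 s * d2)) by ring.
        apply is_derive_Rplus; now apply is_derive_Rmult.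
      + assert (P1 : D1 s * d1 <= Rabs (D1 s) * (c * (Rabs (D1 s) + Rabs (D2 s)) + e)).
        { apply Rle_trans with (1 := Rle_abs _). rewrite Rabs_mult.
          apply Rmult_le_compat_l; [apply Rabs_pos | trivial]. }
        assert (P2 : D2 s * d2 <= Rabs (D2 s) * (c * (Rabs (D1 s) + Rabs (D2 s)) + e)).
        { apply Rle_trans with (1 := Rle_abs _). rewrite Rabs_mult.
          apply Rmult_le_compat_l; [apply Rabs_pos | trivial]. }
        assert (S1 : D1 s * D1 s = Rabs (D1 s) * Rabs (D1 s)).
        { apply Rsqr_abs. }
        assert (S2 : D2 s * D2 s = Rabs (D2 s) * Rabs (D2 s)).
        { apply Rsqr_abs. }
        rewrite S1, S2. set (p := Rabs (D1 s)) in *. set (r := Rabs (D2 s)) in *.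
        assert (Q0 : (p + r) * (p + r) <= 2 * (p * p + r * r))
          by (pose proof (Rle_0_sqr (p - r)); unfold Rsqr in *; lra).
        assert (Q1 : c * ((p + r) * (p + r)) <= c * (2 * (p * p + r * r)))
          by now apply Rmult_le_compat_l.
        assert (Q2 : 2 * ((p + r) * e) <= (p + r) * (p + r) + e ^ 2)
          by (pose proof (pow2_ge_0 (p + r - e)); lra).
        nra. }
  assert (Hu : forall s, (dist1 (X s) (Y s)) ^ 2 <= 2 * u s /\ u s <= (dist1 (X s) (Y s)) ^ 2).
  { intros s. rewrite Hd. unfold u.
    assert (S1 : D1 s * D1 s = Rabs (D1 s) * Rabs (D1 s)).
    { apply Rsqr_abs. }
    assert (S2 : D2 s * D2 s = Rabs (D2 s) * Rabs (D2 s)).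
    { apply Rsqr_abs. }
    rewrite S1, S2. pose proof (Rabs_pos (D1 s)). pose proof (Rabs_pos (D2 s)).
    set (p := Rabs (D1 s)) in *. set (r := Rabs (D2 s)) in *.
    pose proof (pow2_ge_0 (p - r)). pose proof (Rmult_le_pos p r). split; nra. }
  destruct (Hu t) as [U1 _]. destruct (Hu a) as [_ U2].
  assert (He2 : 0 <= e ^ 2) by apply pow2_ge_0.
  assert (Hua : 0 <= u a) by (apply Rplus_le_le_0_compat; apply Rle_0_sqr).
  apply Rle_trans with (1 := U1). rewrite Rmult_assoc. apply Rmult_le_compat_l; [lra|].
  apply Rle_trans with (1 := H). apply Rmult_le_compat.
  - left; apply exp_pos.
  - nra.
  - destruct (Rle_lt_or_eq_dec t b) as [Hl| ->]; [lra| |right; trivial].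
    left. apply exp_increasing. nra.
  - nra.
Qed.

Variables (Prm : Type) (Kp : Prm -> Prop) (Q W : Prm -> R -> R * R) (CW : R).
Hypothesis HCW : 0 < CW.
Hypothesis HQbox : forall p t, Kp p -> tn O <= t <= tn N -> box B0 (Q p t).
Hypothesis HQ : forall p t, Kp p ->
  is_derive (fun s => fst (Q p s)) t (fst (f (Q p t))) /\
  is_derive (fun s => snd (Q p s)) t (snd (f (Q p t))).
Hypothesis HWB : forall p t, Kp p -> tn O <= t <= tn N ->
  Rabs (fst (W p t)) <= CW /\ Rabs (snd (W p t)) <= CW.
(** The weights solve the adjoint variational equation, so that [W . (X - Q)]
    only changes through the perturbation, up to second order. *)
Hypothesis HW : forall p t, Kp p ->
  is_derive (fun s => fst (W p s)) t
    (- (fst (W p t) * a11 (Q p t) + snd (W p t) * a21 (Q p t))) /\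
  is_derive (fun s => snd (W p s)) t
    (- (fst (W p t) * a12 (Q p t) + snd (W p t) * a22 (Q p t))).

Lemma Q_solves p a b : Kp p -> solves_on (fun _ x => f x) a b (Q p).
Proof.
  intros Hp. split; intros t _; [|now apply HQ]. destruct (HQ p t Hp) as [H1 H2].
  apply continuous_ext with (fun s => (fst (Q p s), snd (Q p s))).
  intros s; now destruct (Q p s).
  apply continuous_pair; apply (ex_derive_continuous (V := R_NormedModule)).
  now exists (fst (f (Q p t))). now exists (snd (f (Q p t))).
Qed.

(** Uses [S + 1] as an upper bound for the square root of [S]. *)
Lemma sqr_le_bound d S e : 0 <= S -> 0 <= e -> d ^ 2 <= S * e ^ 2 -> d <= (S + 1) * e.
Proof.
  intros HS He Hd. apply Rnot_lt_le. intros Hlt.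
  assert (((S + 1) * e) ^ 2 < d ^ 2).
  { simpl. rewrite !Rmult_1_r. apply Rmult_le_0_lt_compat; trivial; nra. }
  assert (S * e ^ 2 <= ((S + 1) * e) ^ 2).
  { assert (0 <= e ^ 2) by apply pow2_ge_0. replace (((S + 1) * e) ^ 2) with ((S + 1) ^ 2 * e ^ 2) by ring.
    apply Rmult_le_compat_r; nra. }
  lra.
Qed.

(** A jump adds at most [2 Bg |eps|], and Grönwall with defect [Bg |eps|] carries the distance
    across the next interval. The cut-off confines the arguments of [f], [g] and [ln] to the box, so
    no a priori bound on the trajectory is required, and [C] serves all parameters at once. *)
Lemma trajectory_close i : (i <= N)%nat -> exists C, 0 < C /\
  forall eps p y X, Rabs eps <= 1 -> Kp p -> trajectory eps y X -> y O = Q p (tn O) ->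
    dist1 (y i) (Q p (tn i)) <= C * Rabs eps /\
    forall j t, (j < i)%nat -> tn j <= t <= tn (S j) ->
      dist1 (X j t) (Q p t) <= C * Rabs eps.
Proof.
  induction i; intros Hi.
  - exists 1. split; [lra|]. intros eps p y X He Hp HX H0. split.
    + rewrite H0, dist1_refl. pose proof (Rabs_pos eps). lra.
    + intros; lia.
  - destruct IHi as (C & HC & IH); [lia|].
    set (S0 := 2 * exp ((4 * L + 2) * (tn (S i) - tn i))
                 * ((C + 2 * Bg) ^ 2 + Bg ^ 2 * (tn (S i) - tn i))).
    pose proof (Htn i) as Hti.
    assert (HS0 : 0 <= S0).
    { unfold S0. pose proof (exp_pos ((4 * L + 2) * (tn (S i) - tn i))).
      apply Rmult_le_pos; [lra|]. nra. }
    exists (C + (S0 + 1)). split; [lra|].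
    intros eps p y X He Hp HX H0. destruct (IH eps p y X He Hp HX H0) as [IH1 IH2].
    pose proof (Rabs_pos eps) as Hpe.
    destruct (HX i ltac:(lia)) as (HXi & HXs & HXe).
    assert (Hint : forall t, tn i <= t <= tn (S i) -> tn O <= t <= tn N).
    { intros t Ht. pose proof (tn_mono O i ltac:(lia)). pose proof (tn_mono (S i) N ltac:(lia)). lra. }
    assert (Hstart : dist1 (X i (tn i)) (Q p (tn i)) <= (C + 2 * Bg) * Rabs eps).
    { apply Rle_trans with (1 := dist1_triang _ (y i) _).
      assert (dist1 (X i (tn i)) (y i) <= 2 * Bg * Rabs eps); [|lra].
      rewrite HXi. unfold dist1, jump. simpl.
      destruct (HlB i (boxclamp B (y i)) eps) as [L1 L2]; trivial.
      apply boxclamp_in; unfold B; lra.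
      replace (fst (y i) + eps * fst (ln i (boxclamp B (y i)) eps) - fst (y i))
        with (eps * fst (ln i (boxclamp B (y i)) eps)) by ring.
      replace (snd (y i) + eps * snd (ln i (boxclamp B (y i)) eps) - snd (y i))
        with (eps * snd (ln i (boxclamp B (y i)) eps)) by ring.
      rewrite !Rabs_mult. nra. }
    assert (Hall : forall t, tn i <= t <= tn (S i) ->
              dist1 (X i t) (Q p t) <= (S0 + 1) * Rabs eps).
    { intros t Ht. apply sqr_le_bound; trivial.
      apply Rle_trans with (2 * exp ((4 * L + 2) * (tn (S i) - tn i)) *
         ((dist1 (X i (tn i)) (Q p (tn i))) ^ 2 + (Bg * Rabs eps) ^ 2 * (tn (S i) - tn i))).
      - apply (gronwall_dist (Bg * Rabs eps) L (cutfield eps) (fun _ x => f x)); trivial; try lra.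
        nra. now apply Q_solves.
        intros s Hs. assert (Hs' : tn O <= s <= tn N) by (apply Hint; lra).
        assert (HBp : 0 < B) by (unfold B; lra).
        pose proof (HQbox p s Hp Hs') as HQb.
        assert (HQB : box B (Q p s)) by (destruct HQb; unfold B; split; lra).
        destruct (Hflip (boxclamp B (X i s)) (Q p s)) as [F1 F2]; trivial.
        now apply boxclamp_in.
        destruct (HgB s (boxclamp B (X i s)) eps) as [G1 G2]; trivial. now apply boxclamp_in.
        assert (HPd : dist1 (boxclamp B (X i s)) (Q p s) <= dist1 (X i s) (Q p s)).
        { rewrite <- (boxclamp_id B (Q p s)) at 1; trivial. apply boxclamp_lip. }
        unfold cutfield; simpl. set (bx := boxclamp B (X i s)) in *.
        assert (Hone : forall F G A, Rabs (F - A) <= L * dist1 bx (Q p s) -> Rabs G <= Bg ->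
             Rabs (F + eps * G - A) <= L * dist1 (X i s) (Q p s) + Bg * Rabs eps).
        { intros F G A HF HG. replace (F + eps * G - A) with ((F - A) + eps * G) by ring.
          apply Rle_trans with (1 := Rabs_triang _ _). rewrite Rabs_mult. nra. }
        split; now apply Hone.
      - unfold S0. set (E := exp ((4 * L + 2) * (tn (S i) - tn i))).
        assert (HE : 0 < E) by apply exp_pos.
        replace (2 * E * ((C + 2 * Bg) ^ 2 + Bg ^ 2 * (tn (S i) - tn i)) * Rabs eps ^ 2)
          with (2 * E * (((C + 2 * Bg) * Rabs eps) ^ 2 + (Bg * Rabs eps) ^ 2 * (tn (S i) - tn i)))
          by ring.
        apply Rmult_le_compat_l; [lra|]. apply Rplus_le_compat_r.
        apply pow_incr. split; [apply dist1_pos | trivial]. }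
    split.
    + rewrite <- HXe. specialize (Hall (tn (S i)) ltac:(lra)). nra.
    + intros j t Hj Ht. destruct (Nat.eq_dec j i) as [->|Hne].
      * specialize (Hall t Ht). nra.
      * specialize (IH2 j t ltac:(lia) Ht). nra.
Qed.

Definition melnikov_density (p : Prm) (t : R) : R := rowcol (W p t) (g t (Q p t) 0).

(** Arranged in the order in which a trajectory meets the perturbation: the jump at [tn j], then the
    flow up to [tn (S j)]. The impulse at the right end of the window is thus left out. *)
Fixpoint melnikov_partial (p : Prm) (i : nat) : R :=
  match i with
  | O => 0
  | S j => melnikov_partial p j + rowcol (W p (tn j)) (ln j (Q p (tn j)) 0)
           + RInt (melnikov_density p) (tn j) (tn (S j))
  end.

Hypothesis Hdens : forall p t, Kp p -> continuous (melnikov_density p) t.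

Definition rowdiff (w x y : R * R) : R := fst w * (fst x - fst y) + snd w * (snd x - snd y).

(** On an interval, [W . (X - Q)] minus [eps] times the integral of the density has a derivative
    made of the Taylor remainder of [f] and the variation of [g]. Both are [o(eps)] because [X - Q]
    is [O(eps)], uniformly in the parameter; an impulse is treated in the same way. *)
Lemma trajectory_melnikov i : (i <= N)%nat -> forall eta, 0 < eta -> exists del, 0 < del /\
  forall eps p y X, Rabs eps < del -> Kp p -> trajectory eps y X -> y O = Q p (tn O) ->
    Rabs (rowdiff (W p (tn i)) (y i) (Q p (tn i)) - eps * melnikov_partial p i)
      <= eta * Rabs eps.
Proof.
  induction i; intros Hi eta Heta.
  - exists 1. split; [lra|]. intros eps p y X He Hp HX H0. simpl.
    rewrite H0. unfold rowdiff. rewrite !Rminus_diag.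
    replace (_ + _ - _) with 0 by ring. rewrite Rabs_R0. pose proof (Rabs_pos eps). nra.
  - pose proof (Htn i) as Hti.
    destruct (IHi ltac:(lia) (eta / 2) ltac:(lra)) as (del0 & Hdel0 & IH).
    destruct (trajectory_close N (le_n N)) as (C & HC & Hclose).
    destruct (trajectory_close i ltac:(lia)) as (C' & HC' & Hclose').
    set (T := tn (S i) - tn i). assert (HT : 0 < T) by (unfold T; lra).
    (* Chosen so that the error [2 CW e1] at the impulse and [2 CW (C + 1) e1 T] along the interval
       total [eta / 2]; the induction hypothesis takes the other half. *)
    set (e1 := eta / 2 / (2 * CW * (1 + (C + 1) * T))).
    assert (HCT : 0 < (C + 1) * T) by (apply Rmult_lt_0_compat; lra).
    assert (Hden : 0 < 2 * CW * (1 + (C + 1) * T)) by (apply Rmult_lt_0_compat; lra).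
    assert (He1 : 0 < e1) by (apply Rdiv_lt_0_compat; lra).
    assert (He1' : 2 * CW * e1 + 2 * CW * ((C + 1) * e1) * T = eta / 2).
    { unfold e1. field. lra. }
    destruct (Hftay e1 He1) as (d1 & Hd1 & Tay).
    destruct (Hgc e1 He1) as (d2 & Hd2 & Gc).
    destruct (Hlc i e1 ltac:(lia) He1) as (d3 & Hd3 & Lc).
    destruct (common_radius d1 d2 d3 1 1) as (dm & Hdm & Hm1 & Hm2 & Hm3 & Hm4 & _); try lra.
    assert (HCC : 0 < C + C' + 1) by lra.
    exists (Rmin del0 (dm / (C + C' + 1))). split.
    { apply Rmin_pos; trivial. now apply Rdiv_lt_0_compat. }
    intros eps p y X He Hp HX H0.
    pose proof (Rmin_l del0 (dm / (C + C' + 1))). pose proof (Rmin_r del0 (dm / (C + C' + 1))).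
    pose proof (Rabs_pos eps) as Hpe.
    assert (Hsm : (C + C' + 1) * Rabs eps < dm).
    { apply (Rmult_lt_reg_r (/ (C + C' + 1))). now apply Rinv_0_lt_compat.
      rewrite (Rmult_comm (C + C' + 1)), Rmult_assoc, Rinv_r by lra. unfold Rdiv in *. lra. }
    assert (Heps : Rabs eps < dm) by nra.
    assert (HCe : C * Rabs eps < dm) by nra. assert (HCe' : C' * Rabs eps < dm) by nra.
    specialize (IH eps p y X ltac:(lra) Hp HX H0).
    destruct (Hclose eps p y X ltac:(lra) Hp HX H0) as [_ HcX].
    destruct (Hclose' eps p y X ltac:(lra) Hp HX H0) as [Hcy _].
    destruct (HX i ltac:(lia)) as (HXi & [HXc HXd] & HXe).
    assert (Hint : forall t, tn i <= t <= tn (S i) -> tn O <= t <= tn N).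
    { intros t Ht. pose proof (tn_mono O i ltac:(lia)). pose proof (tn_mono (S i) N ltac:(lia)). lra. }
    (* For small [eps] the trajectory lies within 1 of the reference orbit, so from here on the
       cut-off disappears. *)
    assert (Hyb : boxclamp B (y i) = y i).
    { apply boxclamp_id. apply (box_near B0 (Q p (tn i))); [|lra]. apply HQbox; trivial.
      apply Hint; lra. }
    set (dens := melnikov_density p).
    set (phi t := rowdiff (W p t) (X i t) (Q p t) - eps * RInt dens (tn i) t).
    set (R1 t := fst (f (X i t)) - fst (f (Q p t)) - ((fst (X i t) - fst (Q p t)) * a11 (Q p t)
                   + (snd (X i t) - snd (Q p t)) * a12 (Q p t))).
    set (R2 t := snd (f (X i t)) - snd (f (Q p t)) - ((fst (X i t) - fst (Q p t)) * a21 (Q p t)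
                   + (snd (X i t) - snd (Q p t)) * a22 (Q p t))).
    set (G1 t := fst (g t (X i t) eps) - fst (g t (Q p t) 0)).
    set (G2 t := snd (g t (X i t) eps) - snd (g t (Q p t) 0)).
    (* The derivative of [phi]: the linear part of [f (X) - f (Q)] has cancelled against the adjoint
       equation. *)
    set (phi' t := fst (W p t) * (R1 t + eps * G1 t) + snd (W p t) * (R2 t + eps * G2 t)).
    assert (Hphi : Rabs (phi (tn (S i)) - phi (tn i)) <= 2 * CW * ((C + 1) * e1) * Rabs eps * T).
    { assert (HQc : forall t, continuous (Q p) t).
      { intros t. apply (proj1 (Q_solves p t t Hp)). lra. }
      assert (Hder : forall t, is_derive (fun t => RInt dens (tn i) t) t (dens t)).
      { intros t. apply (is_derive_RInt dens _ (tn i)).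
        - apply filter_forall. intros z. apply (RInt_correct (V := R_CompleteNormedModule)).
          apply (ex_RInt_continuous (V := R_CompleteNormedModule)). intros; now apply Hdens.
        - now apply Hdens. }
      pose proof (derive_compare_abs phi (fun t => 2 * CW * ((C + 1) * e1) * Rabs eps * t)
         phi' (fun _ => 2 * CW * ((C + 1) * e1) * Rabs eps) (tn i) (tn (S i))) as K.
      cbv beta in K. unfold T.
      replace (2 * CW * ((C + 1) * e1) * Rabs eps * (tn (S i) - tn i)) with
        (2 * CW * ((C + 1) * e1) * Rabs eps * tn (S i) - 2 * CW * ((C + 1) * e1) * Rabs eps * tn i)
        by ring.
      apply K; [lra | |].
      - intros t Ht. split.
        + specialize (HXc t Ht). destruct (HW p t Hp) as [W1 W2].
          apply continuous_Rminus.
          * apply continuous_Rplus; apply continuous_Rmult.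
            -- apply (ex_derive_continuous (V := R_NormedModule)). eexists; exact W1.
            -- apply continuous_Rminus; now apply continuous_fst_comp.
            -- apply (ex_derive_continuous (V := R_NormedModule)). eexists; exact W2.
            -- apply continuous_Rminus; now apply continuous_snd_comp.
          * apply continuous_Rmult. apply continuous_const.
            apply (ex_derive_continuous (V := R_NormedModule)). eexists; apply Hder.
        + apply (ex_derive_continuous (V := R_NormedModule)). auto_derive. trivial.
      - intros t Ht. assert (Ht' : tn i <= t <= tn (S i)) by lra.
        destruct (HW p t Hp) as [W1 W2]. destruct (HQ p t Hp) as [Q1 Q2].
        destruct (HXd t Ht) as [X1 X2].
        pose proof (HcX i t ltac:(lia) Ht') as Hd.
        pose proof (HQbox p t Hp (Hint t Ht')) as HQb.
        assert (HXb : boxclamp B (X i t) = X i t).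
        { apply boxclamp_id. apply (box_near B0 (Q p t)); trivial. lra. }
        unfold cutfield in X1, X2. simpl in X1, X2. rewrite HXb in X1, X2.
        split; [|split].
        + unfold phi, rowdiff.
          replace (phi' t) with
           (((- (fst (W p t) * a11 (Q p t) + snd (W p t) * a21 (Q p t)))
               * (fst (X i t) - fst (Q p t))
             + fst (W p t) * (fst (f (X i t)) + eps * fst (g t (X i t) eps) - fst (f (Q p t)))
            + ((- (fst (W p t) * a12 (Q p t) + snd (W p t) * a22 (Q p t)))
               * (snd (X i t) - snd (Q p t))
             + snd (W p t) * (snd (f (X i t)) + eps * snd (g t (X i t) eps) - snd (f (Q p t)))))
            - eps * dens t).
          * apply is_derive_Rminus.
            -- apply is_derive_Rplus.
               ++ apply (is_derive_Rmult (fun s => fst (W p s)) (fun s => fst (X i s) - fst (Q p s)));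
                    trivial. now apply is_derive_Rminus.
               ++ apply (is_derive_Rmult (fun s => snd (W p s)) (fun s => snd (X i s) - snd (Q p s)));
                    trivial. now apply is_derive_Rminus.
            -- apply (is_derive_scal (fun t => RInt dens (tn i) t)). apply Hder.
          * unfold phi', R1, R2, G1, G2, dens, melnikov_density, rowcol. ring.
        + auto_derive; [trivial | ring].
        + destruct (Tay (Q p t) (X i t)) as [T1 T2]; trivial; [lra|].
          destruct (Gc t (Q p t) (X i t) eps) as [K1 K2]; trivial; [now apply Hint|lra|lra|].
          fold (R1 t) in T1. fold (R2 t) in T2. fold (G1 t) in K1. fold (G2 t) in K2.
          destruct (HWB p t Hp (Hint t Ht')) as [V1 V2].
          assert (Hone : forall v r k, Rabs v <= CW -> Rabs r <= e1 * dist1 (X i t) (Q p t) ->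
              Rabs k <= e1 -> Rabs (v * (r + eps * k)) <= CW * ((C + 1) * e1 * Rabs eps)).
          { intros v r k Hv Hr Hk. rewrite Rabs_mult.
            apply Rmult_le_compat; try apply Rabs_pos; trivial.
            apply Rle_trans with (1 := Rabs_triang _ _). rewrite Rabs_mult.
            assert (e1 * dist1 (X i t) (Q p t) <= e1 * (C * Rabs eps))
              by (apply Rmult_le_compat_l; lra).
            assert (Rabs eps * Rabs k <= Rabs eps * e1) by now apply Rmult_le_compat_l.
            nra. }
          apply Rle_trans with (1 := Rabs_triang _ _).
          pose proof (Hone _ _ _ V1 T1 K1). pose proof (Hone _ _ _ V2 T2 K2). lra. }
    assert (Hphi0 : phi (tn i) = rowdiff (W p (tn i)) (y i) (Q p (tn i))
               + eps * rowcol (W p (tn i)) (ln i (y i) eps)).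
    { unfold phi. rewrite RInt_point. rewrite HXi. unfold jump. rewrite Hyb.
      unfold rowdiff, rowcol. simpl. change (@zero R_CompleteNormedModule) with 0. ring. }
    assert (HL0 : Rabs (rowcol (W p (tn i)) (ln i (y i) eps)
                   - rowcol (W p (tn i)) (ln i (Q p (tn i)) 0)) <= 2 * CW * e1).
    { assert (Hi0 : tn O <= tn i <= tn N) by (apply Hint; lra).
      destruct (Lc (Q p (tn i)) (y i) eps) as [K1 K2]; [now apply HQbox|lra|lra|].
      destruct (HWB p (tn i) Hp Hi0) as [V1 V2]. unfold rowcol.
      replace (_ - _) with (fst (W p (tn i)) * (fst (ln i (y i) eps) - fst (ln i (Q p (tn i)) 0))
        + snd (W p (tn i)) * (snd (ln i (y i) eps) - snd (ln i (Q p (tn i)) 0))) by ring.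
      apply Rle_trans with (1 := Rabs_triang _ _). rewrite !Rabs_mult.
      assert (forall v k, Rabs v <= CW -> Rabs k <= e1 -> Rabs v * Rabs k <= CW * e1).
      { intros v k Hv Hk. apply Rmult_le_compat; trivial; apply Rabs_pos. }
      pose proof (H2 _ _ V1 K1). pose proof (H2 _ _ V2 K2). lra. }
    simpl melnikov_partial.
    replace (rowdiff (W p (tn (S i))) (y (S i)) (Q p (tn (S i)))) with
      (phi (tn (S i)) + eps * RInt dens (tn i) (tn (S i)))
      by (unfold phi; rewrite HXe; ring).
    fold dens.
    replace (_ - _) with ((phi (tn (S i)) - phi (tn i))
       + ((rowdiff (W p (tn i)) (y i) (Q p (tn i)) - eps * melnikov_partial p i)
       + eps * (rowcol (W p (tn i)) (ln i (y i) eps) - rowcol (W p (tn i)) (ln i (Q p (tn i)) 0))))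
      by (rewrite Hphi0; ring).
    apply Rle_trans with (1 := Rabs_triang _ _).
    eapply Rle_trans. apply Rplus_le_compat_l, Rabs_triang.
    rewrite (Rabs_mult eps).
    assert (Rabs eps * Rabs (rowcol (W p (tn i)) (ln i (y i) eps) -
       rowcol (W p (tn i)) (ln i (Q p (tn i)) 0)) <= Rabs eps * (2 * CW * e1))
      by now apply Rmult_le_compat_l.
    assert (eta * Rabs eps = eta / 2 * Rabs eps
       + (2 * CW * e1 + 2 * CW * ((C + 1) * e1) * T) * Rabs eps) by (rewrite He1'; field).
    nra.
Qed.

End Perturbation.

(** * Planar mean value estimates *)

Definition has_partials (F d1 d2 : R * R -> R) : Prop :=
  forall x, is_derive (fun z => F (z, snd x)) (fst x) (d1 x) /\
            is_derive (fun z => F (fst x, z)) (snd x) (d2 x).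

Lemma mean_value_1 (F d : R -> R) (a b : R) :
  (forall z, Rmin a b <= z <= Rmax a b -> is_derive F z (d z)) ->
  exists c, Rmin a b <= c <= Rmax a b /\ F b - F a = (b - a) * d c.
Proof.
  intros H. destruct (MVT_gen F a b d) as (c & Hc & E).
  - intros x Hx. apply H. lra.
  - intros x Hx. apply continuity_pt_filterlim, (ex_derive_continuous F).
    exists (d x). now apply H.
  - exists c. split; trivial. rewrite E. ring.
Qed.

Lemma mean_value_2 F d1 d2 (x y : R * R) : has_partials F d1 d2 ->
  exists c1 c2, Rmin (fst x) (fst y) <= c1 <= Rmax (fst x) (fst y) /\
    Rmin (snd x) (snd y) <= c2 <= Rmax (snd x) (snd y) /\
    F y - F x = (fst y - fst x) * d1 (c1, snd y) + (snd y - snd x) * d2 (fst x, c2).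
Proof.
  intros H.
  destruct (mean_value_1 (fun z => F (z, snd y)) (fun z => d1 (z, snd y)) (fst x) (fst y))
    as (c1 & Hc1 & E1).
  { intros z _. apply (proj1 (H (z, snd y))). }
  destruct (mean_value_1 (fun z => F (fst x, z)) (fun z => d2 (fst x, z)) (snd x) (snd y))
    as (c2 & Hc2 & E2).
  { intros z _. apply (proj2 (H (fst x, z))). }
  exists c1, c2. split; [|split]; trivial. rewrite <- E1, <- E2.
  destruct x, y; simpl. ring.
Qed.

Lemma between_box B x1 y1 c : - B <= x1 <= B -> - B <= y1 <= B ->
  Rmin x1 y1 <= c <= Rmax x1 y1 -> - B <= c <= B.
Proof. unfold Rmin, Rmax. destruct (Rle_dec x1 y1); lra. Qed.

Lemma between_near x1 y1 c : Rmin x1 y1 <= c <= Rmax x1 y1 -> Rabs (c - x1) <= Rabs (y1 - x1).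
Proof.
  unfold Rmin, Rmax. destruct (Rle_dec x1 y1); intros H.
  rewrite !Rabs_pos_eq; lra. rewrite !Rabs_left1; lra.
Qed.

(** The compact parameter set is there for [g], which needs one constant for all times in the window
    and all small [eps]. *)
Lemma lipschitz_on_box {S : UniformSpace} (K : S -> Prop) (F d1 d2 : S -> R * R -> R) (B : R) :
  cpt K -> (forall s, has_partials (F s) (d1 s) (d2 s)) ->
  (forall z : S * (R * R), continuous (fun z => d1 (fst z) (snd z)) z) ->
  (forall z : S * (R * R), continuous (fun z => d2 (fst z) (snd z)) z) ->
  exists L, 0 < L /\ forall s x y, K s -> box B x -> box B y ->
    Rabs (F s x - F s y) <= L * dist1 x y.
Proof.
  intros HK HF H1 H2.
  pose proof (cpt_prod K (box B) HK (cpt_box B)) as HKB.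
  destruct (cpt_bounded _ (fun z : S * (R * R) => d1 (fst z) (snd z)) HKB) as (L1 & P1 & B1); auto.
  destruct (cpt_bounded _ (fun z : S * (R * R) => d2 (fst z) (snd z)) HKB) as (L2 & P2 & B2); auto.
  exists (L1 + L2). split; [lra|]. intros s x y Hs [Hx1 Hx2] [Hy1 Hy2].
  destruct (mean_value_2 (F s) (d1 s) (d2 s) y x (HF s)) as (c1 & c2 & Hc1 & Hc2 & E).
  rewrite E.
  pose proof (between_box _ _ _ _ Hy1 Hx1 Hc1) as I1.
  pose proof (between_box _ _ _ _ Hy2 Hx2 Hc2) as I2.
  assert (K1 : Rabs (d1 s (c1, snd x)) <= L1) by (apply (B1 (s, (c1, snd x))); repeat split; simpl; trivial; lra).
  assert (K2 : Rabs (d2 s (fst y, c2)) <= L2) by (apply (B2 (s, (fst y, c2))); repeat split; simpl; trivial; lra).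
  apply Rle_trans with (1 := Rabs_triang _ _). rewrite !Rabs_mult. unfold dist1.
  pose proof (Rabs_pos (fst x - fst y)) as A1. pose proof (Rabs_pos (snd x - snd y)) as A2.
  pose proof (Rmult_le_compat_l _ _ _ A1 K1). pose proof (Rmult_le_compat_l _ _ _ A2 K2).
  pose proof (Rmult_le_pos L1 (Rabs (snd x - snd y)) ltac:(lra) A2).
  pose proof (Rmult_le_pos L2 (Rabs (fst x - fst y)) ltac:(lra) A1). lra.
Qed.

(** Mean values of the partial derivatives are compared with their values at [x]. Only [x] must lie
    in the box, since the uniform continuity is one-sided in this sense. *)
Lemma taylor_on_box (F d1 d2 : R * R -> R) (B eta : R) :
  has_partials F d1 d2 -> (forall x, continuous d1 x) -> (forall x, continuous d2 x) -> 0 < eta ->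
  exists del, 0 < del /\ forall x y, box B x -> dist1 y x < del ->
    Rabs (F y - F x - ((fst y - fst x) * d1 x + (snd y - snd x) * d2 x)) <= eta * dist1 y x.
Proof.
  intros HF H1 H2 Heta.
  destruct (cpt_unif_cont (box B) d1 eta (cpt_box B)) as (e1 & He1 & U1); auto.
  destruct (cpt_unif_cont (box B) d2 eta (cpt_box B)) as (e2 & He2 & U2); auto.
  exists (Rmin e1 e2). split. now apply Rmin_pos.
  intros x y Hx Hd. pose proof (Rmin_l e1 e2). pose proof (Rmin_r e1 e2).
  destruct (mean_value_2 F d1 d2 x y HF) as (c1 & c2 & Hc1 & Hc2 & E).
  rewrite E. apply between_near in Hc1. apply between_near in Hc2.
  unfold dist1 in *.
  pose proof (Rabs_pos (fst y - fst x)). pose proof (Rabs_pos (snd y - snd x)).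
  assert (K1 : Rabs (d1 (c1, snd y) - d1 x) < eta).
  { apply U1; trivial. split; apply ball_R; simpl; lra. }
  assert (K2 : Rabs (d2 (fst x, c2) - d2 x) < eta).
  { apply U2; trivial. split; apply ball_R; simpl. rewrite Rminus_diag, Rabs_R0. lra. lra. }
  replace (_ - _) with ((fst y - fst x) * (d1 (c1, snd y) - d1 x)
     + (snd y - snd x) * (d2 (fst x, c2) - d2 x)) by ring.
  apply Rle_trans with (1 := Rabs_triang _ _). rewrite !Rabs_mult.
  assert (Rabs (fst y - fst x) * Rabs (d1 (c1, snd y) - d1 x) <= Rabs (fst y - fst x) * eta)
    by (apply Rmult_le_compat_l; lra).
  assert (Rabs (snd y - snd x) * Rabs (d2 (fst x, c2) - d2 x) <= Rabs (snd y - snd x) * eta)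
    by (apply Rmult_le_compat_l; lra).
  lra.
Qed.

Lemma is_derive_shift (F : R -> R) (x l : R) :
  is_derive (fun s => F (x + s)) 0 l -> is_derive F x l.
Proof.
  intros H.
  apply is_derive_ext with (fun z => (fun s => F (x + s)) (z - x)).
  { intros z. f_equal. ring. }
  replace l with (1 * l) by ring.
  apply (is_derive_comp (fun s => F (x + s)) (fun z => z - x)).
  - now rewrite Rminus_diag.
  - auto_derive; trivial; ring.
Qed.

Lemma dir_partial_1 (D : R * R -> Prop) (F d : R * R -> R) x :
  dir_derivative (U := R2) D F (1, 0) d -> D x -> is_derive (fun z => F (z, snd x)) (fst x) (d x).
Proof.
  intros [H _] Hx. apply is_derive_shift. specialize (H x Hx).
  eapply is_derive_ext; [|exact H]. intros s. simpl. f_equal. destruct x as [x1 x2].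
  change ((x1 + s * 1, x2 + s * 0) = (x1 + s, x2)). f_equal; ring.
Qed.

Lemma dir_partial_2 (D : R * R -> Prop) (F d : R * R -> R) x :
  dir_derivative (U := R2) D F (0, 1) d -> D x -> is_derive (fun z => F (fst x, z)) (snd x) (d x).
Proof.
  intros [H _] Hx. apply is_derive_shift. specialize (H x Hx).
  eapply is_derive_ext; [|exact H]. intros s. simpl. f_equal. destruct x as [x1 x2].
  change ((x1 + s * 0, x2 + s * 1) = (x1, x2 + s)). f_equal; ring.
Qed.

Lemma open_snd (V : R -> Prop) : is_open_interval V -> open (fun u : R * R => V (snd u)).
Proof.
  intros (a & b & HV). apply (open_comp snd V).
  - intros x _. apply continuous_snd.
  - apply open_ext with (fun h : R => Rbar_lt a h /\ Rbar_lt h b).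
    intros x. symmetry. apply HV. apply open_and. apply open_Rbar_gt. apply open_Rbar_lt.
Qed.

Lemma open_V (V : R -> Prop) : is_open_interval V -> open V.
Proof.
  intros (a & b & HV). apply open_ext with (fun h : R => Rbar_lt a h /\ Rbar_lt h b).
  intros x. symmetry. apply HV. apply open_and. apply open_Rbar_gt. apply open_Rbar_lt.
Qed.

(** * The family of periodic orbits *)

(** [p = (p1,p2)] is [D_h q], and [a_ij] the entries of [Df]. *)
Record orbit_family (V : R -> Prop) (f : R * R -> R * R) (q : R -> R -> R * R)
    (a11 a12 a21 a22 p1 p2 : R * R -> R) : Prop := {
  of_f1 : has_partials (fun x => fst (f x)) a11 a12;
  of_f2 : has_partials (fun x => snd (f x)) a21 a22;
  of_a11 : forall x, continuous a11 x;
  of_a12 : forall x, continuous a12 x;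
  of_a21 : forall x, continuous a21 x;
  of_a22 : forall x, continuous a22 x;
  of_f1C : C1 (U := R2) (fun _ => True) (fun x => fst (f x));
  of_f2C : C1 (U := R2) (fun _ => True) (fun x => snd (f x));
  of_q1 : C1 (U := R2) (fun u => V (snd u)) (fun u => fst (q (fst u) (snd u)));
  of_q2 : C1 (U := R2) (fun u => V (snd u)) (fun u => snd (q (fst u) (snd u)));
  of_p1 : C1 (U := R2) (fun u => V (snd u)) p1;
  of_p2 : C1 (U := R2) (fun u => V (snd u)) p2;
  of_qt : forall t h : R, V h -> is_derive (fun s => fst (q s h)) t (fst (f (q t h))) /\
                             is_derive (fun s => snd (q s h)) t (snd (f (q t h)));
  of_qh : forall t h : R, V h -> is_derive (fun r => fst (q t r)) h (p1 (t, h)) /\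
                             is_derive (fun r => snd (q t r)) h (p2 (t, h));
  of_det : forall t h : R, V h -> fst (f (q t h)) * p2 (t, h) - snd (f (q t h)) * p1 (t, h) = 1;
  of_tr : forall t h : R, V h -> a11 (q t h) + a22 (q t h) = 0;
  of_p1t : forall t h : R, V h -> is_derive (fun s => p1 (s, h)) t
             (a11 (q t h) * p1 (t, h) + a12 (q t h) * p2 (t, h));
  of_p2t : forall t h : R, V h -> is_derive (fun s => p2 (s, h)) t
             (a21 (q t h) * p1 (t, h) + a22 (q t h) * p2 (t, h));
}.

Arguments of_f1 {V f q a11 a12 a21 a22 p1 p2}.
Arguments of_f2 {V f q a11 a12 a21 a22 p1 p2}.
Arguments of_a11 {V f q a11 a12 a21 a22 p1 p2}.
Arguments of_a12 {V f q a11 a12 a21 a22 p1 p2}.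
Arguments of_a21 {V f q a11 a12 a21 a22 p1 p2}.
Arguments of_a22 {V f q a11 a12 a21 a22 p1 p2}.
Arguments of_f1C {V f q a11 a12 a21 a22 p1 p2}.
Arguments of_f2C {V f q a11 a12 a21 a22 p1 p2}.
Arguments of_q1 {V f q a11 a12 a21 a22 p1 p2}.
Arguments of_q2 {V f q a11 a12 a21 a22 p1 p2}.
Arguments of_p1 {V f q a11 a12 a21 a22 p1 p2}.
Arguments of_p2 {V f q a11 a12 a21 a22 p1 p2}.
Arguments of_qt {V f q a11 a12 a21 a22 p1 p2}.
Arguments of_qh {V f q a11 a12 a21 a22 p1 p2}.
Arguments of_det {V f q a11 a12 a21 a22 p1 p2}.
Arguments of_tr {V f q a11 a12 a21 a22 p1 p2}.
Arguments of_p1t {V f q a11 a12 a21 a22 p1 p2}.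
Arguments of_p2t {V f q a11 a12 a21 a22 p1 p2}.

Lemma is_derive_curve (F d1 d2 : R * R -> R) (c1 c2 : R -> R) (t c1' c2' : R) :
  filterdiff F (locally (c1 t, c2 t)) (fun v => fst v * d1 (c1 t, c2 t) + snd v * d2 (c1 t, c2 t)) ->
  is_derive c1 t c1' -> is_derive c2 t c2' ->
  is_derive (fun s => F (c1 s, c2 s)) t (d1 (c1 t, c2 t) * c1' + d2 (c1 t, c2 t) * c2').
Proof.
  intros HF H1 H2.
  replace (d1 (c1 t, c2 t) * c1' + d2 (c1 t, c2 t) * c2')
    with (fst (c1', c2') * d1 (c1 t, c2 t) + snd (c1', c2') * d2 (c1 t, c2 t)) by (simpl; ring).
  apply (is_derive_along (U := R2) F
    (fun v => fst v * d1 (c1 t, c2 t) + snd v * d2 (c1 t, c2 t)) (fun s => (c1 s, c2 s))); trivial.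
  now apply (is_derive_pair (U := R_NormedModule) (W := R_NormedModule)).
Qed.

(** Schwarz's theorem localized to [h] in [V]. It is applied to [q] to show that [D_h q] solves the
    variational equation. *)
Lemma mixed_derivatives (V : R -> Prop) (u : R -> R -> R) (ut uh uth uht : R * R -> R) :
  open V ->
  (forall t h, V h -> is_derive (fun s => u s h) t (ut (t, h))) ->
  (forall t h, V h -> is_derive (fun r => u t r) h (uh (t, h))) ->
  (forall t h, V h -> is_derive (fun s => uh (s, h)) t (uht (t, h))) ->
  (forall t h, V h -> is_derive (fun r => ut (t, r)) h (uth (t, h))) ->
  (forall t h, V h -> continuous uth (t, h)) ->
  (forall t h, V h -> continuous uht (t, h)) ->
  forall t h, V h -> uht (t, h) = uth (t, h).
Proof.
  intros HV Ht Hh Hht Hth Cth Cht t h Hv.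
  destruct (HV h Hv) as [d Hd].
  assert (E1 : forall t' h', V h' -> Derive (fun r => u t' r) h' = uh (t', h'))
    by (intros; now apply is_derive_unique, Hh).
  assert (E2 : forall t' h', V h' -> Derive (fun s => u s h') t' = ut (t', h'))
    by (intros; now apply is_derive_unique, Ht).
  assert (D1 : forall t' h', V h' ->
     is_derive (fun z => Derive (fun r => u z r) h') t' (uht (t', h'))).
  { intros t' h' Hh'. apply is_derive_ext with (fun s => uh (s, h')).
    intros s. symmetry. now apply E1. now apply Hht. }
  assert (D2 : forall t' h', V h' ->
     is_derive (fun z => Derive (fun s => u s z) t') h' (uth (t', h'))).
  { intros t' h' Hh'. apply is_derive_ext_loc with (fun r => ut (t', r)).
    destruct (HV h' Hh') as [d' Hd']. exists d'. intros r Hr. symmetry. now apply E2, Hd'.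
    now apply Hth. }
  refine (eq_trans (eq_sym (is_derive_unique _ _ _ (D1 t h Hv)))
    (eq_trans _ (is_derive_unique _ _ _ (D2 t h Hv)))).
  assert (HC : forall (A : R -> R -> R) (a : R * R -> R), (forall t' h', V h' -> A t' h' = a (t', h')) ->
     continuous a (t, h) -> continuity_2d_pt A t h).
  { intros A a HA Ha. apply continuity_2d_pt_filterlim. rewrite (HA t h Hv).
    apply filterlim_ext_loc with a; trivial.
    exists d. intros [t' h'] [_ B2]. symmetry. apply HA. now apply Hd. }
  apply Schwarz.
  - exists d. intros t' h' _ Hh'. assert (Hv' : V h') by now apply Hd.
    split; [|split; [|split]].
    + eexists. now apply Ht.
    + eexists. now apply Hh.
    + eexists. now apply D1.
    + eexists. now apply D2.
  - apply HC with uht; [|now apply Cht]. intros t' h' Hh'. now apply is_derive_unique, D1.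
  - apply HC with uth; [|now apply Cth]. intros t' h' Hh'. now apply is_derive_unique, D2.
Qed.

Lemma continuous_dir2 (D : R * R -> Prop) (dF : R2 -> R2 -> R) (v : R2) :
  (forall u w, D u -> continuous (fun p : R2 * R2 => dF (fst p) (snd p)) (u, w)) ->
  forall u, D u -> continuous (fun u => dF u v) u.
Proof.
  intros H u Hu.
  apply (continuous_comp (fun u : R2 => (u, v)) (fun p : R2 * R2 => dF (fst p) (snd p))).
  - apply (continuous_pair (U := R2) (V := R2) (W := R2)). apply continuous_id.
    apply continuous_const.
  - now apply H.
Qed.

(** As the period is the constant [T0], [q] is [G] after a linear change of the time variable and
    inherits its regularity. The trace of [Df] is shown to vanish on the orbits through Liouville's
    formula for a constant determinant, without symmetry of the second derivatives of [H]. *)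
Lemma orbit_family_exists (r0 r1 : nat) (H : R * R -> R) (f : R * R -> R * R)
    (V : R -> Prop) (Th : R -> R) (q : R -> R -> R * R) (T0 : R) :
  (3 <= r0)%nat -> (4 <= r1)%nat -> Ck r1 H -> Ck r0 f ->
  (forall x, f x = hamiltonian_field H x) -> is_open_interval V ->
  periodic_family r0 H f V Th q -> 0 < T0 -> (forall h, V h -> Th h = T0) ->
  exists a11 a12 a21 a22 p1 p2, orbit_family V f q a11 a12 a21 a22 p1 p2.
Proof.
  intros Hr0 Hr1 HH Hf HfH HV (_ & Hq & _ & HHq & HG) HT0 HTh.
  destruct r0 as [|[|r0]]; [lia | lia |]. destruct r1 as [|r1]; [lia|].
  pose (Om := 2 * PI / T0).
  assert (HOm : 0 < Om) by (apply Rdiv_lt_0_compat; [pose proof PI_RGT_0|]; lra).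
  assert (HTr : open (fun _ : R * R => True)) by apply open_true.
  pose proof (open_snd V HV) as HD. pose proof (open_V V HV) as HVo.
  pose proof (Ck_on_fst (U := R2) (V := R_NormedModule) (W := R_NormedModule) _ _ _ Hf) as Hf1.
  pose proof (Ck_on_snd (U := R2) (V := R_NormedModule) (W := R_NormedModule) _ _ _ Hf) as Hf2.
  pose proof (Ck_on_fst (U := R2) (V := R_NormedModule) (W := R_NormedModule) _ _ _ HG) as HG1.
  pose proof (Ck_on_snd (U := R2) (V := R_NormedModule) (W := R_NormedModule) _ _ _ HG) as HG2.
  destruct (Ck_on_dir_derivative (U := R2) _ _ _ (1, 0) Hf1) as (a11 & A11 & _).
  destruct (Ck_on_dir_derivative (U := R2) _ _ _ (0, 1) Hf1) as (a12 & A12 & _).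
  destruct (Ck_on_dir_derivative (U := R2) _ _ _ (1, 0) Hf2) as (a21 & A21 & _).
  destruct (Ck_on_dir_derivative (U := R2) _ _ _ (0, 1) Hf2) as (a22 & A22 & _).
  destruct (Ck_on_dir_derivative (U := R2) _ _ _ (1, 0) HH) as (h1 & DH1 & _).
  destruct (Ck_on_dir_derivative (U := R2) _ _ _ (0, 1) HH) as (h2 & DH2 & _).
  destruct (Ck_on_dir_derivative (U := R2) _ _ _ (0, 1) HG1) as (b1 & DB1 & CB1).
  destruct (Ck_on_dir_derivative (U := R2) _ _ _ (0, 1) HG2) as (b2 & DB2 & CB2).
  pose (p1 := fun u : R * R => b1 (Om * fst u, snd u)).
  pose (p2 := fun u : R * R => b2 (Om * fst u, snd u)).
  assert (HqG : forall t h, V h -> q t h = Gmap Th q (Om * t) h).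
  { intros t h Hh. unfold Gmap, Omega. rewrite (HTh h Hh). fold Om. f_equal. field. lra. }
  assert (Hlin : C1 (U := R2) (W := R2) (fun u => V (snd u)) (fun u => (Om * fst u, snd u))).
  { apply (C1_linear (U := R2) (W := R2)).
    apply (is_linear_prod (K := R_AbsRing) (T := R2) (U := R_NormedModule) (V := R_NormedModule)
             (fun u : R * R => Om * fst u) snd).
    - apply (is_linear_comp (K := R_AbsRing) (U := R2) (V := R_NormedModule) (W := R_NormedModule)
               fst (fun x => Om * x)).
      apply is_linear_fst. apply (is_linear_scal_r (K := R_AbsRing) (V := R_NormedModule) Om).
      apply Rmult_comm.
    - apply is_linear_snd. }
  assert (Hcomp : forall k (F : R * R -> R), Ck_on (U := R2) (W := R_NormedModule) (S k) (fun u => V (snd u)) F ->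
      C1_real R2 (fun u => V (snd u)) (fun u => F (Om * fst u, snd u))).
  { intros k F HF.
    apply (C1_comp (U := R2) (V := R2) (W := R_NormedModule) _ (fun u => V (snd u)) _ F Hlin); trivial.
    now apply (Ck_C1_R2 k). }
  assert (Hqt : forall t h, V h -> is_derive (fun s => fst (q s h)) t (fst (f (q t h))) /\
                             is_derive (fun s => snd (q s h)) t (snd (f (q t h)))).
  { intros t h Hh. split.
    - now apply (is_derive_fst (U := R_NormedModule) (W := R_NormedModule) (fun s => q s h)), Hq.
    - now apply (is_derive_snd (U := R_NormedModule) (W := R_NormedModule) (fun s => q s h)), Hq. }
  assert (Hqh : forall t h, V h -> is_derive (fun r => fst (q t r)) h (p1 (t, h)) /\
                             is_derive (fun r => snd (q t r)) h (p2 (t, h))).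
  { intros t h Hh. destruct (HVo h Hh) as [d Hd]. split.
    - apply is_derive_ext_loc with (fun r => fst (Gmap Th q (Om * t) r)).
      exists d. intros r Hr. symmetry. rewrite HqG; trivial. now apply Hd.
      now apply (dir_partial_2 _ (fun u => fst (Gmap Th q (fst u) (snd u))) b1 (Om * t, h)) in DB1.
    - apply is_derive_ext_loc with (fun r => snd (Gmap Th q (Om * t) r)).
      exists d. intros r Hr. symmetry. rewrite HqG; trivial. now apply Hd.
      now apply (dir_partial_2 _ (fun u => snd (Gmap Th q (fst u) (snd u))) b2 (Om * t, h)) in DB2. }
  assert (Hp1 : C1_real R2 (fun u => V (snd u)) p1) by now apply (Hcomp r0).
  assert (Hp2 : C1_real R2 (fun u => V (snd u)) p2) by now apply (Hcomp r0).
  assert (Hq1 : C1_real R2 (fun u => V (snd u)) (fun u => fst (q (fst u) (snd u)))).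
  { apply (C1_ext_open (U := R2) (W := R_NormedModule) _ (fun u => fst (Gmap Th q (Om * fst u) (snd u)))); trivial.
    intros u Hu. now rewrite HqG. exact (Hcomp _ _ HG1). }
  assert (Hq2 : C1_real R2 (fun u => V (snd u)) (fun u => snd (q (fst u) (snd u)))).
  { apply (C1_ext_open (U := R2) (W := R_NormedModule) _ (fun u => snd (Gmap Th q (Om * fst u) (snd u)))); trivial.
    intros u Hu. now rewrite HqG. exact (Hcomp _ _ HG2). }
  assert (Hff1 : forall x, filterdiff (fun x => fst (f x)) (locally x)
                   (fun v => fst v * a11 x + snd v * a12 x)).
  { intros x. now apply (filterdiff_R2 (fun _ => True)). }
  assert (Hff2 : forall x, filterdiff (fun x => snd (f x)) (locally x)
                   (fun v => fst v * a21 x + snd v * a22 x)).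
  { intros x. now apply (filterdiff_R2 (fun _ => True)). }
  assert (Hgr : forall x, fst (f x) = h2 x /\ snd (f x) = - h1 x).
  { intros x. rewrite HfH. unfold hamiltonian_field, grad. simpl. split.
    - apply is_derive_unique. now apply (dir_partial_2 (fun _ => True) H h2 x).
    - f_equal. apply is_derive_unique. now apply (dir_partial_1 (fun _ => True) H h1 x). }
  assert (Hpair : forall x : R * R, (fst x, snd x) = x) by now intros [].
  (* The derivative in [h] of [H (q t h) = h], rewritten with [f = (H_x2, - H_x1)]. *)
  assert (Hdet : forall t h, V h -> fst (f (q t h)) * p2 (t, h) - snd (f (q t h)) * p1 (t, h) = 1).
  { intros t h Hh. destruct (Hqh t h Hh) as [P1 P2].
    assert (E : is_derive (fun r => H (fst (q t r), snd (q t r))) h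
        (h1 (fst (q t h), snd (q t h)) * p1 (t, h) + h2 (fst (q t h), snd (q t h)) * p2 (t, h))).
    { apply (is_derive_curve H h1 h2 (fun r => fst (q t r)) (fun r => snd (q t r))); trivial.
      now apply (filterdiff_R2 (fun _ => True)). }
    assert (E' : is_derive (fun r => H (fst (q t r), snd (q t r))) h 1).
    { apply is_derive_ext_loc with (fun r : R => r).
      - destruct (HVo h Hh) as [d Hd]. exists d. intros r Hr. rewrite Hpair.
        symmetry. apply HHq. now apply Hd.
      - apply (is_derive_id (K := R_AbsRing)). }
    pose proof (is_derive_unique _ _ _ E) as U1. pose proof (is_derive_unique _ _ _ E') as U2.
    rewrite U1, Hpair in U2. destruct (Hgr (q t h)) as [G1 G2]. rewrite G1, G2. lra. }
  (* For a coordinate [u] of [q] with [u_t = F (q)] and [u_h = p], exchanging the derivatives gives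
     [p_t = DF (q) (p1, p2)]. *)
  assert (Hmix : forall (u : R * R -> R) (F b1 b2 p : R * R -> R),
     (forall x, filterdiff F (locally x) (fun v => fst v * b1 x + snd v * b2 x)) ->
     (forall x, continuous b1 x) -> (forall x, continuous b2 x) ->
     (forall t h, V h -> is_derive (fun s => u (s, h)) t (F (q t h))) ->
     (forall t h, V h -> is_derive (fun r => u (t, r)) h (p (t, h))) ->
     C1_real R2 (fun u => V (snd u)) p ->
     forall t h, V h -> is_derive (fun s => p (s, h)) t
        (b1 (q t h) * p1 (t, h) + b2 (q t h) * p2 (t, h))).
  { intros u F c1 c2 p HF Cc1 Cc2 Hu1 Hu2 (dp & DP & CP) t h Hh.
    assert (Hpt : forall t h, V h -> is_derive (fun s => p (s, h)) t (dp (t, h) (1, 0))).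
    { intros t' h' Hh'.
      apply (is_derive_along (U := R2) p (dp (t', h')) (fun s => (s, h'))).
      - now apply DP.
      - apply (is_derive_pair (U := R_NormedModule) (W := R_NormedModule) (fun s => s) (fun _ => h')).
        apply (is_derive_id (K := R_AbsRing)). apply (is_derive_const (V := R_NormedModule)). }
    assert (E : dp (t, h) (1, 0)
        = (fun z => c1 (q (fst z) (snd z)) * p1 z + c2 (q (fst z) (snd z)) * p2 z) (t, h)).
    { apply (mixed_derivatives V (fun t h => u (t, h)) (fun z => F (q (fst z) (snd z))) p
         (fun z => c1 (q (fst z) (snd z)) * p1 z + c2 (q (fst z) (snd z)) * p2 z)
         (fun z => dp z (1, 0)) HVo); trivial.
      - intros t' h' Hh'. simpl. destruct (Hqh t' h' Hh') as [P1 P2].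
        apply is_derive_ext with (fun r => F (fst (q t' r), snd (q t' r))).
        intros r. now rewrite Hpair. rewrite <- (Hpair (q t' h')).
        now apply (is_derive_curve F c1 c2 (fun r => fst (q t' r)) (fun r => snd (q t' r))).
      - intros t' h' Hh'.
        assert (Cq : continuous (fun z : R * R => q (fst z) (snd z)) (t', h')).
        { apply continuous_ext with (fun z : R * R => (fst (q (fst z) (snd z)), snd (q (fst z) (snd z)))).
          intros z. apply Hpair. apply continuous_pair.
          now apply (C1_continuous (U := R2) (W := R_NormedModule) _ _ _ Hq1).
          now apply (C1_continuous (U := R2) (W := R_NormedModule) _ _ _ Hq2). }
        apply continuous_Rplus; apply continuous_Rmult.
        + now apply (continuous_comp (fun z : R * R => q (fst z) (snd z)) c1).
        + now apply (C1_continuous (U := R2) (W := R_NormedModule) _ _ _ Hp1).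
        + now apply (continuous_comp (fun z : R * R => q (fst z) (snd z)) c2).
        + now apply (C1_continuous (U := R2) (W := R_NormedModule) _ _ _ Hp2).
      - intros t' h' Hh'. now apply (continuous_dir2 (fun u => V (snd u))). }
    specialize (Hpt t h Hh). rewrite E in Hpt. exact Hpt. }
  assert (Hp1t : forall t h, V h -> is_derive (fun s => p1 (s, h)) t
             (a11 (q t h) * p1 (t, h) + a12 (q t h) * p2 (t, h))).
  { apply (Hmix (fun u => fst (q (fst u) (snd u))) (fun x => fst (f x))); trivial.
    intros x; now apply A11. intros x; now apply A12.
    intros; now apply Hqt. intros; now apply Hqh. }
  assert (Hp2t : forall t h, V h -> is_derive (fun s => p2 (s, h)) t
             (a21 (q t h) * p1 (t, h) + a22 (q t h) * p2 (t, h))).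
  { apply (Hmix (fun u => snd (q (fst u) (snd u))) (fun x => snd (f x))); trivial.
    intros x; now apply A21. intros x; now apply A22.
    intros; now apply Hqt. intros; now apply Hqh. }
  exists a11, a12, a21, a22, p1, p2. split; trivial.
  - intros x. split. now apply (dir_partial_1 (fun _ => True) (fun x => fst (f x)) a11).
    now apply (dir_partial_2 (fun _ => True) (fun x => fst (f x)) a12).
  - intros x. split. now apply (dir_partial_1 (fun _ => True) (fun x => snd (f x)) a21).
    now apply (dir_partial_2 (fun _ => True) (fun x => snd (f x)) a22).
  - intros x. now apply A11.
  - intros x. now apply A12.
  - intros x. now apply A21.
  - intros x. now apply A22.
  - now apply (Ck_C1_R2 (S r0)).
  - now apply (Ck_C1_R2 (S r0)).
  - (* the determinant [f1 p2 - f2 p1] is constant, and its derivative is [tr Df] times itself *)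
    intros t h Hh. destruct (Hqt t h Hh) as [Q1 Q2].
    assert (F1 : is_derive (fun s => fst (f (q s h))) t
       (a11 (q t h) * fst (f (q t h)) + a12 (q t h) * snd (f (q t h)))).
    { apply is_derive_ext with (fun s => fst (f (fst (q s h), snd (q s h)))).
      intros s. now rewrite Hpair. rewrite <- (Hpair (q t h)) at 1 3.
      apply (is_derive_curve (fun x => fst (f x)) a11 a12 (fun s => fst (q s h)) (fun s => snd (q s h)));
        trivial. }
    assert (F2 : is_derive (fun s => snd (f (q s h))) t
       (a21 (q t h) * fst (f (q t h)) + a22 (q t h) * snd (f (q t h)))).
    { apply is_derive_ext with (fun s => snd (f (fst (q s h), snd (q s h)))).
      intros s. now rewrite Hpair. rewrite <- (Hpair (q t h)) at 1 3.
      apply (is_derive_curve (fun x => snd (f x)) a21 a22 (fun s => fst (q s h)) (fun s => snd (q s h)));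
        trivial. }
    pose proof (is_derive_Rminus _ _ _ _ _ (is_derive_Rmult _ _ _ _ _ F1 (Hp2t t h Hh))
       (is_derive_Rmult _ _ _ _ _ F2 (Hp1t t h Hh))) as D1.
    assert (D2 : is_derive (fun s => fst (f (q s h)) * p2 (s, h) - snd (f (q s h)) * p1 (s, h)) t 0).
    { apply is_derive_ext with (fun _ => 1). intros s. symmetry. now apply Hdet.
      apply (is_derive_const (V := R_NormedModule)). }
    pose proof (is_derive_unique _ _ _ D1) as U1. pose proof (is_derive_unique _ _ _ D2) as U2.
    rewrite U1 in U2. pose proof (Hdet t h Hh) as HD1.
    transitivity ((a11 (q t h) + a22 (q t h)) *
       (fst (f (q t h)) * p2 (t, h) - snd (f (q t h)) * p1 (t, h))).
    rewrite HD1; ring. etransitivity; [|exact U2].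
    assert (K : forall b11 b12 b21 b22 f1 f2 x1 x2 : R, (b11 + b22) * (f1 * x2 - f2 * x1)
      = (b11 * f1 + b12 * f2) * x2 + f1 * (b21 * x1 + b22 * x2)
        - ((b21 * f1 + b22 * f2) * x1 + f2 * (b11 * x1 + b12 * x2))) by (intros; ring).
    apply K.
Qed.

Lemma grad_of_field H f x : (forall x, f x = hamiltonian_field H x) ->
  grad H x = (- snd (f x), fst (f x)).
Proof.
  intros HfH. rewrite HfH. unfold hamiltonian_field. cbn [fst snd].
  rewrite Ropp_involutive. apply surjective_pairing.
Qed.

(** The two conditions on [alpha] form a linear system with rows [(p1, p2)] and [f (q) / Om].
    Cramer's rule with [f1 p2 - f2 p1 = 1] solves it; the factor [Om] comes from differentiating in
    the angle instead of time. *)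
Lemma alpha_formula V f Th q T0 alpha a11 a12 a21 a22 p1 p2 :
  is_open_interval V ->
  orbit_family V f q a11 a12 a21 a22 p1 p2 -> 0 < T0 -> (forall h, V h -> Th h = T0) ->
  is_alpha V (Gmap Th q) alpha -> forall t h, V h ->
  alpha (2 * PI / T0 * t) h = (2 * PI / T0 * p2 (t, h), - (2 * PI / T0) * p1 (t, h)).
Proof.
  intros HVi HO HT0 HTh Hal t h Hh. set (Om := 2 * PI / T0).
  assert (HOm : 0 < Om) by (apply Rdiv_lt_0_compat; [pose proof PI_RGT_0|]; lra).
  destruct (Hal (Om * t) h Hh) as (E1 & E2 & _).
  destruct (of_qt HO t h Hh) as [Q1 Q2].
  destruct (of_qh HO t h Hh) as [P1 P2].
  pose proof (of_det HO t h Hh) as Hdet.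
  assert (HqG : forall t h, V h -> Gmap Th q t h = q (t / Om) h).
  { intros t' h' Hh'. unfold Gmap, Omega. now rewrite (HTh h' Hh'). }
  assert (Ht : Om * t / Om = t) by (field; lra).
  destruct (open_V V HVi h Hh) as [d Hd].
  assert (C1' : Dcurve (fun h' => Gmap Th q (Om * t) h') h = (p1 (t, h), p2 (t, h))).
  { unfold Dcurve. f_equal; apply is_derive_unique.
    - apply is_derive_ext_loc with (fun r => fst (q t r)); trivial.
      exists d. intros r Hr. rewrite HqG, Ht; trivial. now apply Hd.
    - apply is_derive_ext_loc with (fun r => snd (q t r)); trivial.
      exists d. intros r Hr. rewrite HqG, Ht; trivial. now apply Hd. }
  assert (C2' : Dcurve (fun t' => Gmap Th q t' h) (Om * t)
                = (/ Om * fst (f (q t h)), / Om * snd (f (q t h)))).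
  { assert (Hlin : is_derive (fun s => s / Om) (Om * t) (/ Om)).
    { auto_derive; trivial. field. lra. }
    unfold Dcurve. f_equal; apply is_derive_unique.
    - apply is_derive_ext with (fun s => fst (q (s / Om) h)).
      intros s. now rewrite HqG.
      apply (is_derive_comp (fun s => fst (q s h)) (fun s => s / Om)); trivial. now rewrite Ht.
    - apply is_derive_ext with (fun s => snd (q (s / Om) h)).
      intros s. now rewrite HqG.
      apply (is_derive_comp (fun s => snd (q s h)) (fun s => s / Om)); trivial. now rewrite Ht. }
  rewrite C1' in E1. rewrite C2' in E2. unfold rowcol in E1, E2. simpl in E1, E2.
  destruct (alpha (Om * t) h) as [a b]. simpl in E1, E2.
  set (f1 := fst (f (q t h))) in *. set (f2 := snd (f (q t h))) in *.
  set (x1 := p1 (t, h)) in *. set (x2 := p2 (t, h)) in *.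
  assert (E3 : a * f1 + b * f2 = Om).
  { transitivity (Om * (a * (/ Om * f1) + b * (/ Om * f2))). field; lra. rewrite E2. ring. }
  f_equal.
  - transitivity (a * (f1 * x2 - f2 * x1)). rewrite Hdet; ring.
    transitivity ((a * f1 + b * f2) * x2 - f2 * (a * x1 + b * x2)). ring. rewrite E1, E3. ring.
  - transitivity (b * (f1 * x2 - f2 * x1)). rewrite Hdet; ring.
    transitivity (f1 * (a * x1 + b * x2) - (a * f1 + b * f2) * x1). ring. rewrite E1, E3. ring.
Qed.

(** * First-order expansions in the parameters *)

(** Fréchet differentiability at the single point [p], in the explicit form that feeds the
    hypotheses of [perturbed_linear_zero]. *)
Definition expands (F : R * R -> R) (p : R * R) (A1 A2 : R) : Prop :=
  forall eta, 0 < eta -> exists rho, 0 < rho /\ forall x,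
    Rabs (fst x - fst p) < rho -> Rabs (snd x - snd p) < rho ->
    Rabs (F x - F p - ((fst x - fst p) * A1 + (snd x - snd p) * A2)) <= eta * dist1 x p.

Lemma norm_R2_le (x : R * R) : norm (x : R2) <= Rabs (fst x) + Rabs (snd x).
Proof.
  unfold norm; simpl. unfold prod_norm, norm; simpl.
  pose proof (Rabs_pos (fst x)). pose proof (Rabs_pos (snd x)).
  unfold abs; simpl. rewrite <- (sqrt_pow2 (Rabs (fst x) + Rabs (snd x))) by lra.
  apply sqrt_le_1_alt. nra.
Qed.

Lemma linear_R2 (l : R2 -> R) (x : R * R) : is_linear (K := R_AbsRing) (U := R2) (V := R_NormedModule) l ->
  l x = fst x * l (1, 0) + snd x * l (0, 1).
Proof.
  intros Hl. destruct x as [x1 x2].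
  transitivity (l (plus (scal x1 (1, 0) : R2) (scal x2 (0, 1)))).
  - f_equal. change ((x1, x2) = (x1 * 1 + x2 * 0, x1 * 0 + x2 * 1)). f_equal; ring.
  - rewrite (linear_plus l Hl), !(linear_scal l Hl). reflexivity.
Qed.

Lemma expands_filterdiff (F : R * R -> R) (p : R * R) (dF : R2 -> R) :
  filterdiff (U := R2) (V := R_NormedModule) F (locally p) dF -> expands F p (dF (1, 0)) (dF (0, 1)).
Proof.
  intros [Hl Hd] eta Heta. destruct (Hd p (fun P HP => HP) (mkposreal _ Heta)) as [rho Hrho].
  exists rho. split. apply cond_pos. intros x H1 H2.
  specialize (Hrho x (conj H1 H2)). simpl in Hrho.
  rewrite (linear_R2 dF (minus (x : R2) p) Hl) in Hrho.
  eapply Rle_trans. exact Hrho. apply Rmult_le_compat_l. lra. apply norm_R2_le.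
Qed.

Lemma expands_C1 (D : R * R -> Prop) F p : C1_real R2 D F -> D p ->
  exists A1 A2, expands F p A1 A2.
Proof.
  intros (dF & H1 & _) Hp. exists (dF p (1, 0)), (dF p (0, 1)). now apply expands_filterdiff, H1.
Qed.

Lemma expands_plus F G p A1 A2 B1 B2 : expands F p A1 A2 -> expands G p B1 B2 ->
  expands (fun x => F x + G x) p (A1 + B1) (A2 + B2).
Proof.
  intros HF HG eta Heta. assert (He : 0 < eta / 2) by lra.
  destruct (HF _ He) as (r1 & P1 & K1). destruct (HG _ He) as (r2 & P2 & K2).
  exists (Rmin r1 r2). split. now apply Rmin_pos. intros x X1 X2.
  pose proof (Rmin_l r1 r2). pose proof (Rmin_r r1 r2).
  specialize (K1 x ltac:(lra) ltac:(lra)). specialize (K2 x ltac:(lra) ltac:(lra)).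
  replace (_ - _) with ((F x - F p - ((fst x - fst p) * A1 + (snd x - snd p) * A2))
     + (G x - G p - ((fst x - fst p) * B1 + (snd x - snd p) * B2))) by ring.
  apply Rle_trans with (1 := Rabs_triang _ _). lra.
Qed.

Lemma is_derive_intro (F : R -> R) (x l : R) :
  (forall eta, 0 < eta -> exists rho, 0 < rho /\ forall y, Rabs (y - x) < rho ->
     Rabs (F y - F x - (y - x) * l) <= eta * Rabs (y - x)) -> is_derive F x l.
Proof.
  intros H. apply (filterdiff_intro (U := R_NormedModule)).
  - apply (is_linear_scal_l (K := R_AbsRing) (V := R_NormedModule) l).
  - intros eta Heta. destruct (H eta Heta) as (rho & Hrho & K). exists rho. split; trivial.
    intros v Hv. specialize (K (x + v)).
    assert (E : forall z : R, x + z - x = z) by (intros; ring). rewrite E in K.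
    apply K. now apply (ball_plus x).
Qed.

Lemma expands_derive_1 F p A1 A2 : expands F p A1 A2 ->
  is_derive (fun t => F (t, snd p)) (fst p) A1.
Proof.
  intros H. apply is_derive_intro. intros eta Heta. destruct (H eta Heta) as (rho & Hrho & K).
  exists rho. split; trivial. intros y Hy. specialize (K (y, snd p)). unfold dist1 in K.
  simpl in K. rewrite Rminus_diag, Rabs_R0, Rmult_0_l, !Rplus_0_r in K.
  rewrite <- surjective_pairing. now apply K.
Qed.

Lemma expands_derive_2 F p A1 A2 : expands F p A1 A2 ->
  is_derive (fun r => F (fst p, r)) (snd p) A2.
Proof.
  intros H. apply is_derive_intro. intros eta Heta. destruct (H eta Heta) as (rho & Hrho & K).
  exists rho. split; trivial. intros y Hy. specialize (K (fst p, y)). unfold dist1 in K.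
  simpl in K. rewrite Rminus_diag, Rabs_R0, Rmult_0_l, !Rplus_0_l in K.
  rewrite <- surjective_pairing. now apply K.
Qed.

Lemma RInt_slice_ex (Phi : R * (R * R) -> R) p a b :
  (forall t, continuous Phi (t, p)) ->
  ex_RInt (fun t => Phi (t, p)) a b.
Proof.
  intros H. apply (ex_RInt_continuous (V := R_CompleteNormedModule)). intros t _.
  apply (continuous_comp (fun t => (t, p)) Phi); [|apply H].
  apply continuous_pair. apply continuous_id. apply continuous_const.
Qed.

(** Differentiation under the integral sign: for each [t] the mean value theorem is used on the
    segment from [p] to [x], and compactness in [t] makes the remainder uniform before
    integration. *)
Lemma expands_RInt (V : R -> Prop) (Phi : R * (R * R) -> R) (p : R * R) (a b : R) :
  open V -> a <= b -> C1_real R3 (fun u => V (snd (snd u))) Phi ->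
  V (snd p) ->
  exists A1 A2, expands (fun p => RInt (fun t => Phi (t, p)) a b) p A1 A2.
Proof.
  intros HV Hab HPhi Hp. pose proof HPhi as (dP & DP & CP).
  set (P1 u := dP u (0, (1, 0))). set (P2 u := dP u (0, (0, 1))).
  assert (CC : forall v, forall u, V (snd (snd u)) -> continuous (fun u => dP u v) u).
  { intros v u Hu.
    apply (continuous_comp (fun u : R3 => (u, v)) (fun p : R3 * R3 => dP (fst p) (snd p))).
    - apply (continuous_pair (U := R3) (V := R3) (W := R3)). apply continuous_id.
      apply continuous_const.
    - now apply CP. }
  assert (HC0 : forall p', V (snd p') -> forall t, continuous Phi (t, p')).
  { intros p' Hp' t. now apply (C1_continuous (U := R3) (W := R_NormedModule) _ _ _ HPhi). }
  destruct (HV _ Hp) as [d0 Hd0].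
  assert (E1 : ex_RInt (fun t => P1 (t, p)) a b) by (apply (RInt_slice_ex P1); intros t; exact (CC _ (t, p) Hp)).
  assert (E2 : ex_RInt (fun t => P2 (t, p)) a b) by (apply (RInt_slice_ex P2); intros t; exact (CC _ (t, p) Hp)).
  exists (RInt (fun t => P1 (t, p)) a b), (RInt (fun t => P2 (t, p)) a b).
  (* The added 1 covers the degenerate interval [a = b]. *)
  intros eta Heta. set (e := eta / (b - a + 1)).
  assert (He : 0 < e) by (apply Rdiv_lt_0_compat; lra).
  (* The segment of all times over the single parameter [p], written as a product of intervals so
     that [cpt_prod] applies. *)
  set (K := fun u : R * (R * R) => a <= fst u <= b /\
              (fst p <= fst (snd u) <= fst p /\ snd p <= snd (snd u) <= snd p)).
  assert (HK : cpt K).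
  { exact (cpt_prod _ _ (cpt_interval a b)
       (cpt_prod _ _ (cpt_interval (fst p) (fst p)) (cpt_interval (snd p) (snd p)))). }
  assert (HKV : forall u, K u -> V (snd (snd u))).
  { intros u (_ & _ & Hu). now replace (snd (snd u)) with (snd p) by lra. }
  destruct (cpt_unif_cont K P1 e HK) as (r1 & Hr1 & U1); trivial.
  { intros u Hu. apply CC. now apply HKV. }
  destruct (cpt_unif_cont K P2 e HK) as (r2 & Hr2 & U2); trivial.
  { intros u Hu. apply CC. now apply HKV. }
  exists (Rmin d0 (Rmin r1 r2)). split. repeat apply Rmin_pos; trivial. apply cond_pos.
  pose proof (Rmin_l d0 (Rmin r1 r2)). pose proof (Rmin_r d0 (Rmin r1 r2)).
  pose proof (Rmin_l r1 r2). pose proof (Rmin_r r1 r2).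
  intros x X1 X2. set (v1 := fst x - fst p) in *. set (v2 := snd x - snd p) in *.
  assert (Hx : V (snd x)) by (apply Hd0, ball_R; fold v2; lra).
  assert (Hone : forall t, a <= t <= b ->
     Rabs (Phi (t, x) - Phi (t, p) - (v1 * P1 (t, p) + v2 * P2 (t, p))) <= e * dist1 x p).
  { intros t Ht.
    set (c := fun s => (t, (fst p + s * v1, snd p + s * v2)) : R * (R * R)).
    assert (Hc : forall s, 0 <= s <= 1 -> V (snd (snd (c s))) /\
        Rabs (P1 (c s) - P1 (t, p)) < e /\ Rabs (P2 (c s) - P2 (t, p)) < e).
    { intros s Hs.
      assert (B1 : Rabs (fst p + s * v1 - fst p) <= Rabs v1).
      { replace (fst p + s * v1 - fst p) with (s * v1) by ring.
        rewrite Rabs_mult, (Rabs_pos_eq s) by lra. pose proof (Rabs_pos v1). nra. }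
      assert (B2 : Rabs (snd p + s * v2 - snd p) <= Rabs v2).
      { replace (snd p + s * v2 - snd p) with (s * v2) by ring.
        rewrite Rabs_mult, (Rabs_pos_eq s) by lra. pose proof (Rabs_pos v2). nra. }
      assert (Hb : forall r, Rabs v1 < r -> Rabs v2 < r -> ball (t, p) r (c s)).
      { intros r R1 R2'. split; [apply ball_R; simpl; rewrite Rminus_diag, Rabs_R0|
          split; apply ball_R; simpl]; pose proof (Rabs_pos v1); lra. }
      assert (HKt : K (t, p)) by (repeat split; simpl; lra).
      split; [|split].
      - simpl. apply Hd0, ball_R. lra.
      - apply U1; trivial. apply Hb; lra.
      - apply U2; trivial. apply Hb; lra. }
    destruct (mean_value_1 (fun s => Phi (c s)) (fun s => v1 * P1 (c s) + v2 * P2 (c s)) 0 1)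
      as (s & Hs & E).
    - rewrite Rmin_left, Rmax_right by lra. intros s Hs.
      replace (v1 * P1 (c s) + v2 * P2 (c s)) with (dP (c s) (0, (v1, v2))).
      + apply (is_derive_along (U := R3) Phi (dP (c s)) c).
        * apply DP. now apply Hc.
        * apply (is_derive_pair (U := R_NormedModule) (W := R2) (fun _ => t)).
          apply (is_derive_const (V := R_NormedModule)).
          apply (is_derive_pair (U := R_NormedModule) (W := R_NormedModule)
             (fun s => fst p + s * v1) (fun s => snd p + s * v2)).
          auto_derive; trivial; ring. auto_derive; trivial; ring.
      + pose proof (proj1 (DP (c s) (proj1 (Hc s Hs)))) as Hl.
        transitivity (dP (c s) (plus (scal v1 (0, (1, 0)) : R3) (scal v2 (0, (0, 1))))).
        * f_equal. change ((0, (v1, v2)) = (v1 * 0 + v2 * 0, (v1 * 1 + v2 * 0, v1 * 0 + v2 * 1))).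
          apply f_equal2; [ring | apply f_equal2; ring].
        * rewrite (linear_plus _ Hl), !(linear_scal _ Hl). reflexivity.
    - rewrite Rmin_left, Rmax_right in Hs by lra. destruct (Hc s Hs) as (_ & K1 & K2).
      assert (Ex : c 1 = (t, x)).
      { unfold c, v1, v2. destruct x as [x1 x2]. simpl. apply f_equal2; [trivial | apply f_equal2; ring]. }
      assert (Ep : c 0 = (t, p)).
      { unfold c. destruct p as [x1 x2]. simpl. apply f_equal2; [trivial | apply f_equal2; ring]. }
      rewrite Ex, Ep in E. rewrite E.
      replace (_ - _) with (v1 * (P1 (c s) - P1 (t, p)) + v2 * (P2 (c s) - P2 (t, p))) by ring.
      apply Rle_trans with (1 := Rabs_triang _ _). rewrite !Rabs_mult. unfold dist1. fold v1 v2.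
      assert (Rabs v1 * Rabs (P1 (c s) - P1 (t, p)) <= Rabs v1 * e)
        by (apply Rmult_le_compat_l; [apply Rabs_pos | lra]).
      assert (Rabs v2 * Rabs (P2 (c s) - P2 (t, p)) <= Rabs v2 * e)
        by (apply Rmult_le_compat_l; [apply Rabs_pos | lra]).
      lra. }
  assert (Ix : ex_RInt (fun t => Phi (t, x)) a b) by (apply RInt_slice_ex; auto).
  assert (Ip : ex_RInt (fun t => Phi (t, p)) a b) by (apply RInt_slice_ex; auto).
  assert (I : is_RInt (fun t => Phi (t, x) - Phi (t, p) - (v1 * P1 (t, p) + v2 * P2 (t, p))) a b
     (RInt (fun t => Phi (t, x)) a b - RInt (fun t => Phi (t, p)) a b
       - (v1 * RInt (fun t => P1 (t, p)) a b + v2 * RInt (fun t => P2 (t, p)) a b))).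
  { apply (is_RInt_minus (V := R_NormedModule)).
    - apply (is_RInt_minus (V := R_NormedModule)); now apply (RInt_correct (V := R_CompleteNormedModule)).
    - apply (is_RInt_plus (V := R_NormedModule)); apply (is_RInt_scal (V := R_NormedModule));
        now apply (RInt_correct (V := R_CompleteNormedModule)). }
  pose proof (dist1_pos x p) as Hdp.
  apply Rle_trans with ((b - a) * (e * dist1 x p)).
  - apply (norm_RInt_le_const (V := R_NormedModule) _ a b _ _ Hab Hone I).
  - rewrite <- Rmult_assoc. apply Rmult_le_compat_r; trivial.
    unfold e. apply (Rmult_le_reg_r (b - a + 1)); [lra|]. unfold Rdiv.
    replace ((b - a) * (eta * / (b - a + 1)) * (b - a + 1)) with ((b - a) * eta) by (field; lra). nra.
Qed.

(** * Melnikov functions on a fixed window *)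

(** Moving the start by one drops [phi j] and adds the equal term [phi (j + n)]; the rest is
    induction in both directions of [Z]. *)
Lemma zshift_sum (phi : Z -> R) (n : nat) : (1 <= n)%nat ->
  (forall k, phi (k + Z.of_nat n)%Z = phi k) ->
  forall j, sum_n (fun i => phi (j + Z.of_nat i)%Z) (n - 1)
          = sum_n (fun i => phi (Z.of_nat i)) (n - 1).
Proof.
  intros Hn Hper. set (S0 j := sum_n (fun i => phi (j + Z.of_nat i)%Z) (n - 1)).
  assert (Hstep : forall j, S0 (j + 1)%Z = S0 j).
  { intros j. destruct n as [|n]; [lia|]. unfold S0. replace (S n - 1)%nat with n by lia.
    assert (E1 : sum_n (fun i => phi (j + Z.of_nat i)%Z) (S n)
        = phi j + sum_n (fun i => phi (j + 1 + Z.of_nat i)%Z) n).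
    { unfold sum_n. rewrite sum_Sn_m by lia. rewrite <- sum_n_m_S.
      change (phi (j + 0)%Z + sum_n_m (fun n0 => phi (j + Z.of_nat (S n0))%Z) 0 n =
        phi j + sum_n_m (fun i => phi (j + 1 + Z.of_nat i)%Z) 0 n).
      f_equal. f_equal. lia. apply sum_n_m_ext. intros i. f_equal. lia. }
    rewrite sum_Sn, (Hper j) in E1.
    change (sum_n (fun i => phi (j + Z.of_nat i)%Z) n + phi j
        = phi j + sum_n (fun i => phi (j + 1 + Z.of_nat i)%Z) n) in E1.
    lra. }
  intros j. change (S0 j = S0 0%Z).
  assert (H : forall k : nat, S0 (Z.of_nat k) = S0 0%Z /\ S0 (- Z.of_nat k)%Z = S0 0%Z).
  { induction k as [|k [IH1 IH2]]; [now split|]. split.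
    - rewrite <- IH1, <- (Hstep (Z.of_nat k)). f_equal. lia.
    - rewrite <- IH2, <- (Hstep (- Z.of_nat (S k))%Z). f_equal. lia. }
  destruct (Z_le_dec 0 j) as [Hj|Hj].
  - rewrite <- (Z2Nat.id j Hj). apply H.
  - replace j with (- Z.of_nat (Z.to_nat (- j)))%Z by lia. apply H.
Qed.

Lemma RInt_period (psi : R -> R) (P a c : R) :
  (forall t, continuous psi t) -> (forall t, psi (t + P) = psi t) ->
  RInt psi a (a + P) = RInt psi c (c + P).
Proof.
  intros Hc Hper.
  assert (Hex : forall x y, ex_RInt psi x y)
    by (intros; apply (ex_RInt_continuous (V := R_CompleteNormedModule)); auto).
  pose proof (RInt_Chasles psi a c (a + P) (Hex _ _) (Hex _ _)) as E1.
  pose proof (RInt_Chasles psi c (c + P) (a + P) (Hex _ _) (Hex _ _)) as E2.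
  pose proof (RInt_Chasles psi c a c (Hex _ _) (Hex _ _)) as E3.
  rewrite RInt_point in E3.
  assert (E4 : RInt psi (c + P) (a + P) = RInt psi c a).
  { replace (c + P) with (1 * c + P) by ring. replace (a + P) with (1 * a + P) by ring.
    rewrite <- (RInt_comp_lin psi 1 P c a) by apply Hex.
    apply RInt_ext. intros t _. change (1 * psi (1 * t + P) = psi t).
    rewrite !Rmult_1_l. apply Hper. }
  unfold plus in *; simpl in *. change (@zero R_CompleteNormedModule) with 0 in E3.
  rewrite E4 in E2. lra.
Qed.

Section Window.
Variables (w q : R -> R -> R * R) (g : R -> R * R -> R -> R * R) (tk : Z -> R)
  (l : Z -> R * R -> R -> R * R) (P : R) (n : nat).
Hypothesis Hn : (1 <= n)%nat.
Hypothesis Htk : forall k, tk (k + Z.of_nat n)%Z = tk k + P.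
Hypothesis Hl : forall k x e, l (k + Z.of_nat n)%Z x e = l k x e.
Hypothesis Hg : forall t x e, g (t + P) x e = g t x e.
Variable r : R.
Hypothesis Hq : forall t, q (t + P) r = q t r.
Hypothesis Hw : forall t, w (t + P) r = w t r.

(** The parameter is the pair of phase and energy [p = (t0, r)]. *)
Definition shifted (q : R -> R -> R * R) (p : R * R) (t : R) : R * R := q (t - fst p) (snd p).

Definition melnikov_fixed (i : nat) (p : R * R) : R :=
  melnikov_partial g (fun i => tk (Z.of_nat i)) (fun i => l (Z.of_nat i)) (R * R)
    (shifted q) (shifted w) p i.

Hypothesis Hcont : forall t0 t, continuous (melnikov_density g (R * R) (shifted q) (shifted w) (t0, r)) t.

(** [P] is a period of integrand and summand, so the integral may start at [tk 0] and the sum at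
    index 0 whatever [t0] is. This removes [impulse_index], which is discontinuous in [t0]. *)
Lemma melnikov_window t0 : melnikov w q g tk l P n t0 r = melnikov_fixed n (t0, r).
Proof.
  set (psi := melnikov_density g (R * R) (shifted q) (shifted w) (t0, r)).
  set (phi k := rowcol (w (tk k - t0) r) (l k (q (tk k - t0) r) 0)).
  assert (Hex : forall x y, ex_RInt psi x y)
    by (intros; apply (ex_RInt_continuous (V := R_CompleteNormedModule)); intros; apply Hcont).
  assert (Hfix : forall i, melnikov_fixed (S i) (t0, r)
     = RInt psi (tk 0%Z) (tk (Z.of_nat (S i))) + sum_n (fun i => phi (Z.of_nat i)) i).
  { induction i.
    - rewrite sum_O. unfold melnikov_fixed. cbn [melnikov_partial]. fold psi.
      rewrite Rplus_0_l, Rplus_comm. reflexivity.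
    - rewrite sum_Sn. change (melnikov_fixed (S i) (t0, r) + phi (Z.of_nat (S i))
         + RInt psi (tk (Z.of_nat (S i))) (tk (Z.of_nat (S (S i)))) =
        RInt psi (tk 0%Z) (tk (Z.of_nat (S (S i))))
        + (sum_n (fun i => phi (Z.of_nat i)) i + phi (Z.of_nat (S i)))).
      rewrite IHi, <- (RInt_Chasles psi (tk 0%Z) (tk (Z.of_nat (S i))) (tk (Z.of_nat (S (S i))))) by apply Hex.
      unfold plus; simpl. ring. }
  destruct n as [|n'] eqn:En; [lia|]. rewrite Hfix. rewrite <- En in *.
  unfold melnikov. f_equal.
  - change (RInt psi t0 (t0 + P) = RInt psi (tk 0%Z) (tk (Z.of_nat n))).
    replace (tk (Z.of_nat n)) with (tk 0%Z + P) by (rewrite <- Htk; f_equal).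
    apply RInt_period. intros; apply Hcont.
    intros t. unfold psi, melnikov_density, shifted. simpl.
    replace (t + P - t0) with (t - t0 + P) by ring. now rewrite Hq, Hw, Hg.
  - replace n' with (n - 1)%nat by lia.
    apply (zshift_sum phi n Hn).
    intros k. unfold phi. rewrite Htk, Hl.
    replace (tk k + P - t0) with (tk k - t0 + P) by ring. now rewrite Hq, Hw.
Qed.

End Window.

(** * Impulse times and periodic extension *)

Lemma minus_plus_R2 (u v : R2) : minus (plus u v) u = v.
Proof.
  destruct u as [a b], v as [c d]. change ((a + c + - a, b + d + - b) = (c, d)).
  apply f_equal2; ring.
Qed.

Section Impulses.
Variable tk : Z -> R.
Hypothesis Htk : impulse_times tk.

Lemma tk_le j k : (j <= k)%Z -> tk j <= tk k.
Proof.
  intros Hjk. destruct Htk as (Hs & _ & _).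
  assert (H : forall d : nat, tk j <= tk (j + Z.of_nat d)%Z).
  { induction d. rewrite Z.add_0_r. lra.
    apply Rle_trans with (1 := IHd). replace (j + Z.of_nat (S d))%Z with ((j + Z.of_nat d) + 1)%Z by lia.
    left. apply Hs. }
  replace k with (j + Z.of_nat (Z.to_nat (k - j)))%Z by lia. apply H.
Qed.

Lemma tk_lt j k : (j < k)%Z -> tk j < tk k.
Proof.
  intros Hjk. apply Rlt_le_trans with (tk (j + 1)%Z). apply Htk. apply tk_le. lia.
Qed.

Lemma impulse_index_exists t : exists j, tk (j - 1)%Z < t <= tk j.
Proof.
  destruct Htk as (_ & Hp & Hm).
  destruct (Hp t) as [n1 Hn1]. specialize (Hn1 n1 ltac:(lia)).
  destruct (Hm t) as [n0 Hn0]. specialize (Hn0 n0 ltac:(lia)).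
  assert (H : forall d : nat, t <= tk (n0 + Z.of_nat d)%Z -> exists j, tk (j - 1)%Z < t <= tk j).
  { induction d; intros Hd.
    - rewrite Z.add_0_r in Hd. lra.
    - destruct (Rle_dec t (tk (n0 + Z.of_nat d)%Z)) as [H|H]; [now apply IHd|].
      exists (n0 + Z.of_nat (S d))%Z. split; trivial.
      replace (n0 + Z.of_nat (S d) - 1)%Z with (n0 + Z.of_nat d)%Z by lia. lra. }
  apply (H (Z.to_nat (n1 - n0))).
  destruct (Z_le_dec n0 n1) as [Hle|Hle].
  - replace (n0 + Z.of_nat (Z.to_nat (n1 - n0)))%Z with n1 by lia. lra.
  - pose proof (tk_le n1 n0 ltac:(lia)). lra.
Qed.

Lemma impulse_index_spec t : tk (impulse_index tk t - 1)%Z < t <= tk (impulse_index tk t).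
Proof.
  exact (epsilon_spec (inhabits 0%Z) (fun j => tk (j - 1)%Z < t <= tk j) (impulse_index_exists t)).
Qed.

Lemma impulse_index_unique t j : tk (j - 1)%Z < t <= tk j -> impulse_index tk t = j.
Proof.
  intros Hj. pose proof (impulse_index_spec t) as Hi. set (i := impulse_index tk t) in *.
  destruct (Z.lt_trichotomy i j) as [H|[H|H]]; trivial.
  - pose proof (tk_le i (j - 1) ltac:(lia)). lra.
  - pose proof (tk_le j (i - 1) ltac:(lia)). lra.
Qed.

Variables (f : R * R -> R * R) (g : R -> R * R -> R -> R * R)
  (l : Z -> R * R -> R -> R * R) (eps P : R) (n : Z)
  (XX : Z -> R -> R * R) (YY : Z -> R * R).
Hypothesis HP : forall k, tk (k + n)%Z = tk k + P.
Hypothesis Hjump : forall k, XX k (tk k) = plus (YY k : R2) (scal eps (l k (YY k) eps : R2)).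
Hypothesis Hcont : forall k t, tk k <= t <= tk (k + 1)%Z -> continuous (XX k) t.
Hypothesis Hder : forall k t, tk k < t < tk (k + 1)%Z ->
  is_derive (V := R2) (XX k) t (plus (f (XX k t) : R2) (scal eps (g t (XX k t) eps : R2))).
Hypothesis Hend : forall k, XX k (tk (k + 1)%Z) = YY (k + 1)%Z.
Hypothesis Hper : forall k t, XX (k + n)%Z (t + P) = XX k t.

(** The half-open intervals of [impulse_index] are closed on the right, so at an impulse time the
    value comes from the earlier piece and the result is left continuous. *)
Definition glue (t : R) : R * R := XX (impulse_index tk t - 1)%Z t.

Lemma glue_eq k t : tk k < t <= tk (k + 1)%Z -> glue t = XX k t.
Proof.
  intros Ht. unfold glue. rewrite (impulse_index_unique t (k + 1)%Z).
  f_equal. lia. now replace (k + 1 - 1)%Z with k by lia.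
Qed.

Lemma glue_at k : glue (tk k) = YY k.
Proof.
  rewrite (glue_eq (k - 1)%Z).
  - pose proof (Hend (k - 1)%Z) as H. now replace (k - 1 + 1)%Z with k in H by lia.
  - replace (k - 1 + 1)%Z with k by lia. split; [apply tk_lt; lia | lra].
Qed.

Lemma glue_solution : is_solution f g tk l eps glue.
Proof.
  split; [|split].
  - intros k t Ht. assert (Ht' : tk (k - 1)%Z < t < tk (k - 1 + 1)%Z)
      by now replace (k - 1 + 1)%Z with k by lia.
    apply is_derive_ext_loc with (XX (k - 1)%Z).
    + apply (locally_interval _ t (tk (k - 1)%Z) (tk k)); simpl; try apply Ht.
      intros s S1 S2. symmetry. apply glue_eq. replace (k - 1 + 1)%Z with k by lia.
      simpl in *. lra.
    + rewrite (glue_eq (k - 1)%Z) by lra. now apply Hder.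
  - intros k. rewrite glue_at.
    assert (E : YY k = XX (k - 1)%Z (tk k)).
    { rewrite <- glue_at. apply glue_eq. replace (k - 1 + 1)%Z with k by lia.
      split; [apply tk_lt; lia | lra]. }
    rewrite E. apply filterlim_ext_loc with (XX (k - 1)%Z).
    + assert (Hd : 0 < tk k - tk (k - 1)%Z) by (pose proof (tk_lt (k - 1) k ltac:(lia)); lra).
      exists (mkposreal _ Hd).
      intros s Hs Hlt. symmetry. apply glue_eq. replace (k - 1 + 1)%Z with k by lia.
      change (Rabs (s - tk k) < tk k - tk (k - 1)%Z) in Hs. apply Rabs_def2 in Hs. lra.
    + intros A HA. apply filter_le_within. revert A HA.
      apply Hcont. replace (k - 1 + 1)%Z with k by lia.
      pose proof (tk_lt (k - 1) k ltac:(lia)). lra.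
  - intros k. exists (XX k (tk k)). split.
    + apply filterlim_ext_loc with (XX k).
      * assert (Hd : 0 < tk (k + 1)%Z - tk k) by (pose proof (tk_lt k (k + 1) ltac:(lia)); lra).
        exists (mkposreal _ Hd). intros s Hs Hlt. symmetry. apply glue_eq.
        change (Rabs (s - tk k) < tk (k + 1)%Z - tk k) in Hs. apply Rabs_def2 in Hs. lra.
      * intros A HA. apply filter_le_within. revert A HA. apply Hcont. pose proof (tk_lt k (k + 1) ltac:(lia)). lra.
    + rewrite glue_at, Hjump. apply minus_plus_R2.
Qed.

Lemma glue_periodic t : glue (t + P) = glue t.
Proof.
  destruct (impulse_index_exists t) as [j Hj].
  rewrite (glue_eq (j - 1)%Z t) by now replace (j - 1 + 1)%Z with j by lia.
  rewrite (glue_eq (j - 1 + n)%Z (t + P)). apply Hper.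
  replace (j - 1 + n + 1)%Z with (j + n)%Z by lia. rewrite !HP. lra.
Qed.

End Impulses.

Lemma periodic_Z {A : Type} (F : R -> A) (P : R) : (forall t, F (t + P) = F t) ->
  forall (k : Z) t, F (t + IZR k * P) = F t.
Proof.
  intros HF.
  assert (H : forall (k : nat) t, F (t + INR k * P) = F t).
  { induction k; intros t. f_equal. simpl. ring.
    rewrite S_INR. replace (t + (INR k + 1) * P) with (t + INR k * P + P) by ring.
    now rewrite HF. }
  intros k t. destruct (Z_le_dec 0 k) as [Hk|Hk].
  - rewrite <- (Z2Nat.id k Hk), <- INR_IZR_INZ. apply H.
  - rewrite <- (H (Z.to_nat (- k)) (t + IZR k * P)). f_equal.
    rewrite INR_IZR_INZ, Z2Nat.id by lia. rewrite opp_IZR. ring.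
Qed.

Lemma periodic_reduce {A : Type} (F : R -> A) (P c t : R) : 0 < P ->
  (forall t, F (t + P) = F t) -> exists t', c <= t' <= c + P /\ F t' = F t.
Proof.
  intros HP HF. destruct (archimed ((t - c) / P)) as [H1 H2].
  set (k := up ((t - c) / P)) in *. exists (t + IZR (1 - k) * P). split.
  - rewrite minus_IZR.
    assert (E : t - c = (t - c) / P * P) by (field; lra).
    split; nra.
  - now apply periodic_Z.
Qed.

(** * Existence and continuous dependence of cut-off trajectories *)

Section Existence.
Variables (f : R * R -> R * R) (g : R -> R * R -> R -> R * R)
  (tn : nat -> R) (ln : nat -> R * R -> R -> R * R) (N : nat) (B0 L eps : R).
Let B := B0 + 1.
Hypothesis (HB0 : 0 < B0) (HL : 0 < L) (Heps : Rabs eps <= 1).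
Hypothesis Htn : forall i, tn i < tn (S i).
Hypothesis Hf : forall x, continuous f x.
Hypothesis Hg : forall z : R * (R * R), continuous (fun z => g (fst z) (snd z) eps) z.
Hypothesis Hl : forall i x, continuous (fun x => ln i x eps) x.
Hypothesis Hflip : forall x y, box B x -> box B y ->
  Rabs (fst (f x) - fst (f y)) <= L * dist1 x y /\
  Rabs (snd (f x) - snd (f y)) <= L * dist1 x y.
Hypothesis Hglip : forall t x y, tn O <= t <= tn N -> box B x -> box B y ->
  Rabs (fst (g t x eps) - fst (g t y eps)) <= L * dist1 x y /\
  Rabs (snd (g t x eps) - snd (g t y eps)) <= L * dist1 x y.

Lemma cutfield_lip t x y : tn O <= t <= tn N ->
  Rabs (fst (cutfield f g B0 eps t x) - fst (cutfield f g B0 eps t y)) <= 2 * L * dist1 x y /\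
  Rabs (snd (cutfield f g B0 eps t x) - snd (cutfield f g B0 eps t y)) <= 2 * L * dist1 x y.
Proof.
  intros Ht. assert (HB : 0 < B) by (unfold B; lra).
  pose proof (boxclamp_in B x HB) as Bx. pose proof (boxclamp_in B y HB) as By.
  destruct (Hflip _ _ Bx By) as [F1 F2]. destruct (Hglip t _ _ Ht Bx By) as [G1 G2].
  pose proof (boxclamp_lip B x y) as Hd. unfold cutfield; simpl. fold B.
  assert (Hone : forall a b a' b', Rabs (a - a') <= L * dist1 (boxclamp B x) (boxclamp B y) ->
     Rabs (b - b') <= L * dist1 (boxclamp B x) (boxclamp B y) ->
     Rabs (a + eps * b - (a' + eps * b')) <= 2 * L * dist1 x y).
  { intros a b a' b' H1 H2. replace (_ - _) with ((a - a') + eps * (b - b')) by ring.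
    apply Rle_trans with (1 := Rabs_triang _ _). rewrite Rabs_mult.
    pose proof (Rabs_pos (b - b')). pose proof (Rabs_pos eps).
    assert (L * dist1 (boxclamp B x) (boxclamp B y) <= L * dist1 x y)
      by (apply Rmult_le_compat_l; lra).
    assert (Rabs eps * Rabs (b - b') <= 1 * Rabs (b - b')) by (apply Rmult_le_compat_r; lra).
    lra. }
  split; now apply Hone.
Qed.

Lemma cutfield_continuous (a b : R) (z : R * (R * R)) :
  continuous (fun z => cutfield f g B0 eps (clamp a b (fst z)) (snd z)) z.
Proof.
  assert (H1 : continuous (fun z : R * (R * R) => boxclamp B (snd z)) z).
  { apply (continuous_comp (fun z : R * (R * R) => snd z) (boxclamp B)).
    apply continuous_snd. apply continuous_boxclamp. }
  assert (H2 : continuous (fun z : R * (R * R) => f (boxclamp B (snd z))) z).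
  { now apply (continuous_comp (fun z : R * (R * R) => boxclamp B (snd z)) f). }
  assert (H3 : continuous (fun z : R * (R * R) => g (clamp a b (fst z)) (boxclamp B (snd z)) eps) z).
  { apply (continuous_comp (fun z : R * (R * R) => (clamp a b (fst z), boxclamp B (snd z)))
             (fun z => g (fst z) (snd z) eps)); [|apply Hg].
    apply continuous_pair; trivial.
    apply (continuous_comp (fun z : R * (R * R) => fst z) (clamp a b)).
    apply continuous_fst. apply continuous_clamp. }
  unfold cutfield. fold B.
  apply continuous_pair; apply continuous_Rplus.
  - now apply continuous_fst_comp.
  - apply continuous_Rmult. apply continuous_const. now apply continuous_fst_comp.
  - now apply continuous_snd_comp.
  - apply continuous_Rmult. apply continuous_const. now apply continuous_snd_comp.
Qed.

(** Time is clamped as well, because the Lipschitz bound for [g] is known on the window only; on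
    [(a, b)] this changes nothing. *)
Lemma cutfield_solution a b y : a < b -> tn O <= a -> b <= tn N ->
  exists X, solves_on (cutfield f g B0 eps) a b X /\ X a = y.
Proof.
  intros Hab Ha Hb.
  destruct (picard_solution (fun t x => fst (cutfield f g B0 eps (clamp a b t) x))
    (fun t x => snd (cutfield f g B0 eps (clamp a b t) x)) (2 * L) a b) with (y := y)
    as (X & X1 & X2 & X3); try lra.
  - intros z. apply continuous_fst_comp, cutfield_continuous.
  - intros z. apply continuous_snd_comp, cutfield_continuous.
  - intros t x x'. apply cutfield_lip. pose proof (clamp_in a b t). lra.
  - intros t x x'. apply cutfield_lip. pose proof (clamp_in a b t). lra.
  - exists X. split; trivial. split. intros; apply X1.
    intros t Ht. specialize (X3 t Ht). now rewrite clamp_id in X3 by lra.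
Qed.

Lemma jump_continuous i x : continuous (jump ln B0 eps i) x.
Proof.
  assert (H : continuous (fun x => ln i (boxclamp B x) eps) x).
  { apply (continuous_comp (boxclamp B) (fun x => ln i x eps)).
    apply continuous_boxclamp. apply Hl. }
  unfold jump. fold B. apply continuous_pair; apply continuous_Rplus.
  - apply continuous_fst.
  - apply continuous_Rmult. apply continuous_const. now apply continuous_fst_comp.
  - apply continuous_snd.
  - apply continuous_Rmult. apply continuous_const. now apply continuous_snd_comp.
Qed.

Lemma lipschitz_continuous (F : R * R -> R * R) (C : R) x : 0 < C ->
  (forall y, dist1 (F y) (F x) <= C * dist1 y x) -> continuous F x.
Proof.
  intros HC H. apply filterlim_locally. intros e.
  assert (He : 0 < e / (2 * C)) by (apply Rdiv_lt_0_compat; [apply cond_pos | lra]).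
  exists (mkposreal _ He). intros y [Y1 Y2]. apply ball_R in Y1. apply ball_R in Y2. simpl in Y1, Y2.
  assert (Hd : dist1 y x < e / C).
  { unfold dist1. replace (e / C) with (e / (2 * C) + e / (2 * C)) by (field; lra).
    now apply Rplus_lt_compat. }
  assert (Hd' : dist1 (F y) (F x) < e).
  { apply Rle_lt_trans with (1 := H y). replace (pos e) with (C * (e / C)) by (field; lra).
    now apply Rmult_lt_compat_l. }
  unfold dist1 in Hd'. pose proof (Rabs_pos (fst (F y) - fst (F x))).
  pose proof (Rabs_pos (snd (F y) - snd (F x))).
  assert (Rabs (fst (F y) - fst (F x)) < e) by lra.
  assert (Rabs (snd (F y) - snd (F x)) < e) by lra. now split.
Qed.

(** Solutions on each interval are selected by choice for every initial value. Grönwall with zero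
    defect shows that the selection depends Lipschitz continuously on that value; the jumps are only
    continuous, and so is the composite. *)
Lemma trajectories_exist : exists (Y : R * R -> nat -> R * R) (X : R * R -> nat -> R -> R * R),
  forall y, trajectory f g tn ln N B0 eps (Y y) (X y) /\ Y y O = y /\
    forall i, (i <= N)%nat -> continuous (fun y => Y y i) y.
Proof.
  assert (Hsol : forall iy : nat * (R * R), exists X : R -> R * R, (fst iy < N)%nat ->
     solves_on (cutfield f g B0 eps) (tn (fst iy)) (tn (S (fst iy))) X /\ X (tn (fst iy)) = snd iy).
  { intros [i y]. simpl. destruct (lt_dec i N) as [Hi|Hi].
    - destruct (cutfield_solution (tn i) (tn (S i)) y) as (X & H1 & H2).
      apply Htn. apply (tn_mono tn Htn); lia. apply (tn_mono tn Htn); lia.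
      exists X. auto.
    - exists (fun _ => y). lia. }
  destruct (choice _ Hsol) as [sol Hs].
  set (Y := fix Y (y : R * R) (i : nat) : R * R :=
    match i with O => y | S k => sol (k, jump ln B0 eps k (Y y k)) (tn (S k)) end).
  exists Y, (fun y i => sol (i, jump ln B0 eps i (Y y i))). intros y. split; [|split].
  - intros i Hi. destruct (Hs (i, jump ln B0 eps i (Y y i)) Hi) as [H1 H2].
    split; [exact H2 | split; [exact H1 | reflexivity]].
  - reflexivity.
  - induction i; intros Hi. apply continuous_id.
    change (continuous (fun y => (fun z => sol (i, z) (tn (S i))) (jump ln B0 eps i (Y y i))) y).
    apply (continuous_comp (fun y => jump ln B0 eps i (Y y i)) (fun z => sol (i, z) (tn (S i)))).
    + apply (continuous_comp (fun y => Y y i) (jump ln B0 eps i)). apply IHi; lia.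
      apply jump_continuous.
    + set (E := exp ((4 * (2 * L) + 2) * (tn (S i) - tn i))).
      assert (HE : 0 < E) by apply exp_pos.
      apply lipschitz_continuous with (2 * E + 1). lra.
      intros z. set (x := jump ln B0 eps i (Y y i)).
      pose proof (Htn i) as Hti.
      destruct (Hs (i, z) ltac:(simpl; lia)) as [S1 E1].
      destruct (Hs (i, x) ltac:(simpl; lia)) as [S2 E2]. simpl in S1, S2, E1, E2.
      pose proof (gronwall_dist 0 (2 * L) _ _ _ _ (tn i) (tn (S i)) ltac:(lra) ltac:(lra) (Rle_refl 0) S1 S2) as G.
      apply sqr_le_bound. lra. apply dist1_pos.
      eapply Rle_trans. apply G; [|lra].
      * intros t Ht. rewrite Rplus_0_r. apply cutfield_lip.
        pose proof (tn_mono tn Htn O i ltac:(lia)). pose proof (tn_mono tn Htn (S i) N ltac:(lia)). lra.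
      * rewrite E1, E2. fold E. right. ring.
Qed.

End Existence.

(** * Regularity of the perturbation, and auxiliary facts *)

Lemma dir_derivative_slice {U : NormedModule R_AbsRing}
    (F d : U * R -> R) (e : U) (c : R) :
  dir_derivative (U := prod_NormedModule R_AbsRing U R_NormedModule) (fun _ => True) F (e, 0) d ->
  dir_derivative (fun _ : U => True) (fun z => F (z, c)) e (fun z => d (z, c)).
Proof.
  intros [H1 H2]. split.
  - intros u _. specialize (H1 (u, c) I). eapply is_derive_ext; [|exact H1].
    intros s. simpl. f_equal.
    change ((plus u (scal s e), c + s * 0) = (plus u (scal s e), c)).
    f_equal. ring.
  - intros u _. apply (continuous_comp (fun z : U => (z, c)) d).
    + apply continuous_pair. apply continuous_id. apply continuous_const.
    + now apply (H2 (u, c)).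
Qed.

(** The two forms in which smoothness of [g] enters: [C1] in [(t, x)] at [eps = 0], for
    differentiating the Melnikov functions, and continuous [x]-partials for all [(t, eps)], for
    Lipschitz bounds. *)
Lemma perturbation_regular (k : nat) (F : R * (R * R) * R -> R) :
  Ck_on (U := prod_NormedModule R_AbsRing R3 R_NormedModule) (W := R_NormedModule)
    (S k) (fun _ => True) F ->
  C1_real R3 (fun _ => True) (fun z => F (z, 0)) /\
  exists d1 d2 : R * R -> R * R -> R,
    (forall s, has_partials (fun x => F (fst s, x, snd s)) (d1 s) (d2 s)) /\
    (forall z : (R * R) * (R * R), continuous (fun z => d1 (fst z) (snd z)) z) /\
    (forall z : (R * R) * (R * R), continuous (fun z => d2 (fst z) (snd z)) z).
Proof.
  intros HF. set (U4 := prod_NormedModule R_AbsRing R3 R_NormedModule) in *.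
  destruct (Ck_on_dir_derivative (U := U4) _ _ _ ((1, (0, 0)), 0) HF) as (b0 & B0 & _).
  destruct (Ck_on_dir_derivative (U := U4) _ _ _ ((0, (1, 0)), 0) HF) as (b1 & B1 & _).
  destruct (Ck_on_dir_derivative (U := U4) _ _ _ ((0, (0, 1)), 0) HF) as (b2 & B2 & _).
  split.
  - apply (C1_R3 (fun _ => True) (fun z => F (z, 0)) (fun z => b0 (z, 0)) (fun z => b1 (z, 0))
             (fun z => b2 (z, 0))).
    + apply open_true.
    + exact (dir_derivative_slice (U := R3) F b0 (1, (0, 0)) 0 B0).
    + exact (dir_derivative_slice (U := R3) F b1 (0, (1, 0)) 0 B1).
    + exact (dir_derivative_slice (U := R3) F b2 (0, (0, 1)) 0 B2).
  - exists (fun s x => b1 (fst s, x, snd s)), (fun s x => b2 (fst s, x, snd s)).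
    assert (HC : forall b : R * (R * R) * R -> R, (forall u, continuous b u) ->
       forall z : (R * R) * (R * R), continuous (fun z => b (fst (fst z), snd z, snd (fst z))) z).
    { intros b Hb z.
      apply (continuous_comp (fun z : (R * R) * (R * R) => (fst (fst z), snd z, snd (fst z))) b); auto.
      apply continuous_pair; [apply continuous_pair|].
      apply continuous_fst_comp, continuous_fst. apply continuous_snd.
      apply continuous_snd_comp, continuous_fst. }
    split; [|split].
    + intros [t e] x. split; apply is_derive_shift; simpl.
      * pose proof (proj1 (dir_derivative_slice (U := R3) F b1 (0, (1, 0)) e B1) (t, x) I) as H.
        destruct x as [x1 x2].
        eapply is_derive_ext; [|exact H]. intros s. cbn. f_equal. f_equal.
        change ((t + s * 0, (x1 + s * 1, x2 + s * 0)) = (t, (x1 + s, x2))).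
        apply f_equal2; [ring | apply f_equal2; ring].
      * pose proof (proj1 (dir_derivative_slice (U := R3) F b2 (0, (0, 1)) e B2) (t, x) I) as H.
        destruct x as [x1 x2].
        eapply is_derive_ext; [|exact H]. intros s. cbn. f_equal. f_equal.
        change ((t + s * 0, (x1 + s * 0, x2 + s * 1)) = (t, (x1, x2 + s))).
        apply f_equal2; [ring | apply f_equal2; ring].
    + apply (HC b1). intros u. now apply B1.
    + apply (HC b2). intros u. now apply B2.
Qed.

(** The infimum over the set of zeros may not be attained; a minimizer up to [e] is enough, since
    [e] will be [|eps|]. *)
Lemma near_minimizer {A : Type} (S : A -> Prop) (d : A -> R) (e : R) :
  0 < e -> (forall a, 0 <= d a) -> (exists a, S a) ->
  exists a, S a /\ forall b, S b -> d a <= d b + e.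
Proof.
  intros He Hd [a0 Ha0].
  destruct (completeness (fun x => exists a, S a /\ x = - d a)) as [m [M1 M2]].
  - exists 0. intros x (a & _ & ->). specialize (Hd a). lra.
  - exists (- d a0). now exists a0.
  - apply NNPP. intros Hn.
    assert (m <= m - e); [|lra]. apply M2. intros x (a & Ha & ->).
    apply Rnot_lt_le. intros Hlt. apply Hn. exists a. split; trivial.
    intros b Hb. specialize (M1 (- d b) (ex_intro _ b (conj Hb eq_refl))). lra.
Qed.

Lemma melnikov_ext w w' q g tk l len n t0 r :
  (forall t, w t r = w' t r) ->
  melnikov w q g tk l len n t0 r = melnikov w' q g tk l len n t0 r.
Proof.
  intros Hw. unfold melnikov. f_equal.
  - apply RInt_ext. intros t _. now rewrite Hw.
  - apply sum_n_ext. intros i. now rewrite Hw.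
Qed.

Lemma expands_near F p A1 A2 : expands F p A1 A2 -> forall eta, 0 < eta ->
  exists rho, 0 < rho /\ forall x, Rabs (fst x - fst p) <= rho -> Rabs (snd x - snd p) <= rho ->
    Rabs (F x - F p) <= eta.
Proof.
  intros HF eta Heta. destruct (HF 1 Rlt_0_1) as (r & Hr & K).
  pose proof (Rabs_pos A1). pose proof (Rabs_pos A2).
  set (c := Rabs A1 + Rabs A2 + 2). assert (Hc : 0 < c) by (unfold c; lra).
  exists (Rmin (r / 2) (eta / c)). split.
  { apply Rmin_pos. lra. now apply Rdiv_lt_0_compat. }
  intros x X1 X2. pose proof (Rmin_l (r / 2) (eta / c)). pose proof (Rmin_r (r / 2) (eta / c)).
  specialize (K x ltac:(lra) ltac:(lra)). unfold dist1 in K.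
  set (v1 := fst x - fst p) in *. set (v2 := snd x - snd p) in *.
  replace (F x - F p) with ((F x - F p - (v1 * A1 + v2 * A2)) + (v1 * A1 + v2 * A2)) by ring.
  apply Rle_trans with (1 := Rabs_triang _ _).
  assert (Rabs (v1 * A1 + v2 * A2) <= eta / c * Rabs A1 + eta / c * Rabs A2).
  { apply Rle_trans with (1 := Rabs_triang _ _). rewrite !Rabs_mult.
    apply Rplus_le_compat; apply Rmult_le_compat_r; lra. }
  assert (eta = eta / c * Rabs A1 + eta / c * Rabs A2 + 2 * (eta / c)).
  { transitivity (eta / c * c). field; lra. unfold c at 2. ring. }
  lra.
Qed.

(** * The impulsive system near the periodic orbits *)

Section Main.
Variables (f : R * R -> R * R) (g : R -> R * R -> R -> R * R) (V : R -> Prop)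
  (q : R -> R -> R * R) (tk : Z -> R) (l : Z -> R * R -> R -> R * R)
  (a11 a12 a21 a22 p1 p2 : R * R -> R) (T0 P : R) (n K : nat)
  (d11 d12 d21 d22 : R * R -> R * R -> R).
Hypothesis (HV : is_open_interval V) (HO : orbit_family V f q a11 a12 a21 a22 p1 p2).
Hypothesis (HT0 : 0 < T0) (HP : P = INR K * T0) (HK : (1 <= K)%nat) (Hn : (1 <= n)%nat).
Hypothesis Hqper : forall t h, V h -> q (t + T0) h = q t h.
Hypothesis Htk : impulse_times tk.
Hypothesis HtkP : forall k, tk (k + Z.of_nat n)%Z = tk k + P.
Hypothesis Hlper : forall k x e, l (k + Z.of_nat n)%Z x e = l k x e.
Hypothesis Hgper : forall t x e, g (t + P) x e = g t x e.
Hypothesis Hgc : forall z : R * (R * R) * R, continuous (fun z => g (fst (fst z)) (snd (fst z)) (snd z)) z.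
Hypothesis Hg1 : C1_real R3 (fun _ => True) (fun z => fst (g (fst z) (snd z) 0)).
Hypothesis Hg2 : C1_real R3 (fun _ => True) (fun z => snd (g (fst z) (snd z) 0)).
Hypothesis Hgp1 : forall s, has_partials (fun x => fst (g (fst s) x (snd s))) (d11 s) (d12 s).
Hypothesis Hgp2 : forall s, has_partials (fun x => snd (g (fst s) x (snd s))) (d21 s) (d22 s).
Hypothesis Hd11 : forall z : (R * R) * (R * R), continuous (fun z => d11 (fst z) (snd z)) z.
Hypothesis Hd12 : forall z : (R * R) * (R * R), continuous (fun z => d12 (fst z) (snd z)) z.
Hypothesis Hd21 : forall z : (R * R) * (R * R), continuous (fun z => d21 (fst z) (snd z)) z.
Hypothesis Hd22 : forall z : (R * R) * (R * R), continuous (fun z => d22 (fst z) (snd z)) z.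
Hypothesis Hlc : forall (k : Z) (z : R * R * R), continuous (fun z => l k (fst z) (snd z)) z.
Hypothesis Hl1 : forall k, C1_real R2 (fun _ => True) (fun x => fst (l k x 0)).
Hypothesis Hl2 : forall k, C1_real R2 (fun _ => True) (fun x => snd (l k x 0)).

Let tn (i : nat) := tk (Z.of_nat i).
Let ln (i : nat) := l (Z.of_nat i).
Let DV (u : R * R) := V (snd u).
Let Q := shifted q.

(** What a row vector needs for its Melnikov function to give the first-order increment of
    [w . (x - q)]; [DH (q)] and [alpha] are then treated by the same lemmas. *)
Record adjoint_weight (w : R -> R -> R * R) : Prop := {
  gw_1 : C1_real R2 DV (fun u => fst (w (fst u) (snd u)));
  gw_2 : C1_real R2 DV (fun u => snd (w (fst u) (snd u)));
  gw_per : forall t h : R, V h -> w (t + T0) h = w t h;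
  gw_adj : forall t h : R, V h ->
    is_derive (fun s => fst (w s h)) t
      (- (fst (w t h) * a11 (q t h) + snd (w t h) * a21 (q t h))) /\
    is_derive (fun s => snd (w s h)) t
      (- (fst (w t h) * a12 (q t h) + snd (w t h) * a22 (q t h)));
}.

Arguments gw_1 {w}.
Arguments gw_2 {w}.
Arguments gw_per {w}.
Arguments gw_adj {w}.

(** This is [DH (q t h)], expressed through [f]. *)
Definition energy_weight (t h : R) : R * R := (- snd (f (q t h)), fst (f (q t h))).

(** For [c = 2 PI / T0] this is [alpha] at the angle [c t]. *)
Definition phase_weight (c t h : R) : R * R := (c * p2 (t, h), - c * p1 (t, h)).

Lemma tn_lt i : tn i < tn (S i).
Proof. apply (tk_lt tk Htk). lia. Qed.

Lemma tn_n : tn n = tn O + P.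
Proof. unfold tn. rewrite <- HtkP. f_equal. Qed.

Lemma T0_le_P : T0 <= P.
Proof.
  rewrite HP. apply le_INR in HK. simpl in HK. nra.
Qed.

Lemma per_P {A : Type} (F : R -> A) : (forall t, F (t + T0) = F t) -> forall t, F (t + P) = F t.
Proof.
  intros HF t. rewrite HP, INR_IZR_INZ. now apply (periodic_Z F T0).
Qed.

Lemma q_continuous t h : V h -> continuous (fun u : R * R => q (fst u) (snd u)) (t, h).
Proof.
  intros Hh.
  apply continuous_ext with (fun z : R * R => (fst (q (fst z) (snd z)), snd (q (fst z) (snd z)))).
  intros z. symmetry. apply surjective_pairing. apply continuous_pair.
  now apply (C1_continuous (U := R2) (W := R_NormedModule) _ _ _ (of_q1 HO)).
  now apply (C1_continuous (U := R2) (W := R_NormedModule) _ _ _ (of_q2 HO)).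
Qed.

Lemma w_continuous w t h : adjoint_weight w -> V h -> continuous (fun u : R * R => w (fst u) (snd u)) (t, h).
Proof.
  intros Hw Hh.
  apply continuous_ext with (fun z : R * R => (fst (w (fst z) (snd z)), snd (w (fst z) (snd z)))).
  intros z. symmetry. apply surjective_pairing. apply continuous_pair.
  now apply (C1_continuous (U := R2) (W := R_NormedModule) _ _ _ (gw_1 Hw)).
  now apply (C1_continuous (U := R2) (W := R_NormedModule) _ _ _ (gw_2 Hw)).
Qed.

Lemma shifted_continuous (w : R -> R -> R * R) t (p : R * R) :
  continuous (fun u : R * R => w (fst u) (snd u)) (t - fst p, snd p) ->
  continuous (fun p => shifted w p t) p.
Proof.
  intros H. unfold shifted.
  apply (continuous_comp (fun p : R * R => (t - fst p, snd p)) (fun u => w (fst u) (snd u))); trivial.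
  apply continuous_pair. apply continuous_Rminus. apply continuous_const. apply continuous_fst.
  apply continuous_snd.
Qed.

Lemma shifted_continuous_t (w : R -> R -> R * R) t (p : R * R) :
  continuous (fun u : R * R => w (fst u) (snd u)) (t - fst p, snd p) ->
  continuous (shifted w p) t.
Proof.
  intros H. unfold shifted.
  apply (continuous_comp (fun t : R => (t - fst p, snd p)) (fun u => w (fst u) (snd u))); trivial.
  apply continuous_pair. apply continuous_Rminus. apply continuous_id. apply continuous_const.
  apply continuous_const.
Qed.

(** The chain rule uses the Fréchet derivative provided by [C1]; uniqueness of derivatives
    identifies its entries with the given partials. *)
Lemma derive_along_orbit (F b1 b2 : R * R -> R) t h : V h ->
  has_partials F b1 b2 -> C1_real R2 (fun _ => True) F ->
  is_derive (fun s => F (q s h)) t (b1 (q t h) * fst (f (q t h)) + b2 (q t h) * snd (f (q t h))).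
Proof.
  intros Hh HF (dF & DF & _). destruct (of_qt HO t h Hh) as [Q1 Q2].
  specialize (DF (q t h) I).
  pose proof (expands_filterdiff F (q t h) (dF (q t h)) DF) as HE.
  assert (E1 : dF (q t h) (1, 0) = b1 (q t h)).
  { pose proof (is_derive_unique _ _ _ (expands_derive_1 _ _ _ _ HE)) as U1.
    pose proof (is_derive_unique _ _ _ (proj1 (HF (q t h)))) as U2.
    exact (eq_trans (eq_sym U1) U2). }
  assert (E2 : dF (q t h) (0, 1) = b2 (q t h)).
  { pose proof (is_derive_unique _ _ _ (expands_derive_2 _ _ _ _ HE)) as U1.
    pose proof (is_derive_unique _ _ _ (proj2 (HF (q t h)))) as U2.
    exact (eq_trans (eq_sym U1) U2). }
  replace (b1 (q t h) * fst (f (q t h)) + b2 (q t h) * snd (f (q t h)))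
    with (dF (q t h) (fst (f (q t h)), snd (f (q t h)))).
  - apply (is_derive_along (U := R2) F (dF (q t h)) (fun s => q s h)); trivial.
    apply is_derive_ext with (fun s => (fst (q s h), snd (q s h))).
    intros s. symmetry. apply surjective_pairing.
    now apply (is_derive_pair (U := R_NormedModule) (W := R_NormedModule)).
  - rewrite (linear_R2 (dF (q t h)) (fst (f (q t h)), snd (f (q t h))) (proj1 DF)), E1, E2. simpl. ring.
Qed.

Lemma compose_q (F : R * R -> R) : C1_real R2 (fun _ => True) F ->
  C1_real R2 DV (fun u => F (q (fst u) (snd u))).
Proof.
  intros HF.
  apply (C1_comp (U := R2) (V := R2) (W := R_NormedModule) DV (fun _ => True)
     (fun u => q (fst u) (snd u)) F); trivial.
  destruct (C1_pair (U := R2) (V := R_NormedModule) (W := R_NormedModule) DV _ _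
     (of_q1 HO) (of_q2 HO)) as (dq & D1 & D2).
  exists dq. split; [|exact D2]. intros u Hu.
  apply filterdiff_ext with (2 := D1 u Hu). intros y. symmetry. apply surjective_pairing.
Qed.

(** Where [Df] has trace zero, rotating a solution of the variational equation by a right angle
    gives a solution of the adjoint equation. The solution used here is [f (q)], the time derivative
    of the orbit. *)
Lemma energy_weight_good : adjoint_weight energy_weight.
Proof.
  split.
  - apply (C1_Ropp (U := R2) DV (fun u => snd (f (q (fst u) (snd u))))).
    apply (compose_q (fun x => snd (f x))). apply (of_f2C HO).
  - apply (compose_q (fun x => fst (f x))). apply (of_f1C HO).
  - intros t h Hh. unfold energy_weight. now rewrite Hqper.
  - intros t h Hh. unfold energy_weight; simpl.
    pose proof (of_tr HO t h Hh) as Htr.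
    split.
    + replace (- (_ + _)) with (- (a21 (q t h) * fst (f (q t h)) + a22 (q t h) * snd (f (q t h)))).
      apply (is_derive_opp (V := R_NormedModule) (fun s => snd (f (q s h)))).
      apply (derive_along_orbit (fun x => snd (f x))); trivial. apply (of_f2 HO).
      apply (of_f2C HO).
      replace (a22 (q t h)) with (- a11 (q t h)) by lra. ring.
    + replace (- (_ + _)) with (a11 (q t h) * fst (f (q t h)) + a12 (q t h) * snd (f (q t h))).
      apply (derive_along_orbit (fun x => fst (f x))); trivial. apply (of_f1 HO).
      apply (of_f1C HO).
      replace (a11 (q t h)) with (- a22 (q t h)) by lra. ring.
Qed.

Lemma p_periodic t h : V h -> p1 (t + T0, h) = p1 (t, h) /\ p2 (t + T0, h) = p2 (t, h).
Proof.
  intros Hh. destruct (of_qh HO t h Hh) as [P1 P2].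
  destruct (of_qh HO (t + T0) h Hh) as [P1' P2'].
  destruct (open_V V HV h Hh) as [d Hd].
  split.
  - rewrite <- (is_derive_unique _ _ _ P1). symmetry. apply is_derive_unique.
    apply is_derive_ext_loc with (2 := P1'). exists d. intros r Hr. f_equal. now apply Hqper, Hd.
  - rewrite <- (is_derive_unique _ _ _ P2). symmetry. apply is_derive_unique.
    apply is_derive_ext_loc with (2 := P2'). exists d. intros r Hr. f_equal. now apply Hqper, Hd.
Qed.

(** The same rotation argument for the solution [D_h q]. It is [T0]-periodic because the period does
    not vary with [h]; otherwise it would contain a term growing in [t]. *)
Lemma phase_weight_good c : adjoint_weight (phase_weight c).
Proof.
  assert (HC : forall a (p : R * R -> R), C1_real R2 DV p ->
     C1_real R2 DV (fun u => a * p (fst u, snd u))).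
  { intros a p Hp. apply (C1_Rmult (U := R2) DV (fun _ => a)).
    apply (C1_const (U := R2) (W := R_NormedModule)).
    destruct Hp as (dp & D1 & D2). exists dp. split; [|exact D2]. intros u Hu.
    apply filterdiff_ext with (2 := D1 u Hu). intros y. f_equal. apply surjective_pairing. }
  split.
  - apply HC. apply (of_p2 HO).
  - apply HC. apply (of_p1 HO).
  - intros t h Hh. unfold phase_weight. destruct (p_periodic t h Hh) as [E1 E2]. now rewrite E1, E2.
  - intros t h Hh. unfold phase_weight; simpl.
    pose proof (of_tr HO t h Hh) as Htr.
    split.
    + replace (- (_ + _)) with (c * (a21 (q t h) * p1 (t, h) + a22 (q t h) * p2 (t, h))).
      apply (is_derive_scal (fun s => p2 (s, h))). apply (of_p2t HO t h Hh).
      replace (a22 (q t h)) with (- a11 (q t h)) by lra. ring.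
    + replace (- (_ + _)) with (- c * (a11 (q t h) * p1 (t, h) + a12 (q t h) * p2 (t, h))).
      apply (is_derive_scal (fun s => p1 (s, h))). apply (of_p1t HO t h Hh).
      replace (a11 (q t h)) with (- a22 (q t h)) by lra. ring.
Qed.

Lemma density_continuous w p t : adjoint_weight w -> V (snd p) ->
  continuous (melnikov_density g (R * R) Q (shifted w) p) t.
Proof.
  intros Hw Hp. unfold melnikov_density, rowcol.
  assert (CQ : continuous (Q p) t) by now apply shifted_continuous_t, q_continuous.
  assert (CW : continuous (shifted w p) t) by now apply shifted_continuous_t, w_continuous.
  assert (CG : continuous (fun t => g t (Q p t) 0) t).
  { apply (continuous_comp (fun t => (t, Q p t, 0)) (fun z => g (fst (fst z)) (snd (fst z)) (snd z))).
    apply continuous_pair; [apply continuous_pair|]. apply continuous_id. trivial.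
    apply continuous_const. apply Hgc. }
  apply continuous_Rplus; apply continuous_Rmult;
    (now apply continuous_fst_comp) || (now apply continuous_snd_comp).
Qed.

Lemma melnikov_is_fixed w t0 r : adjoint_weight w -> V r ->
  melnikov w q g tk l P n t0 r = melnikov_fixed w q g tk l n (t0, r).
Proof.
  intros Hw Hr. apply melnikov_window; trivial.
  - apply (per_P (fun t => q t r)). intros t. now apply Hqper.
  - apply (per_P (fun t => w t r)). intros t. now apply (gw_per Hw).
  - intros. now apply density_continuous.
Qed.

Lemma C1_shift (F : R * R -> R) t : C1_real R2 DV F ->
  C1_real R2 DV (fun p => F (t - fst p, snd p)).
Proof.
  intros HF.
  apply (C1_comp (U := R2) (V := R2) (W := R_NormedModule) DV DV
     (fun p => (t - fst p, snd p)) F); trivial.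
  apply (C1_pair (U := R2) (V := R_NormedModule) (W := R_NormedModule)).
  - apply (C1_Rplus (U := R2) DV (fun _ => t) (fun p => - fst p)).
    apply (C1_const (U := R2) (W := R_NormedModule)).
    apply (C1_Ropp (U := R2) DV (fun p => fst p)).
    apply (C1_linear (U := R2) (W := R_NormedModule)), is_linear_fst.
  - apply (C1_linear (U := R2) (W := R_NormedModule)), is_linear_snd.
Qed.

Lemma C1_shift3 (F : R * R -> R) : C1_real R2 DV F ->
  C1_real R3 (fun u => V (snd (snd u)))
    (fun u => F (fst u - fst (snd u), snd (snd u))).
Proof.
  intros HF.
  apply (C1_comp (U := R3) (V := R2) (W := R_NormedModule) _ DV
     (fun u : R * (R * R) => (fst u - fst (snd u), snd (snd u))) F); trivial.
  assert (L1 : is_linear (K := R_AbsRing) (U := R3) (V := R_NormedModule) (fun u => fst (snd u))).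
  { apply (is_linear_comp (K := R_AbsRing) (U := R3) (V := R2) (W := R_NormedModule) snd fst).
    apply is_linear_snd. apply is_linear_fst. }
  assert (L2 : is_linear (K := R_AbsRing) (U := R3) (V := R_NormedModule) (fun u => snd (snd u))).
  { apply (is_linear_comp (K := R_AbsRing) (U := R3) (V := R2) (W := R_NormedModule) snd snd).
    apply is_linear_snd. apply is_linear_snd. }
  apply (C1_pair (U := R3) (V := R_NormedModule) (W := R_NormedModule)).
  - apply (C1_Rplus (U := R3) _ (fun u => fst u) (fun u => - fst (snd u))).
    apply (C1_linear (U := R3) (W := R_NormedModule)), is_linear_fst.
    apply (C1_Ropp (U := R3) _ (fun u => fst (snd u))).
    now apply (C1_linear (U := R3) (W := R_NormedModule)).
  - now apply (C1_linear (U := R3) (W := R_NormedModule)).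
Qed.

(** Each impulse term and each integrand is a composition of [C1] maps at [eps = 0]; phase and
    energy enter only through [(t - t0, r)]. *)
Lemma melnikov_expands w i p : adjoint_weight w -> V (snd p) ->
  exists A1 A2, expands (melnikov_fixed w q g tk l i) p A1 A2.
Proof.
  intros Hw Hp. induction i as [|i (A1 & A2 & IH)].
  - exists 0, 0. intros eta Heta. exists 1. split; [lra|]. intros x _ _.
    unfold melnikov_fixed; simpl. rewrite !Rmult_0_r, Rplus_0_r, !Rminus_diag, Rabs_R0.
    pose proof (dist1_pos x p). nra.
  - assert (H1 : exists B1 B2, expands (fun p => rowcol (shifted w p (tn i)) (ln i (Q p (tn i)) 0)) p B1 B2).
    { apply (expands_C1 DV); trivial. unfold rowcol.
      apply (C1_Rplus (U := R2)); apply (C1_Rmult (U := R2)).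
      - apply (C1_shift (fun u => fst (w (fst u) (snd u)))). apply (gw_1 Hw).
      - apply (C1_shift (fun u => fst (ln i (q (fst u) (snd u)) 0))).
        apply (compose_q (fun x => fst (ln i x 0))). apply Hl1.
      - apply (C1_shift (fun u => snd (w (fst u) (snd u)))). apply (gw_2 Hw).
      - apply (C1_shift (fun u => snd (ln i (q (fst u) (snd u)) 0))).
        apply (compose_q (fun x => snd (ln i x 0))). apply Hl2. }
    assert (H2 : exists B1 B2, expands (fun p => RInt (melnikov_density g (R * R) Q (shifted w) p)
                     (tn i) (tn (S i))) p B1 B2).
    { set (Phi := fun u : R * (R * R) => melnikov_density g (R * R) Q (shifted w) (snd u) (fst u)).
      apply (expands_RInt V Phi p (tn i) (tn (S i))); trivial.
      - now apply open_V.
      - left. apply tn_lt.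
      - unfold Phi, melnikov_density, rowcol, Q, shifted.
        assert (Hq3 : C1 (U := R3) (W := R3) (fun u => V (snd (snd u)))
            (fun u => (fst u, q (fst u - fst (snd u)) (snd (snd u))))).
        { destruct (C1_pair (U := R3) (V := R_NormedModule) (W := R2) (fun u => V (snd (snd u)))
             (fun u => fst u) _
             (C1_linear (U := R3) (W := R_NormedModule) _ _ (is_linear_fst (K := R_AbsRing)))
             (C1_pair (U := R3) (V := R_NormedModule) (W := R_NormedModule) _ _ _
               (C1_shift3 _ (of_q1 HO))
               (C1_shift3 _ (of_q2 HO)))) as (dq & D1 & D2).
          exists dq. split; [|exact D2]. intros u Hu.
          apply filterdiff_ext with (2 := D1 u Hu). intros y. simpl. f_equal.
          symmetry. apply surjective_pairing. }
        apply (C1_Rplus (U := R3)); apply (C1_Rmult (U := R3)).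
        + apply (C1_shift3 (fun u => fst (w (fst u) (snd u)))). apply (gw_1 Hw).
        + exact (C1_comp (U := R3) (V := R3) (W := R_NormedModule) _ (fun _ => True) _ _ Hq3 Hg1
            (fun _ _ => I)).
        + apply (C1_shift3 (fun u => snd (w (fst u) (snd u)))). apply (gw_2 Hw).
        + exact (C1_comp (U := R3) (V := R3) (W := R_NormedModule) _ (fun _ => True) _ _ Hq3 Hg2
            (fun _ _ => I)). }
    destruct H1 as (B1 & B2 & H1). destruct H2 as (C1' & C2' & H2).
    exists (A1 + B1 + C1'), (A2 + B2 + C2').
    exact (expands_plus _ _ _ _ _ _ _ (expands_plus _ _ _ _ _ _ _ IH H1) H2).
Qed.

(** * Uniform estimates over a compact rectangle of phases and energies *)

Definition rect (ta tb ra rb : R) (p : R * R) : Prop := ta <= fst p <= tb /\ ra <= snd p <= rb.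

Lemma cpt_rect ta tb ra rb : cpt (rect ta tb ra rb).
Proof. exact (cpt_prod _ _ (cpt_interval ta tb) (cpt_interval ra rb)). Qed.

Lemma g_bounded (B : R) : exists Bg, 0 < Bg /\ forall t x eps,
  tn O <= t <= tn n -> box B x -> Rabs eps <= 1 ->
  Rabs (fst (g t x eps)) <= Bg /\ Rabs (snd (g t x eps)) <= Bg.
Proof.
  pose proof (cpt_prod _ _ (cpt_prod _ _ (cpt_interval (tn O) (tn n)) (cpt_box B))
                (cpt_interval (-1) 1)) as HKc.
  destruct (cpt_bounded _ (fun z : R * (R * R) * R => fst (g (fst (fst z)) (snd (fst z)) (snd z))) HKc)
    as (b1 & Hb1 & K1). { intros; apply continuous_fst_comp, Hgc. }
  destruct (cpt_bounded _ (fun z : R * (R * R) * R => snd (g (fst (fst z)) (snd (fst z)) (snd z))) HKc)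
    as (b2 & Hb2 & K2). { intros; apply continuous_snd_comp, Hgc. }
  exists (b1 + b2). split; [lra|]. intros t x eps Ht Hx He. apply Rabs_le_between in He.
  specialize (K1 (t, x, eps) (conj (conj Ht Hx) He)).
  specialize (K2 (t, x, eps) (conj (conj Ht Hx) He)). simpl in K1, K2. split; lra.
Qed.

Lemma l_bounded (B : R) : exists Bl, 0 < Bl /\ forall i x eps,
  (i < n)%nat -> box B x -> Rabs eps <= 1 ->
  Rabs (fst (ln i x eps)) <= Bl /\ Rabs (snd (ln i x eps)) <= Bl.
Proof.
  pose proof (cpt_prod _ _ (cpt_box B) (cpt_interval (-1) 1)) as HKc.
  assert (Hone : forall i, exists b, 0 < b /\ forall x eps, box B x -> Rabs eps <= 1 ->
     Rabs (fst (ln i x eps)) <= b /\ Rabs (snd (ln i x eps)) <= b).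
  { intros i.
    destruct (cpt_bounded _ (fun z : R * R * R => fst (ln i (fst z) (snd z))) HKc)
      as (b1 & Hb1 & K1). { intros; apply continuous_fst_comp, Hlc. }
    destruct (cpt_bounded _ (fun z : R * R * R => snd (ln i (fst z) (snd z))) HKc)
      as (b2 & Hb2 & K2). { intros; apply continuous_snd_comp, Hlc. }
    exists (b1 + b2). split; [lra|]. intros x eps Hx He. apply Rabs_le_between in He.
    specialize (K1 (x, eps) (conj Hx He)). specialize (K2 (x, eps) (conj Hx He)).
    simpl in K1, K2. split; lra. }
  generalize n. intros N. induction N as [|k IH].
  - exists 1. split; [lra|]. intros; lia.
  - destruct IH as (b & Hb & IH). destruct (Hone k) as (b' & Hb' & H').
    exists (b + b'). split; [lra|]. intros i x eps Hi Hx He.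
    destruct (Nat.eq_dec i k) as [->|Hne].
    + destruct (H' x eps Hx He). split; lra.
    + destruct (IH i x eps ltac:(lia) Hx He). split; lra.
Qed.

Lemma dist1_ball (x y : R * R) d : dist1 y x < d -> ball x d y.
Proof.
  intros H. unfold dist1 in H.
  pose proof (Rabs_pos (fst y - fst x)). pose proof (Rabs_pos (snd y - snd x)).
  assert (K1 : Rabs (fst y - fst x) < d) by lra.
  assert (K2 : Rabs (snd y - snd x) < d) by lra. now split.
Qed.

Lemma g_uniform (B eta : R) : 0 < eta -> exists del, 0 < del /\
  forall t x y eps, tn O <= t <= tn n -> box B x -> dist1 y x < del -> Rabs eps < del ->
  Rabs (fst (g t y eps) - fst (g t x 0)) <= eta /\
  Rabs (snd (g t y eps) - snd (g t x 0)) <= eta.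
Proof.
  intros Heta.
  (* The compact set has [eps = 0]; the perturbed point [(t, y, eps)] lies off it, as
     [cpt_unif_cont] permits. *)
  pose proof (cpt_prod _ _ (cpt_prod _ _ (cpt_interval (tn O) (tn n)) (cpt_box B))
                (cpt_interval 0 0)) as HKc.
  destruct (cpt_unif_cont _ (fun z : R * (R * R) * R => g (fst (fst z)) (snd (fst z)) (snd z)) eta HKc)
    as (d & Hd & HU); trivial.
  exists d. split; trivial. intros t x y eps Ht Hx Hy He.
  assert (B1 : ball (t, x, 0) d (t, y, eps)).
  { split; [split|]. now apply ball_self. now apply dist1_ball.
    apply ball_R. simpl. now rewrite Rminus_0_r. }
  destruct (HU (t, x, 0) (conj (conj Ht Hx) (conj (Rle_refl 0) (Rle_refl 0))) _ B1) as [H1 H2].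
  split; left; assumption.
Qed.

Lemma l_uniform (B eta : R) i : 0 < eta -> exists del, 0 < del /\
  forall x y eps, box B x -> dist1 y x < del -> Rabs eps < del ->
  Rabs (fst (ln i y eps) - fst (ln i x 0)) <= eta /\
  Rabs (snd (ln i y eps) - snd (ln i x 0)) <= eta.
Proof.
  intros Heta.
  pose proof (cpt_prod _ _ (cpt_box B) (cpt_interval 0 0)) as HKc.
  destruct (cpt_unif_cont _ (fun z : R * R * R => ln i (fst z) (snd z)) eta HKc)
    as (d & Hd & HU); trivial. { intros; apply Hlc. }
  exists d. split; trivial. intros x y eps Hx Hy He.
  assert (B1 : ball (x, 0) d (y, eps)).
  { split. now apply dist1_ball. apply ball_R. simpl. now rewrite Rminus_0_r. }
  destruct (HU (x, 0) (conj Hx (conj (Rle_refl 0) (Rle_refl 0))) _ B1) as [H1 H2].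
  split; left; assumption.
Qed.

Lemma lipschitz_constant (B : R) : exists L, 0 < L /\
  (forall x y, box B x -> box B y ->
     Rabs (fst (f x) - fst (f y)) <= L * dist1 x y /\
     Rabs (snd (f x) - snd (f y)) <= L * dist1 x y) /\
  (forall eps t x y, Rabs eps <= 1 -> tn O <= t <= tn n -> box B x -> box B y ->
     Rabs (fst (g t x eps) - fst (g t y eps)) <= L * dist1 x y /\
     Rabs (snd (g t x eps) - snd (g t y eps)) <= L * dist1 x y).
Proof.
  assert (Hconst : forall a : R * R -> R, (forall x, continuous a x) ->
     forall z : R * (R * R), continuous (fun z => a (snd z)) z).
  { intros a Ha z. apply (continuous_comp (fun z : R * (R * R) => snd z) a); trivial.
    apply continuous_snd. }
  (* The autonomous [f] is viewed as a family over the one-point parameter set. *)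
  destruct (lipschitz_on_box (fun s : R => 0 <= s <= 0) (fun _ x => fst (f x)) (fun _ => a11)
    (fun _ => a12) B (cpt_interval 0 0)) as (L1 & P1 & K1).
  { intros _. apply (of_f1 HO). }
  { apply Hconst. apply (of_a11 HO). }
  { apply Hconst. apply (of_a12 HO). }
  destruct (lipschitz_on_box (fun s : R => 0 <= s <= 0) (fun _ x => snd (f x)) (fun _ => a21)
    (fun _ => a22) B (cpt_interval 0 0)) as (L2 & P2 & K2).
  { intros _. apply (of_f2 HO). }
  { apply Hconst. apply (of_a21 HO). }
  { apply Hconst. apply (of_a22 HO). }
  pose proof (cpt_prod _ _ (cpt_interval (tn O) (tn n)) (cpt_interval (-1) 1)) as HKc.
  destruct (lipschitz_on_box _ (fun s x => fst (g (fst s) x (snd s))) d11 d12 B HKc Hgp1 Hd11 Hd12)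
    as (L3 & P3 & K3).
  destruct (lipschitz_on_box _ (fun s x => snd (g (fst s) x (snd s))) d21 d22 B HKc Hgp2 Hd21 Hd22)
    as (L4 & P4 & K4).
  exists (L1 + L2 + L3 + L4). split; [lra|].
  assert (Hle : forall c L x y, c <= L * dist1 x y -> L <= L1 + L2 + L3 + L4 ->
            c <= (L1 + L2 + L3 + L4) * dist1 x y).
  { intros c L x y H1 H2. apply Rle_trans with (1 := H1).
    apply Rmult_le_compat_r; trivial. apply dist1_pos. }
  split.
  - intros x y Hx Hy. split.
    + apply Hle with L1; [|lra]. apply (K1 0); trivial; lra.
    + apply Hle with L2; [|lra]. apply (K2 0); trivial; lra.
  - intros eps t x y He Ht Hx Hy. apply Rabs_le_between in He. split.
    + apply Hle with L3; [|lra]. now apply (K3 (t, eps)).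
    + apply Hle with L4; [|lra]. now apply (K4 (t, eps)).
Qed.

Lemma shifted_bounded (w : R -> R -> R * R) (c ta tb ra rb : R) :
  (forall t r, ra <= r <= rb -> continuous (fun u : R * R => w (fst u) (snd u)) (t, r)) ->
  exists C, c < C /\ 0 < C /\ forall p t, rect ta tb ra rb p -> tn O <= t <= tn n ->
    Rabs (fst (shifted w p t)) <= C /\ Rabs (snd (shifted w p t)) <= C.
Proof.
  intros Hw. pose proof (cpt_rect (tn O - tb) (tn n - ta) ra rb) as HKc.
  destruct (cpt_bounded _ (fun u : R * R => fst (w (fst u) (snd u))) HKc) as (b1 & Hb1 & K1).
  { intros [t r] [_ Hr]. now apply continuous_fst_comp, Hw. }
  destruct (cpt_bounded _ (fun u : R * R => snd (w (fst u) (snd u))) HKc) as (b2 & Hb2 & K2).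
  { intros [t r] [_ Hr]. now apply continuous_snd_comp, Hw. }
  exists (b1 + b2 + Rabs c + 1).
  pose proof (Rle_abs c). pose proof (Rabs_pos c). split; [lra|]. split; [lra|].
  intros p t [Hp1 Hp2] Ht.
  assert (Hr : rect (tn O - tb) (tn n - ta) ra rb (t - fst p, snd p)) by (split; simpl; lra).
  specialize (K1 _ Hr). specialize (K2 _ Hr). simpl in K1, K2. unfold shifted. split; lra.
Qed.

Notation traj B0 := (trajectory f g tn ln n B0).

(** Everything later needed about trajectories starting near the family. The order of quantifiers
    matters: [B0] and [C] depend on the rectangle alone, and [del] on the weight and [eta] but not
    on the parameter in the rectangle. *)
Lemma perturbed_trajectories (ta tb ra rb : R) : (forall r, ra <= r <= rb -> V r) ->
  exists B0 C, 0 < B0 /\ 0 < C /\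
  (forall p t, rect ta tb ra rb p -> tn O <= t <= tn n -> box B0 (Q p t)) /\
  (forall eps p y X, Rabs eps <= 1 -> rect ta tb ra rb p -> traj B0 eps y X -> y O = Q p (tn O) ->
     forall j t, (j < n)%nat -> tn j <= t <= tn (S j) -> dist1 (X j t) (Q p t) <= C * Rabs eps) /\
  (forall w eta, adjoint_weight w -> 0 < eta -> exists del, 0 < del /\
     forall eps p y X, Rabs eps < del -> rect ta tb ra rb p -> traj B0 eps y X ->
     y O = Q p (tn O) ->
     Rabs (rowdiff (shifted w p (tn n)) (y n) (Q p (tn n)) - eps * melnikov_fixed w q g tk l n p)
       <= eta * Rabs eps) /\
  (forall eps, Rabs eps <= 1 ->
     exists (Y : R * R -> nat -> R * R) (X : R * R -> nat -> R -> R * R),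
     forall y, traj B0 eps (Y y) (X y) /\ Y y O = y /\
       forall i, (i <= n)%nat -> continuous (fun y => Y y i) y).
Proof.
  intros HVr.
  destruct (shifted_bounded q 0 ta tb ra rb) as (B0 & _ & HB0 & HQB).
  { intros t r Hr. now apply q_continuous, HVr. }
  set (Kp := rect ta tb ra rb).
  assert (HQbox : forall p t, Kp p -> tn O <= t <= tn n -> box B0 (Q p t)).
  { intros p t Hp Ht. destruct (HQB p t Hp Ht) as [H1 H2].
    apply Rabs_le_between in H1. apply Rabs_le_between in H2. now split. }
  destruct (lipschitz_constant (B0 + 1)) as (L & HL & HfL & HgL).
  destruct (g_bounded (B0 + 1)) as (b1 & Hb1 & HgB). destruct (l_bounded (B0 + 1)) as (b2 & Hb2 & HlB).
  set (Bg := b1 + b2). assert (HBg : 0 < Bg) by (unfold Bg; lra).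
  assert (HgB' : forall t x eps, tn O <= t <= tn n -> box (B0 + 1) x -> Rabs eps <= 1 ->
    Rabs (fst (g t x eps)) <= Bg /\ Rabs (snd (g t x eps)) <= Bg).
  { intros t x eps H1 H2 H3. destruct (HgB t x eps H1 H2 H3). unfold Bg. split; lra. }
  assert (HlB' : forall i x eps, (i < n)%nat -> box (B0 + 1) x -> Rabs eps <= 1 ->
    Rabs (fst (ln i x eps)) <= Bg /\ Rabs (snd (ln i x eps)) <= Bg).
  { intros i x eps H1 H2 H3. destruct (HlB i x eps H1 H2 H3). unfold Bg. split; lra. }
  assert (HQd : forall p t, Kp p ->
     is_derive (fun s => fst (Q p s)) t (fst (f (Q p t))) /\
     is_derive (fun s => snd (Q p s)) t (snd (f (Q p t)))).
  { intros p t [_ Hr]. unfold Q, shifted.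
    destruct (of_qt HO (t - fst p) (snd p) (HVr _ Hr)) as [H1 H2].
    rewrite <- (Rmult_1_l (fst (f _))), <- (Rmult_1_l (snd (f _))).
    split.
    - apply (is_derive_comp (fun s => fst (q s (snd p))) (fun s => s - fst p)); trivial.
      auto_derive; trivial; ring.
    - apply (is_derive_comp (fun s => snd (q s (snd p))) (fun s => s - fst p)); trivial.
      auto_derive; trivial; ring. }
  destruct (trajectory_close f g tn ln n B0 L Bg HB0 HL HBg tn_lt HfL HgB' HlB' (R * R) Kp Q
              HQbox HQd n (le_n n)) as (C & HC & Hclose).
  exists B0, C. split; [trivial|]. split; [trivial|]. split; [exact HQbox|]. split; [|split].
  - intros eps p y X He Hp HX H0 j t Hj Ht. now apply (Hclose eps p y X).
  - intros w eta Hw Heta.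
    destruct (shifted_bounded w 0 ta tb ra rb) as (CW & _ & HCW & HWB).
    { intros t r Hr. apply w_continuous; auto. }
    apply (trajectory_melnikov f g tn ln a11 a12 a21 a22 n B0 L Bg HB0 HL HBg tn_lt HfL) with (CW := CW);
      trivial.
    + intros e He.
      destruct (taylor_on_box (fun x => fst (f x)) a11 a12 B0 e) as (e1 & He1 & K1); trivial.
      apply (of_f1 HO). apply (of_a11 HO).
      apply (of_a12 HO).
      destruct (taylor_on_box (fun x => snd (f x)) a21 a22 B0 e) as (e2 & He2 & K2); trivial.
      apply (of_f2 HO). apply (of_a21 HO).
      apply (of_a22 HO).
      exists (Rmin e1 e2). split. now apply Rmin_pos.
      intros x y Hx Hd. pose proof (Rmin_l e1 e2). pose proof (Rmin_r e1 e2).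
      split; [apply K1 | apply K2]; trivial; lra.
    + intros; now apply g_uniform.
    + intros; now apply l_uniform.
    + intros p t [_ Hr]. unfold Q, shifted.
      destruct (gw_adj Hw (t - fst p) (snd p) (HVr _ Hr)) as [H1 H2].
      match goal with |- is_derive _ _ ?a /\ is_derive _ _ ?b =>
        rewrite <- (Rmult_1_l a), <- (Rmult_1_l b) end.
      split.
      * apply (is_derive_comp (fun s => fst (w s (snd p))) (fun s => s - fst p)); trivial.
        auto_derive; trivial; ring.
      * apply (is_derive_comp (fun s => snd (w s (snd p))) (fun s => s - fst p)); trivial.
        auto_derive; trivial; ring.
    + intros p t [_ Hr]. now apply density_continuous, HVr.
  - intros eps He. apply (trajectories_exist f g tn ln n B0 L eps HB0 HL He tn_lt); trivial.
    + intros x. apply continuous_ext with (fun x => (fst (f x), snd (f x))).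
      intros z. symmetry. apply surjective_pairing.
      apply continuous_pair.
      apply (C1_continuous (U := R2) (W := R_NormedModule) _ _ _ (of_f1C HO) I).
      apply (C1_continuous (U := R2) (W := R_NormedModule) _ _ _ (of_f2C HO) I).
    + intros z. apply (continuous_comp (fun z : R * (R * R) => (fst z, snd z, eps))
         (fun z => g (fst (fst z)) (snd (fst z)) (snd z))); [|apply Hgc].
      apply continuous_pair; [apply continuous_pair|]. apply continuous_fst. apply continuous_snd.
      apply continuous_const.
    + intros i x. apply (continuous_comp (fun x : R * R => (x, eps)) (fun z => ln i (fst z) (snd z))).
      apply continuous_pair. apply continuous_id. apply continuous_const. apply Hlc.
    + intros t x y Ht Hx Hy. now apply HgL.
Qed.

(** The Jacobian of [(t0,r) |-> q(tn 0 - t0, r)] is [-1]. *)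
Lemma orbit_cover (t0 h0 rho : R) : V h0 -> 0 < rho -> exists d, 0 < d /\ forall y,
  dist1 y (Q (t0, h0) (tn O)) < d ->
  exists p, Rabs (fst p - t0) <= rho /\ Rabs (snd p - h0) <= rho /\ V (snd p) /\ Q p (tn O) = y.
Proof.
  intros Hh0 Hrho. set (u0 := (t0, h0)).
  destruct (expands_C1 DV (fun p => fst (Q p (tn O))) u0) as (A1 & A2 & E1); trivial.
  { apply (C1_shift (fun u => fst (q (fst u) (snd u)))). apply (of_q1 HO). }
  destruct (expands_C1 DV (fun p => snd (Q p (tn O))) u0) as (B1 & B2 & E2); trivial.
  { apply (C1_shift (fun u => snd (q (fst u) (snd u)))). apply (of_q2 HO). }
  set (s0 := tn O - t0).
  destruct (of_qt HO s0 h0 Hh0) as [Q1 Q2].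
  destruct (of_qh HO s0 h0 Hh0) as [H1 H2].
  pose proof (of_det HO s0 h0 Hh0) as Hdet.
  assert (Hlin : is_derive (fun t => tn O - t) t0 (-1)) by (auto_derive; trivial; ring).
  assert (FA1 : A1 = - fst (f (q s0 h0))).
  { rewrite <- (is_derive_unique _ _ _ (expands_derive_1 _ _ _ _ E1)). apply is_derive_unique.
    replace (- fst (f (q s0 h0))) with (-1 * fst (f (q s0 h0))) by ring.
    apply (is_derive_comp (fun s => fst (q s h0)) (fun t => tn O - t)); trivial. }
  assert (FB1 : B1 = - snd (f (q s0 h0))).
  { rewrite <- (is_derive_unique _ _ _ (expands_derive_1 _ _ _ _ E2)). apply is_derive_unique.
    replace (- snd (f (q s0 h0))) with (-1 * snd (f (q s0 h0))) by ring.
    apply (is_derive_comp (fun s => snd (q s h0)) (fun t => tn O - t)); trivial. }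
  assert (FA2 : A2 = p1 (s0, h0)).
  { rewrite <- (is_derive_unique _ _ _ (expands_derive_2 _ _ _ _ E1)). now apply is_derive_unique. }
  assert (FB2 : B2 = p2 (s0, h0)).
  { rewrite <- (is_derive_unique _ _ _ (expands_derive_2 _ _ _ _ E2)). now apply is_derive_unique. }
  (* The map is only known through its expansion at [(t0, h0)], so surjectivity near that point
     comes from Poincaré-Miranda again. *)
  destruct (perturbed_linear_zero A1 A2 B1 B2) as (ka & Hka & Hzero).
  { rewrite FA1, FA2, FB1, FB2. intros Hd. lra. }
  assert (Hk4 : 0 < ka / 4) by lra.
  destruct (E1 _ Hk4) as (r1 & Hr1 & K1). destruct (E2 _ Hk4) as (r2 & Hr2 & K2).
  destruct (open_V V HV h0 Hh0) as [d0 Hd0]. pose proof (cond_pos d0) as Pd0.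
  destruct (common_radius rho (d0 / 2) (r1 / 2) (r2 / 2) 1)
    as (r & Hr0 & Hra & Hrb & Hrc & Hrd & _); try lra.
  (* Half of the tolerance [ka r] is for the displacement of [y]; the other half is the Taylor
     error, [ka / 4] times a distance of at most [2 r]. *)
  exists (ka / 2 * r). split. apply Rmult_lt_0_compat; lra.
  intros y Hy. unfold dist1 in Hy.
  pose proof (Rabs_pos (fst y - fst (Q u0 (tn O)))) as N1.
  pose proof (Rabs_pos (snd y - snd (Q u0 (tn O)))) as N2. fold u0 in Hy.
  destruct (Hzero (fun p => fst (Q p (tn O)) - fst y) (fun p => snd (Q p (tn O)) - snd y) t0 h0 r Hr0)
    as (p & I1 & I2 & Z1 & Z2).
  - intros x X1 X2. assert (HVx : V (snd x)) by (apply Hd0, ball_R; lra).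
    assert (CQ : continuous (fun p => Q p (tn O)) x) by now apply shifted_continuous, q_continuous.
    assert (Hdd : dist1 x u0 <= 2 * r) by (unfold dist1; simpl; lra).
    assert (Hka' : ka / 4 * dist1 x u0 <= ka / 2 * r) by nra.
    split; [|split; [|split]].
    + apply continuous_Rminus. now apply continuous_fst_comp. apply continuous_const.
    + apply continuous_Rminus. now apply continuous_snd_comp. apply continuous_const.
    + specialize (K1 x ltac:(simpl; lra) ltac:(simpl; lra)).
      match type of K1 with Rabs ?a <= _ =>
        replace (fst (Q x (tn O)) - fst y - (A1 * (fst x - t0) + A2 * (snd x - h0)))
          with (a - (fst y - fst (Q u0 (tn O)))) by (unfold u0; simpl; ring) end.
      apply Rle_trans with (1 := Rabs_triang _ _). rewrite Rabs_Ropp. lra.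
    + specialize (K2 x ltac:(simpl; lra) ltac:(simpl; lra)).
      match type of K2 with Rabs ?a <= _ =>
        replace (snd (Q x (tn O)) - snd y - (B1 * (fst x - t0) + B2 * (snd x - h0)))
          with (a - (snd y - snd (Q u0 (tn O)))) by (unfold u0; simpl; ring) end.
      apply Rle_trans with (1 := Rabs_triang _ _). rewrite Rabs_Ropp. lra.
  - exists p. split; [lra|]. split; [lra|]. split. apply Hd0, ball_R. lra.
    apply injective_projections; lra.
Qed.

(** Conversely to the construction by cut-off, a given solution inside the box is a trajectory,
    since the retraction acts trivially on it. *)
Lemma solution_trajectory eps B0 (x : R -> R * R) : 0 < B0 ->
  is_solution f g tk l eps x -> (forall t, box (B0 + 1) (x t)) ->
  exists X, traj B0 eps (fun i => x (tn i)) X.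
Proof.
  intros HB0 (S1 & S2 & S3) Hbox.
  destruct (choice _ S3) as [xp Hxp].
  set (xr i := xp (Z.of_nat i)).
  (* The left limit at [tn i] is replaced by the right limit, and the piece is continued by
     constants on both sides to be two-sidedly continuous at its ends. *)
  set (X i t := if Rle_dec t (tn i) then xr i
                else if Rle_dec t (tn (S i)) then x t else x (tn (S i))).
  exists X. intros i _. pose proof (tn_lt i) as Hti.
  destruct (Hxp (Z.of_nat i)) as [J1 J2]. fold (tn i) in J1, J2. fold (xr i) in J1, J2.
  fold (ln i) in J2.
  assert (Hd : forall t, tn i < t < tn (S i) -> is_derive (V := R2) x t
      (plus (f (x t) : R2) (scal eps (g t (x t) eps : R2)))).
  { intros t Ht. apply (S1 (Z.of_nat (S i))).
    replace (Z.of_nat (S i) - 1)%Z with (Z.of_nat i) by lia. exact Ht. }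
  assert (Hloc : forall t, tn i < t < tn (S i) -> locally t (fun s => x s = X i s)).
  { intros t Ht. apply (locally_interval _ t (tn i) (tn (S i))); simpl; try apply Ht.
    intros s B1 B2. simpl in B1, B2. unfold X. destruct (Rle_dec s (tn i)); [lra|].
    destruct (Rle_dec s (tn (S i))); [trivial | lra]. }
  assert (Xin : forall t, tn i < t < tn (S i) -> X i t = x t).
  { intros t Ht. unfold X. destruct (Rle_dec t (tn i)); [lra|].
    destruct (Rle_dec t (tn (S i))); [trivial | lra]. }
  assert (Xl : X i (tn i) = xr i).
  { unfold X. destruct (Rle_dec (tn i) (tn i)); [trivial | lra]. }
  assert (Xr : X i (tn (S i)) = x (tn (S i))).
  { unfold X. destruct (Rle_dec (tn (S i)) (tn i)); [lra|].
    destruct (Rle_dec (tn (S i)) (tn (S i))); [trivial | lra]. }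
  split; [|split; [split|]].
  - rewrite Xl. unfold jump. rewrite boxclamp_id by apply Hbox.
    pose proof (f_equal fst J2) as K1. pose proof (f_equal snd J2) as K2.
    change (fst (xr i) - fst (x (tn i)) = eps * fst (ln i (x (tn i)) eps)) in K1.
    change (snd (xr i) - snd (x (tn i)) = eps * snd (ln i (x (tn i)) eps)) in K2.
    apply injective_projections; simpl; lra.
  - intros t Ht.
    destruct (Req_dec t (tn i)) as [->|N1]; [|destruct (Req_dec t (tn (S i))) as [->|N2]].
    + apply filterlim_locally. intros e. rewrite Xl.
      destruct (proj1 (filterlim_locally _ _) J1 e) as [d Hd'].
      assert (Hm : 0 < Rmin d (tn (S i) - tn i)) by (apply Rmin_pos; [apply cond_pos | lra]).
      exists (mkposreal _ Hm). intros s Hs.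
      change (Rabs (s - tn i) < Rmin d (tn (S i) - tn i)) in Hs.
      pose proof (Rmin_l d (tn (S i) - tn i)). pose proof (Rmin_r d (tn (S i) - tn i)).
      unfold X. destruct (Rle_dec s (tn i)); [apply ball_center|].
      pose proof (Rabs_def2 _ _ Hs) as Hs2.
      destruct (Rle_dec s (tn (S i))); [|lra]. apply Hd'; [|lra].
      apply ball_R. lra.
    + apply filterlim_locally. intros e. rewrite Xr.
      destruct (proj1 (filterlim_locally _ _) (S2 (Z.of_nat (S i))) e) as [d Hd'].
      assert (Hm : 0 < Rmin d (tn (S i) - tn i)) by (apply Rmin_pos; [apply cond_pos | lra]).
      exists (mkposreal _ Hm). intros s Hs.
      change (Rabs (s - tn (S i)) < Rmin d (tn (S i) - tn i)) in Hs.
      pose proof (Rmin_l d (tn (S i) - tn i)). pose proof (Rmin_r d (tn (S i) - tn i)).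
      pose proof (Rabs_def2 _ _ Hs) as Hs2.
      unfold X. destruct (Rle_dec s (tn i)); [lra|].
      destruct (Rle_dec s (tn (S i))) as [Hle|]; [|apply ball_center].
      destruct (Req_dec s (tn (S i))) as [->|Hne]; [apply ball_center|].
      apply Hd'. apply ball_R. fold (tn (S i)). lra. fold (tn (S i)). lra.
    + assert (Ht' : tn i < t < tn (S i)) by lra.
      apply continuous_ext_loc with x. apply Hloc; trivial.
      apply (ex_derive_continuous (V := R2)). eexists. now apply Hd.
  - intros t Ht. unfold cutfield. rewrite (Xin t Ht), boxclamp_id by apply Hbox. simpl.
    specialize (Hd t Ht). split.
    + apply is_derive_ext_loc with (fun s => fst (x s)).
      apply filter_imp with (2 := Hloc t Ht). intros s Hs. now rewrite Hs.
      apply (is_derive_fst (U := R_NormedModule) (W := R_NormedModule)) in Hd. exact Hd.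
    + apply is_derive_ext_loc with (fun s => snd (x s)).
      apply filter_imp with (2 := Hloc t Ht). intros s Hs. now rewrite Hs.
      apply (is_derive_snd (U := R_NormedModule) (W := R_NormedModule)) in Hd. exact Hd.
  - exact Xr.
Qed.

Lemma compact_subinterval h : V h -> exists rho, 0 < rho /\ forall r, h - rho <= r <= h + rho -> V r.
Proof.
  intros Hh. destruct (open_V V HV h Hh) as [d Hd]. pose proof (cond_pos d).
  exists (d / 2). split; [lra|]. intros r Hr. apply Hd, ball_R.
  apply Rle_lt_trans with (d / 2); [apply Rabs_le|]; lra.
Qed.

Lemma Q_period p : V (snd p) -> Q p (tn n) = Q p (tn O).
Proof.
  intros Hp. unfold Q, shifted. rewrite tn_n.
  replace (tn O + P - fst p) with (tn O - fst p + P) by ring.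
  apply (per_P (fun t => q t (snd p))). intros t. now apply Hqper.
Qed.

(** * Necessity of a common zero *)

(** If there is no common zero at [hhat], at every phase one of the two functions is nonzero, and
    for small [eps] no periodic solution starts near that point of the orbit. Compactness of
    [[0, T0]] makes the excluded neighbourhood uniform, contradicting that [x eps (tn O)] approaches
    the orbit. *)
Lemma melnikov_necessary (w1 w2 : R -> R -> R * R) (hhat eps1 : R) (x : R -> R -> R * R) :
  adjoint_weight w1 -> adjoint_weight w2 -> V hhat -> 0 < eps1 ->
  (forall eps, 0 < Rabs eps < eps1 ->
     is_solution f g tk l eps (x eps) /\ forall t, x eps (t + P) = x eps t) ->
  (forall eta, 0 < eta -> exists del, 0 < del /\ forall eps, 0 < Rabs eps < del -> forall t,
     exists t', dist1 (x eps t) (q t' hhat) < eta) ->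
  exists t0, 0 <= t0 <= T0 /\ melnikov_fixed w1 q g tk l n (t0, hhat) = 0 /\
    melnikov_fixed w2 q g tk l n (t0, hhat) = 0.
Proof.
  intros Hw1 Hw2 Hh Heps1 Hsol Hnear. apply NNPP. intros Hno.
  destruct (compact_subinterval hhat Hh) as (rho0 & Hrho0 & HVr).
  destruct (perturbed_trajectories (-1) (T0 + 1) (hhat - rho0) (hhat + rho0) HVr)
    as (B0 & C & HB0 & HC & HQbox & _ & Hmel & _).
  destruct (Hnear 1 Rlt_0_1) as (del1 & Hdel1 & Hn1).
  pose proof T0_le_P as HPp. pose proof tn_n as Htnn.
  assert (Hqp : forall t, q (t + T0) hhat = q t hhat) by (intros; now apply Hqper).
  assert (Hbox : forall eps t, 0 < Rabs eps < del1 -> box (B0 + 1) (x eps t)).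
  { intros eps t He. destruct (Hn1 eps He t) as (t' & Ht').
    destruct (periodic_reduce (fun t => q t hhat) T0 (tn O) t' HT0 Hqp) as (s & Hs1 & Hs2).
    apply (box_near B0 (q t' hhat)); [|lra]. rewrite <- Hs2.
    replace (q s hhat) with (Q (0, hhat) s) by (unfold Q, shifted; simpl; now rewrite Rminus_0_r).
    apply HQbox; [split; simpl; lra | lra]. }
  (* The points [Q (t, hhat) (tn O)] fill the orbit when [t] runs through one period, so a statement
     for each phase [t] controls a neighbourhood of the orbit. *)
  destruct (cpt_interval 0 T0 (fun t d => forall eps, 0 < Rabs eps < d -> eps <> 0 ->
       ~ dist1 (x eps (tn O)) (Q (t, hhat) (tn O)) < d)) as (d & Hd & Hfar).
  - intros t d d' HQd Hd eps He Hne Hlt. apply (HQd eps); trivial; lra.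
  - intros t Ht.
    assert (Hw : exists w, adjoint_weight w /\ melnikov_fixed w q g tk l n (t, hhat) <> 0).
    { destruct (Req_dec (melnikov_fixed w1 q g tk l n (t, hhat)) 0) as [E1|E1].
      - destruct (Req_dec (melnikov_fixed w2 q g tk l n (t, hhat)) 0) as [E2|E2].
        + exfalso. apply Hno. exists t. auto.
        + now exists w2.
      - now exists w1. }
    destruct Hw as (w & Hw & Hmu). set (mu := melnikov_fixed w q g tk l n (t, hhat)) in *.
    assert (Hmu' : 0 < Rabs mu) by now apply Rabs_pos_lt.
    destruct (melnikov_expands w n (t, hhat) Hw Hh) as (A1 & A2 & HE).
    destruct (expands_near _ _ _ _ HE (Rabs mu / 4) ltac:(lra)) as (r1 & Hr1 & Kmu).
    fold mu in Kmu. simpl in Kmu.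
    destruct (Hmel w (Rabs mu / 4) Hw ltac:(lra)) as (del2 & Hdel2 & Kmel).
    destruct (common_radius r1 1 rho0 1 1) as (r & Hr0 & Hra & Hrb & Hrc & _); try lra.
    destruct (orbit_cover t hhat r Hh Hr0) as (d1 & Hd1 & Hcover).
    assert (CQ : continuous (fun s => Q (s, hhat) (tn O)) t).
    { apply (continuous_comp (fun s : R => (s, hhat)) (fun p => Q p (tn O))).
      apply continuous_pair. apply continuous_id. apply continuous_const.
      now apply shifted_continuous, q_continuous. }
    assert (Hd14 : 0 < d1 / 4) by lra.
    destruct (proj1 (filterlim_locally _ _) CQ (mkposreal _ Hd14)) as [d2 Hd2].
    pose proof (cond_pos d2) as Pd2.
    destruct (common_radius d2 (d1 / 2) del1 del2 eps1)
      as (d & Hdp & Hda & Hdb & Hdc & Hdd & Hde); try lra.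
    exists d. split; trivial. intros s Hs Hbs eps He Hne Hlt.
    assert (Hbs2 : dist1 (Q (s, hhat) (tn O)) (Q (t, hhat) (tn O)) < d1 / 2).
    { assert (Hb : ball (Q (t, hhat) (tn O)) (d1 / 4) (Q (s, hhat) (tn O))).
      { apply (Hd2 s). apply ball_le with d; trivial. }
      assert (b1 : Rabs (fst (Q (s, hhat) (tn O)) - fst (Q (t, hhat) (tn O))) < d1 / 4)
        by exact (proj1 Hb).
      assert (b2 : Rabs (snd (Q (s, hhat) (tn O)) - snd (Q (t, hhat) (tn O))) < d1 / 4)
        by exact (proj2 Hb).
      unfold dist1. lra. }
    destruct (Hcover (x eps (tn O))) as (p & P1 & P2 & P3 & P4).
    { apply Rle_lt_trans with (1 := dist1_triang _ (Q (s, hhat) (tn O)) _).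
      apply Rlt_le_trans with (d + d1 / 2); [|lra].
      apply Rplus_lt_compat; [exact Hlt | exact Hbs2]. }
    destruct (Hsol eps ltac:(lra)) as [Hs1 Hs2].
    destruct (solution_trajectory eps B0 (x eps) HB0 Hs1) as [X HX].
    { intros t'. apply Hbox. lra. }
    assert (Hp : rect (-1) (T0 + 1) (hhat - rho0) (hhat + rho0) p).
    { pose proof (proj1 (Rabs_le_between _ _) P1). pose proof (proj1 (Rabs_le_between _ _) P2).
      split; lra. }
    (* Solution and reference orbit start together and both return after [P], so the increment is 0
       and the Melnikov value at [p] is at most [|mu| / 4]. Yet [p] is so close to [(t, hhat)] that
       this value differs from [mu] by at most [|mu| / 4]. *)
    pose proof (Kmel eps p _ X ltac:(lra) Hp HX (eq_sym P4)) as Km.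
    rewrite Q_period in Km by trivial. rewrite P4, Htnn, Hs2 in Km.
    unfold rowdiff in Km. rewrite !Rminus_diag in Km.
    replace (_ + _ - _) with (- (eps * melnikov_fixed w q g tk l n p)) in Km by ring.
    rewrite Rabs_Ropp, Rabs_mult, (Rmult_comm (Rabs mu / 4)) in Km.
    apply Rmult_le_reg_l in Km; [|lra].
    specialize (Kmu p ltac:(lra) ltac:(lra)).
    pose proof (Rabs_triang_inv mu (mu - melnikov_fixed w q g tk l n p)) as Kt.
    replace (mu - (mu - melnikov_fixed w q g tk l n p)) with (melnikov_fixed w q g tk l n p) in Kt by ring.
    rewrite (Rabs_minus_sym mu) in Kt. lra.
  - destruct (Hnear d Hd) as (del & Hdel & Hn2).
    destruct (common_radius (d / 2) (del / 2) (eps1 / 2) 1 1)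
      as (eps & He0 & He1 & He2 & He3 & _); try lra.
    assert (Ha : Rabs eps = eps) by (apply Rabs_pos_eq; lra).
    destruct (Hn2 eps ltac:(lra) (tn O)) as (t' & Ht').
    destruct (periodic_reduce (fun t => q t hhat) T0 (tn O - T0) t' HT0 Hqp) as (s & Hs1 & Hs2).
    (* The point [q s hhat] has phase [tn O - s]; taking [s] in [[tn O - T0, tn O]] puts the phase
       in [[0, T0]]. *)
    apply (Hfar (tn O - s) ltac:(lra) eps); [lra | lra|].
    unfold Q, shifted. simpl. replace (tn O - (tn O - s)) with s by ring. now rewrite Hs2.
Qed.

(** * Sufficiency of a simple zero *)

(** The [n] pieces are translated by multiples of [P] and glued; [y n = y O] closes the chain. The
    last clause traces each value back to the window, so that estimates there extend to all
    times. *)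
Lemma trajectory_extend eps B0 y X : traj B0 eps y X -> y n = y O ->
  (forall j t, (j < n)%nat -> tn j <= t <= tn (S j) -> box (B0 + 1) (X j t)) ->
  (forall j, (j < n)%nat -> box (B0 + 1) (y j)) ->
  exists x, is_solution f g tk l eps x /\ (forall t, x (t + P) = x t) /\
    forall t, exists j t' k, (j < n)%nat /\ tn j <= t' <= tn (S j) /\ x t = X j t' /\ t = t' + IZR k * P.
Proof.
  intros HX Hyn HXb Hyb. set (nz := Z.of_nat n). assert (Hnz : (0 < nz)%Z) by (unfold nz; lia).
  (* Euclidean division [k = jj k + dd k * n]: the piece used after impulse [k], and the number of
     periods by which it is moved. *)
  set (jj k := Z.to_nat (k mod nz)). set (dd k := (k / nz)%Z).
  assert (Hjj : forall k, (jj k < n)%nat).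
  { intros k. unfold jj. pose proof (Z.mod_pos_bound k nz Hnz). unfold nz in *. lia. }
  assert (Hk : forall k, k = (Z.of_nat (jj k) + dd k * nz)%Z).
  { intros k. unfold jj, dd. rewrite Z2Nat.id by (apply Z.mod_pos_bound; lia).
    pose proof (Z.div_mod k nz ltac:(lia)). lia. }
  assert (Htkd : forall d j, tk (j + d * nz)%Z = tk j + IZR d * P).
  { intros d j.
    assert (H : forall (c : nat) j, tk (j + Z.of_nat c * nz)%Z = tk j + IZR (Z.of_nat c) * P).
    { induction c; intros j0. simpl. replace (j0 + 0)%Z with j0 by lia. ring.
      rewrite Nat2Z.inj_succ, succ_IZR.
      replace (j0 + Z.succ (Z.of_nat c) * nz)%Z with (j0 + Z.of_nat c * nz + nz)%Z by lia.
      unfold nz at 2. rewrite HtkP, IHc. ring. }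
    destruct (Z_le_dec 0 d) as [Hd|Hd].
    - rewrite <- (Z2Nat.id d Hd). apply H.
    - pose proof (H (Z.to_nat (- d)) (j + d * nz)%Z) as E. rewrite Z2Nat.id in E by lia.
      replace (j + d * nz + - d * nz)%Z with j in E by lia. rewrite E, opp_IZR. ring. }
  assert (Hld : forall d j z e, l (j + d * nz)%Z z e = l j z e).
  { intros d j z e.
    assert (H : forall (c : nat) j, l (j + Z.of_nat c * nz)%Z z e = l j z e).
    { induction c; intros j0. f_equal. lia.
      replace (j0 + Z.of_nat (S c) * nz)%Z with (j0 + Z.of_nat c * nz + nz)%Z by lia.
      unfold nz at 2. now rewrite Hlper. }
    destruct (Z_le_dec 0 d) as [Hd|Hd].
    - rewrite <- (Z2Nat.id d Hd). apply H.
    - rewrite <- (H (Z.to_nat (- d)) (j + d * nz)%Z). f_equal. lia. }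
  set (XX k t := X (jj k) (t + IZR (- dd k) * P)).
  set (YY k := y (jj k)).
  assert (Hta : forall k, tk k + IZR (- dd k) * P = tn (jj k)).
  { intros k. rewrite (Hk k) at 1. rewrite Htkd, opp_IZR. unfold tn. ring. }
  assert (Htb : forall k, tk (k + 1)%Z + IZR (- dd k) * P = tn (S (jj k))).
  { intros k. rewrite (Hk k) at 1.
    replace (Z.of_nat (jj k) + dd k * nz + 1)%Z with (Z.of_nat (S (jj k)) + dd k * nz)%Z by lia.
    rewrite Htkd, opp_IZR. unfold tn. ring. }
  assert (Hjump : forall k, XX k (tk k) = plus (YY k : R2) (scal eps (l k (YY k) eps : R2))).
  { intros k. unfold XX, YY. rewrite Hta. destruct (HX (jj k) (Hjj k)) as (J & _ & _).
    rewrite J. unfold jump. rewrite boxclamp_id by (apply Hyb, Hjj).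
    assert (El : l k (y (jj k)) eps = ln (jj k) (y (jj k)) eps).
    { rewrite (Hk k) at 1. apply Hld. }
    rewrite El. reflexivity. }
  assert (Hcont : forall k t, tk k <= t <= tk (k + 1)%Z -> continuous (XX k) t).
  { intros k t Ht. unfold XX. destruct (HX (jj k) (Hjj k)) as (_ & [Sc _] & _).
    apply (continuous_comp (fun t => t + IZR (- dd k) * P) (X (jj k))).
    apply continuous_Rplus. apply continuous_id. apply continuous_const.
    apply Sc. rewrite <- Hta, <- Htb. lra. }
  assert (Hder : forall k t, tk k < t < tk (k + 1)%Z ->
    is_derive (V := R2) (XX k) t (plus (f (XX k t) : R2) (scal eps (g t (XX k t) eps : R2)))).
  { intros k t Ht. unfold XX. destruct (HX (jj k) (Hjj k)) as (_ & [_ Sd] & _).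
    set (s := t + IZR (- dd k) * P).
    assert (Hs : tn (jj k) < s < tn (S (jj k))) by (unfold s; rewrite <- Hta, <- Htb; lra).
    specialize (Sd s Hs). unfold cutfield in Sd.
    rewrite boxclamp_id in Sd by (apply HXb; [apply Hjj | lra]). simpl in Sd.
    assert (Eg : g t (X (jj k) s) eps = g s (X (jj k) s) eps).
    { symmetry. apply (periodic_Z (fun t => g t (X (jj k) s) eps) P). intros; apply Hgper. }
    rewrite Eg. destruct Sd as [D1 D2].
    assert (Dp : is_derive (V := R2) (X (jj k)) s (fst (f (X (jj k) s)) + eps * fst (g s (X (jj k) s) eps),
       snd (f (X (jj k) s)) + eps * snd (g s (X (jj k) s) eps))).
    { apply is_derive_ext with (fun s => (fst (X (jj k) s), snd (X (jj k) s))).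
      intros u. symmetry. apply surjective_pairing.
      now apply (is_derive_pair (U := R_NormedModule) (W := R_NormedModule)). }
    assert (Dl : is_derive (fun t => t + IZR (- dd k) * P) t 1) by (auto_derive; trivial; ring).
    pose proof (is_derive_comp (V := R2) (X (jj k)) (fun t => t + IZR (- dd k) * P) t _ 1 Dp Dl) as DD.
    rewrite (scal_one (K := R_AbsRing)) in DD. exact DD. }
  assert (Hyy : forall k, XX k (tk (k + 1)%Z) = YY (k + 1)%Z).
  { intros k. unfold XX, YY. rewrite Htb. destruct (HX (jj k) (Hjj k)) as (_ & _ & E). rewrite E.
    destruct (Nat.eq_dec (S (jj k)) n) as [En|En].
    - rewrite En, Hyn. f_equal. unfold jj.
      replace (k + 1)%Z with (0 + (dd k + 1) * nz)%Z by (pose proof (Hk k); unfold nz in *; lia).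
      rewrite Z.mod_add by lia. now rewrite Z.mod_0_l by lia.
    - f_equal. unfold jj at 2.
      replace (k + 1)%Z with (Z.of_nat (S (jj k)) + dd k * nz)%Z by (pose proof (Hk k); lia).
      rewrite Z.mod_add by lia. specialize (Hjj k). rewrite Z.mod_small by (unfold nz; lia). lia. }
  assert (Hper : forall k t, XX (k + nz)%Z (t + P) = XX k t).
  { intros k t. unfold XX, jj, dd. replace (k + nz)%Z with (k + 1 * nz)%Z by lia.
    rewrite Z.mod_add, Z.div_add by lia. f_equal. rewrite !opp_IZR, plus_IZR. ring. }
  exists (glue tk XX). split; [|split].
  - now apply (glue_solution tk Htk f g l eps XX YY).
  - now apply (glue_periodic tk Htk P nz XX).
  - intros t. destruct (impulse_index_exists tk Htk t) as [j Hj].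
    assert (Hj' : tk (j - 1)%Z < t <= tk (j - 1 + 1)%Z) by now replace (j - 1 + 1)%Z with j by lia.
    exists (jj (j - 1)%Z), (t + IZR (- dd (j - 1)%Z) * P), (dd (j - 1)%Z).
    split; [apply Hjj|]. split; [|split].
    + rewrite <- Hta, <- Htb. lra.
    + apply (glue_eq tk Htk XX (j - 1)%Z t Hj').
    + rewrite opp_IZR. ring.
Qed.

(** The two rows have determinant [- c] by [of_det], so Cramer's rule applies. *)
Lemma weights_independent c t h (x y : R * R) : V h -> c <> 0 ->
  rowdiff (energy_weight t h) x y = 0 -> rowdiff (phase_weight c t h) x y = 0 -> x = y.
Proof.
  intros Hh Hc H1 H2. pose proof (of_det HO t h Hh) as Hdet.
  unfold rowdiff, energy_weight, phase_weight in H1, H2. simpl in H1, H2.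
  set (f1 := fst (f (q t h))) in *. set (f2 := snd (f (q t h))) in *.
  set (u := fst x - fst y) in *. set (v := snd x - snd y) in *.
  assert (H2' : p2 (t, h) * u - p1 (t, h) * v = 0).
  { apply (Rmult_eq_reg_l c); trivial. rewrite Rmult_0_r, <- H2. ring. }
  assert (Hu : u = 0).
  { transitivity (u * (f1 * p2 (t, h) - f2 * p1 (t, h))). rewrite Hdet; ring.
    transitivity (f1 * (p2 (t, h) * u - p1 (t, h) * v) + p1 (t, h) * (- f2 * u + f1 * v)). ring.
    rewrite H1, H2'. ring. }
  assert (Hv : v = 0).
  { transitivity (v * (f1 * p2 (t, h) - f2 * p1 (t, h))). rewrite Hdet; ring.
    transitivity (f2 * (p2 (t, h) * u - p1 (t, h) * v) + p2 (t, h) * (- f2 * u + f1 * v)). ring.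
    rewrite H1, H2'. ring. }
  apply injective_projections; unfold u, v in *; lra.
Qed.

(** The increments divided by [eps] are continuous in [(t0, r)] and close to the linear parts of the
    Melnikov functions, so they vanish together at some point near [(t0, h0)]. There the trajectory
    closes up and extends to a periodic solution. *)
Lemma melnikov_sufficient (c t0 h0 A1 A2 B1 B2 : R) : c <> 0 -> V h0 ->
  melnikov_fixed energy_weight q g tk l n (t0, h0) = 0 ->
  melnikov_fixed (phase_weight c) q g tk l n (t0, h0) = 0 ->
  expands (melnikov_fixed energy_weight q g tk l n) (t0, h0) A1 A2 ->
  expands (melnikov_fixed (phase_weight c) q g tk l n) (t0, h0) B1 B2 ->
  A1 * B2 - A2 * B1 <> 0 ->
  exists (eps0 : R) (x : R -> R -> R * R), 0 < eps0 /\
    (forall eps, 0 < Rabs eps < eps0 ->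
       is_solution f g tk l eps (x eps) /\ forall t, x eps (t + P) = x eps t) /\
    (forall t, filterlim (fun eps => x eps t) (locally' 0) (locally (q (t - t0) h0))).
Proof.
  intros Hc Hh HM HN EM EN Hdet. set (u0 := (t0, h0)) in *.
  set (wM := energy_weight) in *. set (wN := phase_weight c) in *.
  assert (GM : adjoint_weight wM) by apply energy_weight_good.
  assert (GN : adjoint_weight wN) by apply phase_weight_good.
  destruct (compact_subinterval h0 Hh) as (rho0 & Hrho0 & HVr).
  destruct (perturbed_trajectories (t0 - 1) (t0 + 1) (h0 - rho0) (h0 + rho0) HVr)
    as (B0 & C & HB0 & HC & HQbox & Hclose & Hmel & Hex).
  set (Kp := rect (t0 - 1) (t0 + 1) (h0 - rho0) (h0 + rho0)) in *.
  (* Parameters whose initial point lies on a closed trajectory. Naming the set lets the choice of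
     one element be postponed until it can be made close to [u0]. *)
  set (Zero := fun eps p => Kp p /\ exists y X,
         traj B0 eps y X /\ y O = Q p (tn O) /\ y n = y O).
  assert (HKV : forall p, Kp p -> V (snd p)) by (intros p [_ Hr]; now apply HVr).
  assert (S1 : forall rho, 0 < rho -> exists del, 0 < del /\ forall eps, 0 < Rabs eps < del ->
     exists p, Zero eps p /\ dist1 p u0 <= 2 * rho).
  { destruct (perturbed_linear_zero A1 A2 B1 B2 Hdet) as (ka & Hka & Hzero).
    assert (Hk4 : 0 < ka / 4) by lra.
    destruct (EM _ Hk4) as (r1 & Hr1 & K1). destruct (EN _ Hk4) as (r2 & Hr2 & K2).
    intros rho Hrho.
    destruct (common_radius rho 1 rho0 (r1 / 2) (r2 / 2))
      as (r & Hr0 & Hra & Hrb & Hrc & Hrd & Hre); try lra.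
    (* The tolerance [ka r] is halved between the distance from increments to Melnikov functions and
       that from Melnikov functions to their linear parts. *)
    assert (Hkr : 0 < ka * r / 2) by (apply Rmult_lt_0_compat; [apply Rmult_lt_0_compat|]; lra).
    destruct (Hmel wM _ GM Hkr) as (e1 & He1 & M1). destruct (Hmel wN _ GN Hkr) as (e2 & He2 & M2).
    exists (Rmin 1 (Rmin e1 e2)). split. repeat apply Rmin_pos; lra.
    intros eps [Hp He]. pose proof (Rmin_l 1 (Rmin e1 e2)). pose proof (Rmin_r 1 (Rmin e1 e2)).
    pose proof (Rmin_l e1 e2). pose proof (Rmin_r e1 e2).
    assert (Hne : eps <> 0) by (intros ->; rewrite Rabs_R0 in Hp; lra).
    destruct (Hex eps ltac:(lra)) as (Y & X & HYX).
    set (F w p := rowdiff (shifted w p (tn n)) (Y (Q p (tn O)) n) (Q p (tn n)) / eps).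
    assert (Hin : forall p, Rabs (fst p - t0) <= r -> Rabs (snd p - h0) <= r -> Kp p).
    { intros p X1 X2. apply Rabs_le_between in X1. apply Rabs_le_between in X2. split; lra. }
    assert (HFc : forall w p, adjoint_weight w -> Kp p -> continuous (F w) p).
    { intros w p Hw Hp'. pose proof (HKV p Hp') as HVp.
      assert (Cw : continuous (fun p => shifted w p (tn n)) p)
        by now apply shifted_continuous, w_continuous.
      assert (CQ : forall t, continuous (fun p => Q p t) p)
        by (intros; now apply shifted_continuous, q_continuous).
      assert (CY : continuous (fun p => Y (Q p (tn O)) n) p).
      { apply (continuous_comp (fun p => Q p (tn O)) (fun y => Y y n)). apply CQ.
        now apply HYX. }
      unfold F, rowdiff, Rdiv. apply continuous_Rmult; [|apply continuous_const].
      apply continuous_Rplus; apply continuous_Rmult.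
      - now apply continuous_fst_comp.
      - apply continuous_Rminus; now apply continuous_fst_comp.
      - now apply continuous_snd_comp.
      - apply continuous_Rminus; now apply continuous_snd_comp. }
    assert (HFe : forall w p eta, Rabs (rowdiff (shifted w p (tn n)) (Y (Q p (tn O)) n) (Q p (tn n))
             - eps * melnikov_fixed w q g tk l n p) <= eta * Rabs eps ->
          Rabs (F w p - melnikov_fixed w q g tk l n p) <= eta).
    { intros w p eta HE. unfold F. apply (Rmult_le_reg_r (Rabs eps)); trivial.
      rewrite <- Rabs_mult. apply Rle_trans with (2 := HE). right. f_equal. field. exact Hne. }
    destruct (Hzero (F wM) (F wN) t0 h0 r Hr0) as (p & P1 & P2 & Z1 & Z2).
    - intros p X1 X2. pose proof (Hin p X1 X2) as Hp'.
      destruct (HYX (Q p (tn O))) as (T1 & T2 & _).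
      pose proof (HFe wM p _ (M1 eps p _ _ ltac:(lra) Hp' T1 T2)) as FM.
      pose proof (HFe wN p _ (M2 eps p _ _ ltac:(lra) Hp' T1 T2)) as FN.
      specialize (K1 p ltac:(simpl; lra) ltac:(simpl; lra)).
      specialize (K2 p ltac:(simpl; lra) ltac:(simpl; lra)).
      rewrite HM in K1. rewrite HN in K2. simpl in K1, K2.
      assert (Hdd : dist1 p u0 <= 2 * r) by (unfold dist1; simpl; lra).
      assert (Hkd : ka / 4 * dist1 p u0 <= ka * r / 2) by nra.
      split; [now apply HFc|]. split; [now apply HFc|].
      rewrite Rminus_0_r in K1, K2. split.
      + replace (F wM p - _) with ((F wM p - melnikov_fixed wM q g tk l n p)
          + (melnikov_fixed wM q g tk l n p - ((fst p - t0) * A1 + (snd p - h0) * A2))) by ring.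
        apply Rle_trans with (1 := Rabs_triang _ _). lra.
      + replace (F wN p - _) with ((F wN p - melnikov_fixed wN q g tk l n p)
          + (melnikov_fixed wN q g tk l n p - ((fst p - t0) * B1 + (snd p - h0) * B2))) by ring.
        apply Rle_trans with (1 := Rabs_triang _ _). lra.
    - exists p. pose proof (Hin p P1 P2) as Hp'. pose proof (HKV p Hp') as HVp. split.
      + split; trivial. destruct (HYX (Q p (tn O))) as (T1 & T2 & _).
        exists (Y (Q p (tn O))), (X (Q p (tn O))). split; [|split]; trivial.
        (* Both weighted differences vanish, so the trajectory ends where the reference orbit ends,
           which is where both started. *)
        transitivity (Q p (tn n)); [|rewrite T2; now apply Q_period].
        apply (weights_independent c (tn n - fst p) (snd p)); trivial.
        * unfold F in Z1. apply (Rmult_eq_reg_r (/ eps)); [|now apply Rinv_neq_0_compat].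
          rewrite Rmult_0_l. exact Z1.
        * unfold F in Z2. apply (Rmult_eq_reg_r (/ eps)); [|now apply Rinv_neq_0_compat].
          rewrite Rmult_0_l. exact Z2.
      + unfold dist1. simpl. lra. }
  destruct (S1 1 Rlt_0_1) as (e1 & He1 & Hne1).
  pose proof (Rinv_0_lt_compat C HC) as HiC.
  (* The bound [/ C] keeps trajectories within distance 1 of the reference orbit, so that they solve
     the original system. *)
  destruct (common_radius e1 1 (/ C) 1 1) as (eps0 & H0 & H0a & H0b & H0c & _); try lra.
  (* the zero is chosen nearly as close to [u0] as possible, so that it converges to [u0] *)
  assert (S2 : forall eps, exists xp : (R -> R * R) * (R * R), 0 < Rabs eps < eps0 ->
     is_solution f g tk l eps (fst xp) /\ (forall t, fst xp (t + P) = fst xp t) /\ Kp (snd xp) /\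
     (forall p, Zero eps p -> dist1 (snd xp) u0 <= dist1 p u0 + Rabs eps) /\
     forall t, dist1 (fst xp t) (Q (snd xp) t) <= C * Rabs eps).
  { intros eps. destruct (classic (0 < Rabs eps < eps0)) as [He|He].
    (* Dummy values for [eps] outside the range, needed only to apply choice. *)
    2: { exists (fun _ => u0, u0). tauto. }
    destruct (near_minimizer (Zero eps) (fun p => dist1 p u0) (Rabs eps)) as (p & Hp & Hmin).
    { apply He. } { intros; apply dist1_pos. }
    { destruct (Hne1 eps ltac:(lra)) as (p & Hp & _). now exists p. }
    destruct Hp as (Hp & y & X & HX & Hy0 & Hyn).
    assert (HCe : C * Rabs eps <= 1).
    { apply Rle_trans with (C * / C). apply Rmult_le_compat_l; lra. right. field. lra. }
    pose proof (Hclose eps p y X ltac:(lra) Hp HX Hy0) as Hcl.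
    assert (HXb : forall j t, (j < n)%nat -> tn j <= t <= tn (S j) -> box (B0 + 1) (X j t)).
    { intros j t Hj Ht. apply (box_near B0 (Q p t)).
      - apply HQbox; trivial. pose proof (tn_mono tn tn_lt O j ltac:(lia)).
        pose proof (tn_mono tn tn_lt (S j) n ltac:(lia)). lra.
      - specialize (Hcl j t Hj Ht). lra. }
    destruct (trajectory_extend eps B0 y X HX Hyn HXb) as (x & Hx1 & Hx2 & Hx3).
    { intros [|j] Hj.
      - rewrite Hy0. apply (box_near B0 (Q p (tn O))); [|rewrite dist1_refl; lra].
        apply HQbox; trivial. pose proof (tn_mono tn tn_lt O n ltac:(lia)). lra.
      - destruct (HX j ltac:(lia)) as (_ & _ & E). rewrite <- E. apply HXb. lia.
        pose proof (tn_lt j). lra. }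
    exists (x, p). intros _. simpl. split; [|split; [|split; [|split]]]; trivial.
    intros t. destruct (Hx3 t) as (j & t' & k & Hj & Ht' & E1 & E2).
    (* The reference orbit has period [P] too, which carries the estimate from the window to every
       [t]. *)
    rewrite E1. assert (EQ : Q p t = Q p t').
    { rewrite E2. apply (periodic_Z (fun s => Q p s) P). apply per_P. intros s.
      unfold Q, shifted. replace (s + T0 - fst p) with (s - fst p + T0) by ring.
      now apply Hqper, HKV. }
    rewrite EQ. now apply Hcl. }
  destruct (choice _ S2) as [xp Hxp].
  exists eps0, (fun eps => fst (xp eps)). split; [trivial|]. split.
  { intros eps He. destruct (Hxp eps He) as (X1 & X2 & _). now split. }
  intros t. apply filterlim_locally. intros e. pose proof (cond_pos e) as Pe.
  assert (CQ : continuous (fun p => Q p t) u0) by now apply shifted_continuous, q_continuous.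
  assert (He2 : 0 < e / 2) by lra.
  destruct (proj1 (filterlim_locally _ _) CQ (mkposreal _ He2)) as [d Hd]. pose proof (cond_pos d) as Pd.
  destruct (S1 (d / 4) ltac:(lra)) as (e2 & He2' & Hn2).
  assert (HeC : 0 < e / (2 * C)) by (apply Rdiv_lt_0_compat; lra).
  destruct (common_radius eps0 e2 (d / 4) (e / (2 * C)) 1)
    as (del & Hl0 & Hla & Hlb & Hlcc & Hld & _); try lra.
  exists (mkposreal del Hl0). intros eps Hb Hne.
  assert (Ha : 0 < Rabs eps < del).
  { split. now apply Rabs_pos_lt. change (Rabs (eps - 0) < del) in Hb. now rewrite Rminus_0_r in Hb. }
  destruct (Hxp eps ltac:(lra)) as (_ & _ & _ & Hmin & Hcl).
  destruct (Hn2 eps ltac:(lra)) as (p' & Hp' & Hdp'). specialize (Hmin p' Hp').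
  (* Some zero lies within [d / 2] of [u0], and the chosen one is farther by at most
     [|eps| < d / 4]. *)
  assert (Hdp : dist1 (snd (xp eps)) u0 < d) by lra.
  replace (pos e) with (e / 2 + e / 2) by field.
  apply ball_triangle with (Q (snd (xp eps)) t).
  - apply (Hd (snd (xp eps))). now apply dist1_ball.
  - apply dist1_ball. apply Rle_lt_trans with (1 := Hcl t).
    replace (e / 2) with (C * (e / (2 * C))) by (field; lra). apply Rmult_lt_compat_l; lra.
Qed.

End Main.

(** * From the stated hypotheses to those of the section *)

Lemma Z_periods (A : Type) (F : Z -> A) (step : A -> A) (d : Z) :
  (forall k, F (k + d)%Z = step (F k)) ->
  forall (c : nat) k, F (k + Z.of_nat c * d)%Z = Nat.iter c step (F k).
Proof.
  intros HF. induction c; intros k.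
  - change (F (k + 0 * d)%Z = F k). f_equal. lia.
  - replace (k + Z.of_nat (S c) * d)%Z with (k + Z.of_nat c * d + d)%Z by lia.
    simpl. now rewrite HF, IHc.
Qed.

(** The infimum is extended-valued, and [real] would send an infinite one to 0, so finiteness is
    shown before a near point is extracted. Both coordinates are below the norm, whence the factor 2
    for [dist1]. *)
Lemma dist_to_lt (L : R * R -> Prop) (x : R * R) (eta : R) :
  (exists y, L y) -> dist_to L x < eta -> exists y, L y /\ dist1 x y < 2 * eta.
Proof.
  intros [y0 Hy0] Hd. unfold dist_to in Hd.
  set (S0 := fun d => exists y, L y /\ d = norm (minus (x : R2) y)) in *.
  destruct (Glb_Rbar_correct S0) as [H1 H2].
  assert (Hfin : is_finite (Glb_Rbar S0)).
  { apply is_finite_correct.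
    assert (B1 : Rbar_le 0 (Glb_Rbar S0)).
    { apply H2. intros d (y & _ & ->). apply (norm_ge_0 (V := R2)). }
    assert (B2 : Rbar_le (Glb_Rbar S0) (norm (minus (x : R2) y0))).
    { apply H1. now exists y0. }
    destruct (Glb_Rbar S0) as [r| |]; simpl in *; [now exists r | contradiction | contradiction]. }
  apply NNPP. intros Hn.
  assert (Hle : Rbar_le eta (Glb_Rbar S0)).
  { apply H2. intros d (y & Hy & ->). simpl. apply Rnot_lt_le. intros Hlt. apply Hn.
    exists y. split; trivial.
    pose proof (norm_le_prod_norm_1 (K := R_AbsRing) (minus (x : R2) y)) as N1.
    pose proof (norm_le_prod_norm_2 (K := R_AbsRing) (minus (x : R2) y)) as N2.
    change (Rabs (fst x - fst y) <= norm (minus (x : R2) y)) in N1.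
    change (Rabs (snd x - snd y) <= norm (minus (x : R2) y)) in N2.
    unfold dist1. replace (2 * eta) with (eta + eta) by ring.
    apply Rplus_lt_compat; [exact (Rle_lt_trans _ _ _ N1 Hlt) | exact (Rle_lt_trans _ _ _ N2 Hlt)]. }
  rewrite <- Hfin in Hle. exact (Rlt_not_le _ _ Hd Hle).
Qed.

Lemma sup_dist_lt (q : R -> R -> R * R) (h eta : R) (x : R -> R * R) :
  Rbar_lt (sup_dist x (orbit q h)) eta ->
  forall t, exists t', dist1 (x t) (q t' h) < 2 * eta.
Proof.
  intros Hs t. destruct (dist_to_lt (orbit q h) (x t) eta) as (y & [t' ->] & Hy).
  - exists (q 0 h). now exists 0.
  - destruct (Lub_Rbar_correct (fun d => exists t, d = dist_to (orbit q h) (x t))) as [H1 _].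
    specialize (H1 _ (ex_intro _ t eq_refl)).
    exact (Rbar_le_lt_trans (dist_to (orbit q h) (x t)) _ eta H1 Hs).
  - now exists t'.
Qed.

Theorem theorem3p2
  (r0 r1 : nat) (hr0 : (3 <= r0)%nat) (hr1 : (4 <= r1)%nat)
  (H : R * R -> R) (f : R * R -> R * R) (g : R -> R * R -> R -> R * R)
  (hH : Ck r1 H) (hf : Ck r0 f)
  (hg : Ck r0 (fun u : R * (R * R) * R => g (fst (fst u)) (snd (fst u)) (snd u)))
  (hfH : forall x, f x = hamiltonian_field H x)
  (T1 : R) (hT1 : 0 < T1)
  (hgT1 : forall t x eps, g (t + T1) x eps = g t x eps)
  (V : R -> Prop) (hV : is_open_interval V)
  (Th : R -> R) (q : R -> R -> R * R) (hq : periodic_family r0 H f V Th q)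
  (alpha : R -> R -> R * R) (halpha : is_alpha V (Gmap Th q) alpha)
  (tk : Z -> R) (l : Z -> R * R -> R -> R * R) (htk : impulse_times tk)
  (T2 : R) (nu : nat) (hT2 : 0 < T2) (hnu : (1 <= nu)%nat)
  (htkT2 : forall k : Z, tk (k + Z.of_nat nu)%Z - tk k = T2)
  (hlnu : forall (k : Z) x eps, l (k + Z.of_nat nu)%Z x eps = l k x eps)
  (p s : nat) (hp : (1 <= p)%nat) (hs : (1 <= s)%nat) (hps : Nat.gcd p s = 1%nat)
  (hT21 : T2 / T1 = INR p / INR s)
  (T : R) (hTp : T = INR p * T1) (hTs : T = INR s * T2)
  (hlCk : forall (k : Z) (eps : R), Ck r0 (fun x : R * R => l k x eps))
  (hlcont : forall (k : Z) (z : R * R * R),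
     continuous (fun z : R * R * R => l k (fst z) (snd z)) z)
  (T0 : R) (hT0 : forall h, V h -> Th h = T0)
  (m K : nat) (hm : (1 <= m)%nat) (hK : (1 <= K)%nat) (hmK : Nat.gcd m K = 1%nat)
  (hres : T0 / T = INR m / INR K) :
  let M := melnikovM H q g tk l (INR m * T) (m * s * nu) in
  let N := melnikovN alpha T0 q g tk l (INR m * T) (m * s * nu) in
  (forall hhat : R, V hhat ->
     (exists (eps1 : R) (x : R -> R -> R * R),
        0 < eps1 /\
        (forall eps, 0 < Rabs eps < eps1 ->
           is_subharmonic f g tk l T m eps (x eps)) /\
        (forall eta, 0 < eta -> exists delta, 0 < delta /\
           forall eps, 0 < Rabs eps < delta ->
             Rbar_lt (sup_dist (x eps) (orbit q hhat)) eta)) ->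
     exists t0 h0, 0 <= t0 <= T0 /\ V h0 /\ M t0 h0 = 0 /\ N t0 h0 = 0)
  /\
  (forall t0 h0 : R, 0 <= t0 <= T0 -> V h0 -> M t0 h0 = 0 -> N t0 h0 = 0 ->
     det2 (Derive (fun t => M t h0) t0) (Derive (fun r => M t0 r) h0)
          (Derive (fun t => N t h0) t0) (Derive (fun r => N t0 r) h0) <> 0 ->
     exists (eps0 : R) (x : R -> R -> R * R),
       0 < eps0 /\
       (forall eps, 0 < Rabs eps < eps0 ->
          is_subharmonic f g tk l T m eps (x eps)) /\
       (forall t, filterlim (fun eps => x eps t) (locally' 0)
                    (locally (q (t - t0) h0)))).
Proof.
  intros M N.
  set (P := INR m * T) in *. set (n := (m * s * nu)%nat) in *.
  assert (Im : 1 <= INR m) by (apply le_INR in hm; exact hm).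
  assert (Ip : 1 <= INR p) by (apply le_INR in hp; exact hp).
  assert (IK : 1 <= INR K) by (apply le_INR in hK; exact hK).
  assert (HT : 0 < T) by (rewrite hTp; apply Rmult_lt_0_compat; lra).
  (* The resonance condition: [m] periods of the system are [K] periods of every orbit. *)
  assert (HP : P = INR K * T0).
  { unfold P. transitivity (T0 / T * T * INR K). rewrite hres. field. lra. field. lra. }
  assert (Hn : (1 <= n)%nat) by (unfold n; apply Nat.le_succ_l; repeat apply Nat.mul_pos_pos; lia).
  assert (En : Z.of_nat n = (Z.of_nat (m * s) * Z.of_nat nu)%Z) by (unfold n; apply Nat2Z.inj_mul).
  assert (HtkP : forall k, tk (k + Z.of_nat n)%Z = tk k + P).
  (* One shift by [nu] impulses adds [T2], and [m s] such shifts add [m s T2 = m T]. *)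
  { intros k. rewrite En, (Z_periods R tk (fun t => t + T2)).
    - assert (Hit : forall c t, Nat.iter c (fun t => t + T2) t = t + INR c * T2).
      { induction c; intros t. simpl. ring. rewrite S_INR. simpl. rewrite IHc. ring. }
      rewrite Hit, mult_INR. unfold P. rewrite hTs. ring.
    - intros j. rewrite <- (htkT2 j). ring. }
  assert (HlP : forall k x e, l (k + Z.of_nat n)%Z x e = l k x e).
  { intros k x e. rewrite En, (Z_periods _ (fun k => l k x e) (fun y => y)).
    - generalize (m * s)%nat. induction n0; trivial.
    - intros j. apply hlnu. }
  assert (HgP : forall t x e, g (t + P) x e = g t x e).
  { intros t x e. unfold P. rewrite hTp.
    replace (t + INR m * (INR p * T1)) with (t + IZR (Z.of_nat (m * p)) * T1)
      by (rewrite <- INR_IZR_INZ, mult_INR; ring).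
    apply (periodic_Z (fun t => g t x e) T1). intros; apply hgT1. }
  destruct r0 as [|r0]; [lia|].
  assert (Hgc : forall z : R * (R * R) * R,
     continuous (fun z => g (fst (fst z)) (snd (fst z)) (snd z)) z).
  { intros z. exact (Ck_on_continuous (U := prod_NormedModule R_AbsRing R3 R_NormedModule) (W := R2)
       _ _ _ z hg I). }
  destruct (perturbation_regular r0 (fun u => fst (g (fst (fst u)) (snd (fst u)) (snd u))))
    as (Hg1 & d11 & d12 & Hgp1 & Hd11 & Hd12).
  { exact (Ck_on_fst (U := prod_NormedModule R_AbsRing R3 R_NormedModule)
      (V := R_NormedModule) (W := R_NormedModule) _ _ _ hg). }
  destruct (perturbation_regular r0 (fun u => snd (g (fst (fst u)) (snd (fst u)) (snd u))))
    as (Hg2 & d21 & d22 & Hgp2 & Hd21 & Hd22).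
  { exact (Ck_on_snd (U := prod_NormedModule R_AbsRing R3 R_NormedModule)
      (V := R_NormedModule) (W := R_NormedModule) _ _ _ hg). }
  assert (HTr : open (fun _ : R * R => True)) by apply open_true.
  assert (Hl1 : forall k, C1_real R2 (fun _ => True) (fun x => fst (l k x 0))).
  { intros k. apply (Ck_C1_R2 r0); trivial.
    exact (Ck_on_fst (U := R2) (V := R_NormedModule) (W := R_NormedModule) _ _ _ (hlCk k 0)). }
  assert (Hl2 : forall k, C1_real R2 (fun _ => True) (fun x => snd (l k x 0))).
  { intros k. apply (Ck_C1_R2 r0); trivial.
    exact (Ck_on_snd (U := R2) (V := R_NormedModule) (W := R_NormedModule) _ _ _ (hlCk k 0)). }
  pose proof hq as (HTh & _ & Hqper & _).
  assert (Hqp : forall t h, V h -> q (t + T0) h = q t h).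
  { intros t h Hh. rewrite <- (hT0 h Hh). now apply Hqper. }
  set (Om := 2 * PI / T0).
  (* Positivity of [T0] is known only once some [h] in [V] is given, so the orbit data are built
     from such an [h]. *)
  assert (Hset : forall h, V h -> 0 < T0 /\ exists a11 a12 a21 a22 p1 p2,
     orbit_family V f q a11 a12 a21 a22 p1 p2 /\
     adjoint_weight V q a11 a12 a21 a22 T0 (energy_weight f q) /\
     adjoint_weight V q a11 a12 a21 a22 T0 (phase_weight p1 p2 Om) /\
     (forall t r, V r -> M t r = melnikov_fixed (energy_weight f q) q g tk l n (t, r)) /\
     (forall t r, V r -> N t r = melnikov_fixed (phase_weight p1 p2 Om) q g tk l n (t, r))).
  { intros h Hh.
    assert (HT0 : 0 < T0) by (rewrite <- (hT0 h Hh); auto).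
    split; trivial.
    destruct (orbit_family_exists (S r0) r1 H f V Th q T0) as (a11 & a12 & a21 & a22 & p1 & p2 & HO);
      trivial.
    exists a11, a12, a21, a22, p1, p2.
    pose proof (energy_weight_good f V q a11 a12 a21 a22 p1 p2 T0 HO Hqp) as GM.
    pose proof (phase_weight_good f V q a11 a12 a21 a22 p1 p2 T0 hV HO Hqp Om) as GN.
    split; [|split; [|split; [|split]]]; trivial.
    - intros t r Hr.
      rewrite <- (melnikov_is_fixed f g V q tk l a11 a12 a21 a22 p1 p2 T0 P n K); trivial.
      apply melnikov_ext. intros u. now apply grad_of_field.
    - intros t r Hr.
      rewrite <- (melnikov_is_fixed f g V q tk l a11 a12 a21 a22 p1 p2 T0 P n K); trivial.
      apply melnikov_ext. intros u. now apply (alpha_formula V f Th q T0 alpha a11 a12 a21 a22). }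
  split.
  - intros hhat Hh (eps1 & x & Heps1 & Hsub & Hnear).
    destruct (Hset hhat Hh) as (HT0 & a11 & a12 & a21 & a22 & p1 & p2 & HO & GM & GN & EM & EN).
    destruct (melnikov_necessary f g V q tk l a11 a12 a21 a22 p1 p2 T0 P n K d11 d12 d21 d22)
      with (w1 := energy_weight f q) (w2 := phase_weight p1 p2 Om) (hhat := hhat) (eps1 := eps1) (x := x)
      as (t0 & Ht0 & Z1 & Z2); trivial.
    + intros eta Heta. destruct (Hnear (eta / 2) ltac:(lra)) as (del & Hdel & Hd).
      exists del. split; trivial. intros eps He t.
      destruct (sup_dist_lt q hhat (eta / 2) (x eps) (Hd eps He) t) as [t' Ht'].
      exists t'. lra.
    + exists t0, hhat. rewrite EM, EN by trivial. auto.
  - intros t0 h0 Ht0 Hh HM HN Hdet.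
    destruct (Hset h0 Hh) as (HT0 & a11 & a12 & a21 & a22 & p1 & p2 & HO & GM & GN & EM & EN).
    assert (HOm : Om <> 0).
    { apply Rgt_not_eq, Rdiv_lt_0_compat; [pose proof PI_RGT_0|]; lra. }
    destruct (melnikov_expands f g V q tk l a11 a12 a21 a22 p1 p2 T0 n K hV HO hK Hn htk Hg1 Hg2 Hl1 Hl2
       _ n (t0, h0) GM Hh) as (A1 & A2 & XM).
    destruct (melnikov_expands f g V q tk l a11 a12 a21 a22 p1 p2 T0 n K hV HO hK Hn htk Hg1 Hg2 Hl1 Hl2
       _ n (t0, h0) GN Hh) as (B1 & B2 & XN).
    destruct (open_V V hV h0 Hh) as [d Hd].
    (* Identifies the entries of the Jacobian with the expansion coefficients. In [r] the two
       functions agree only on [V], which is open, so the derivative is compared locally. *)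
    assert (Dt : forall (F : R -> R -> R) (G : R * R -> R) c1 c2,
       (forall t r, V r -> F t r = G (t, r)) -> expands G (t0, h0) c1 c2 ->
       Derive (fun t => F t h0) t0 = c1 /\ Derive (fun r => F t0 r) h0 = c2).
    { intros F G c1 c2 HF HG. split; apply is_derive_unique.
      - apply is_derive_ext with (fun t => G (t, h0)). intros t; symmetry; now apply HF.
        exact (expands_derive_1 _ _ _ _ HG).
      - apply is_derive_ext_loc with (fun r => G (t0, r)).
        exists d. intros r Hr. symmetry. now apply HF, Hd.
        exact (expands_derive_2 _ _ _ _ HG). }
    rewrite (proj1 (Dt M _ A1 A2 EM XM)), (proj2 (Dt M _ A1 A2 EM XM)),
      (proj1 (Dt N _ B1 B2 EN XN)), (proj2 (Dt N _ B1 B2 EN XN)) in Hdet.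
    rewrite EM in HM by trivial. rewrite EN in HN by trivial.
    exact (melnikov_sufficient f g V q tk l a11 a12 a21 a22 p1 p2 T0 P n K d11 d12 d21 d22
      hV HO HP hK Hn Hqp htk HtkP HlP HgP Hgc Hgp1 Hgp2 Hd11 Hd12 Hd21 Hd22 hlcont
      Om t0 h0 A1 A2 B1 B2 HOm Hh HM HN XM XN Hdet).
Qed.
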